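(* Let $E \subset \mathbb{T}$ be a closed set of logarithmic capacity $0$. Then $\mathcal{U}^{\mathcal D_{nv}}_{E}$ is a dense $G_\delta$ subset of $\mathcal D_{nv}$.
   Context: The Dirichlet space $\mathcal D$ consists of holomorphic $f(z)=\sum_k a_kz^k$ on $\mathbb{D}$ with $\|f\|_{\mathcal D}^2=\sum_{k\ge0}(k+1)|a_k|^2<\infty$ (equivalently $\|f\|_{\mathcal D}^2=\frac1\pi\int_{\mathbb{D}}|f'|^2dA+\|f\|_{H^2}^2$). $\mathcal D_{nv}\subset\mathcal D$ is the set consisting of all functions in $\mathcal D$ with no zeros in $\mathbb{D}$ together with the zero function, with the metric induced by $\|\cdot\|_{\mathcal D}$ (it is a closed subset of $\mathcal D$). For $f\in\mathcal D\setminus\{0\}$, $Q_m(1/f)$ denotes the unique polynomial of degree at most $m$ minimizing $\|qf-1\|_{\mathcal D}$ over polynomials $q$ of degree at most $m$. $\mathcal{U}^{\mathcal D_{nv}}_E$ is the set of $f\in\mathcal D_{nv}\setminus\{0\}$ such that for every continuous $g:E\to\mathbb{C}$ there is a subsequence $(m_s)$ with $Q_{m_s}(1/f)\to g$ uniformly on $E$. *)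

(* Defs.v *)
From HB Require Import structures.
From mathcomp Require Import all_boot all_order all_algebra.
From mathcomp Require Import all_classical all_reals all_analysis.
From mathcomp Require Import complex.
Set Implicit Arguments.
Unset Strict Implicit.
Unset Printing Implicit Defensive.
Import Order.TTheory GRing.Theory Num.Theory.
Local Open Scope classical_set_scope.
Local Open Scope ring_scope.

Section Dirichlet.
Context {R : realType}.
Local Notation C := R[i].

Definition cabs (z : C) : R := Normc.normc z.

(* An element of the Dirichlet space is represented by its Taylor
   coefficient sequence a : nat -> C, f(z) = sum_k a_k z^k. *)

Definition dnorm2 (a : nat -> C) : \bar R :=
  (\sum_(0 <= k <oo) (((k.+1)%:R * cabs (a k) ^+ 2)%:E))%E.

Definition inD (a : nat -> C) : Prop := (dnorm2 a < +oo)%E.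

Definition ddist_lt (a b : nat -> C) (e : R) : Prop :=
  (dnorm2 (fun k => (a k - b k)%R) < (e ^+ 2)%:E)%E.

Definition series_to (a : nat -> C) (z L : C) : Prop :=
  forall e : R, 0 < e -> exists N : nat, forall n : nat, (N <= n)%N ->
    cabs (\sum_(k < n) a k * z ^+ k - L) < e.

Definition is_zero_fun (a : nat -> C) : Prop := forall k, a k = 0.

Definition zero_free (a : nat -> C) : Prop :=
  forall z : C, cabs z < 1 -> ~ series_to a z 0.

Definition inDnv (a : nat -> C) : Prop :=
  inD a /\ (is_zero_fun a \/ zero_free a).

Definition pmul (q : {poly C}) (a : nat -> C) (k : nat) : C :=
  \sum_(i < k.+1) q`_i * a (k - i)%N.

Definition qf_minus1 (q : {poly C}) (a : nat -> C) (k : nat) : C :=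
  pmul q a k - (k == 0%N)%:R.

Definition errQ (a : nat -> C) (q : {poly C}) : \bar R := dnorm2 (qf_minus1 q a).

Definition IsQm (a : nat -> C) (m : nat) (q : {poly C}) : Prop :=
  (size q <= m.+1)%N /\
  forall p : {poly C}, (size p <= m.+1)%N -> (errQ a q <= errQ a p)%E.

(* Q_m(1/f): the (unique, for f <> 0) minimizer *)
Definition Qm (a : nat -> C) (m : nat) : {poly C} := xget 0 (IsQm a m).

Definition continuous_on (E : set C) (g : C -> C) : Prop :=
  forall z, E z -> forall e : R, 0 < e -> exists2 d : R, 0 < d &
    forall w, E w -> cabs (w - z) < d -> cabs (g w - g z) < e.

Definition unif_cvg_on (E : set C) (P : nat -> C -> C) (g : C -> C) : Prop :=
  forall e : R, 0 < e -> exists N : nat, forall n : nat, (N <= n)%N ->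
    forall z, E z -> cabs (P n z - g z) < e.

Definition UE (E : set C) (a : nat -> C) : Prop :=
  inDnv a /\ ~ is_zero_fun a /\
  forall g : C -> C, continuous_on E g ->
    exists m : nat -> nat, (forall s, (m s < m s.+1)%N) /\
      unif_cvg_on E (fun s z => (Qm a (m s)).[z]) g.

Definition dense_in_Dnv (S : set (nat -> C)) : Prop :=
  forall a, inDnv a -> forall e : R, 0 < e -> exists b, S b /\ ddist_lt a b e.

Definition open_in_Dnv (W : set (nat -> C)) : Prop :=
  (forall a, W a -> inDnv a) /\
  forall a, W a -> exists2 e : R, 0 < e &
    forall b, inDnv b -> ddist_lt a b e -> W b.

Definition Gdelta_in_Dnv (S : set (nat -> C)) : Prop :=
  exists W : nat -> set (nat -> C), (forall n, open_in_Dnv (W n)) /\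
    forall a, S a <-> (forall n, W n a).

Definition closed_in_C (E : set C) : Prop :=
  forall z, (forall e : R, 0 < e -> exists2 w, E w & cabs (z - w) < e) -> E z.

Definition in_circle (E : set C) : Prop := forall z, E z -> cabs z = 1.

(* logarithmic capacity: measures live on R*R ~ C (Borel sets of the plane) *)
Definition toC (p : R * R) : C := (p.1 +i* p.2)%C.

Definition logk (p q : R * R) : \bar R :=
  if p == q then +oo%E
  else (- ln (Num.sqrt ((p.1 - q.1) ^+ 2 + (p.2 - q.2) ^+ 2)))%:E.

Definition log_energy (mu : probability (R * R)%type R) : \bar R :=
  (\int[mu]_p \int[mu]_q logk p q)%E.

Definition log_capacity_zero (E : set C) : Prop :=
  forall mu : probability (R * R)%type R,
    mu [set p | ~ E (toC p)] = 0%E -> log_energy mu = +oo%E.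

End Dirichlet.

(* Main.v *)
Require Import Defs.
From HB Require Import structures.
From mathcomp Require Import all_boot all_order all_algebra.
From mathcomp Require Import all_classical all_reals all_analysis.
From mathcomp Require Import measurable_realfun.
From mathcomp Require cyclic separable cyclotomic.
From mathcomp Require Import complex.
From mathcomp Require Import ring lra zify.
(* If [E] has capacity zero, then for every [B] a fine enough truncation of the
   logarithmic kernel gives energy at least [B] to all finite configurations in
   [E]: otherwise an ultralimit of configurations is a probability on [E] of
   finite energy.  Potentials of near-minimizers yield polynomials that are small
   in norm, close to [1] on a piece of [E] and close to [0] on the others; the
   Douglas formula carries the smallness through Lipschitz maps.  As [E] splits
   into small pieces, every continuous nonvanishing [h] on [E] is approximated on
   [E] by a zero-free polynomial [v] with [v - 1] small in norm.  For [p] without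
   zeros on the closed disc, [Q_m(1/p)] tends to [1/p] uniformly, so replacing [p]
   by [p v] with [h = 1 / (g p)] brings [Q_m] close to [g].  In the concluding
   Baire argument the balls are centred at such polynomials [p] and have radii
   much smaller than [min |p|], which keeps the limit zero-free. *)

Set Implicit Arguments.
Unset Strict Implicit.
Unset Printing Implicit Defensive.
Import Order.TTheory GRing.Theory Num.Theory.
Import numFieldNormedType.Exports.
Local Open Scope classical_set_scope.
Local Open Scope ring_scope.

(** * Complex modulus *)

Section ComplexModulus.
Context {R : realType}.
Local Notation C := R[i].
Implicit Types z w : C.

(** Every function that is handled after the measure theory is a polynomial: exponentials are
    replaced by high powers [(1 + w / N) ^+ N], the logarithm by its Taylor polynomials. This lets
    [Q_m] be compared with explicit approximate inverses of geometric accuracy, and it turns the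
    energy of a configuration into the Dirichlet integral of its potential. The obstacle is that
    smallness in norm has to survive a nonlinear map while values on [E] move by a fixed amount; the
    norm is not controlled by suprema, hence the detour through difference quotients. A second
    obstacle is a circle among the constants: the exponent [N] depends on the peak polynomials,
    their accuracy on the coefficients in front of them, and these coefficients on [N]. It is broken
    by bounding the coefficients independently of [N]. Large energies serve twice: they make
    potentials cheap in norm, and, applied to points at equally spaced levels, they show [E] to be
    so disconnected that functions constant on its pieces are continuous. *)

Lemma cabs0 : cabs (0 : C) = 0. Proof. exact: Normc.normc0. Qed.
Lemma cabs1 : cabs (1 : C) = 1. Proof. exact: Normc.normc1. Qed.
Lemma cabsM z w : cabs (z * w) = cabs z * cabs w. Proof. exact: Normc.normcM. Qed.
Lemma cabsV z : cabs z^-1 = (cabs z)^-1. Proof. exact: Normc.normcV. Qed.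
Lemma cabsN z : cabs (- z) = cabs z. Proof. exact: normcN. Qed.
Lemma cabsD z w : cabs (z + w) <= cabs z + cabs w. Proof. exact: le_normcD. Qed.
Lemma cabsB z w : cabs (z - w) <= cabs z + cabs w.
Proof. by rewrite -(cabsN w) cabsD. Qed.
Lemma cabsBC z w : cabs (z - w) = cabs (w - z).
Proof. by rewrite -cabsN opprB. Qed.
Lemma cabs_ge0 z : 0 <= cabs z.
Proof. by case: z => a b; apply: sqrtr_ge0. Qed.
Hint Resolve cabs_ge0 : core.
Lemma cabs_eq0 z : (cabs z == 0) = (z == 0).
Proof. by apply/eqP/eqP => [/Normc.eq0_normc //|->]; rewrite cabs0. Qed.
Lemma cabs_gt0 z : (0 < cabs z) = (z != 0).
Proof. by rewrite lt_neqAle cabs_ge0 andbT eq_sym cabs_eq0. Qed.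
Lemma cabsX z n : cabs (z ^+ n) = cabs z ^+ n.
Proof. by elim: n => [|n IH]; rewrite ?expr0 ?cabs1 // !exprS cabsM IH. Qed.
Lemma cabs_sum (I : Type) (r : seq I) (P : pred I) (F : I -> C) :
  cabs (\sum_(i <- r | P i) F i) <= \sum_(i <- r | P i) cabs (F i).
Proof.
elim/big_ind2: _ => [|x a y b hx hy|//]; first by rewrite cabs0.
exact: le_trans (cabsD _ _) (lerD hx hy).
Qed.
Lemma cabs_sqr z : cabs z ^+ 2 = complex.Re z ^+ 2 + complex.Im z ^+ 2.
Proof. by case: z => a b /=; rewrite sqr_sqrtr // addr_ge0 // sqr_ge0. Qed.
Lemma cabs_real (x : R) : cabs (x%:C)%C = `|x|.
Proof. by rewrite /cabs /= expr0n /= addr0 sqrtr_sqr. Qed.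
Lemma cabs_nat n : cabs (n%:R : C) = n%:R.
Proof.
by rewrite -(rmorph_nat (real_complex R)) cabs_real ger0_norm.
Qed.
Lemma cabs_tri z w : cabs z - cabs w <= cabs (z - w).
Proof. by rewrite lerBlDr -{1}(subrK w z) cabsD. Qed.
Lemma cabs_triB z w u : cabs (z - u) <= cabs (z - w) + cabs (w - u).
Proof. by rewrite -{1}(subrK w z) -addrA cabsD. Qed.
Lemma cabsJ z : cabs (z^*)%C = cabs z.
Proof. by case: z => a b; rewrite /cabs /= sqrrN. Qed.
Lemma ReD z w : complex.Re (z + w) = complex.Re z + complex.Re w.
Proof. by case: z w => [a b] [c d]. Qed.
Lemma ImD z w : complex.Im (z + w) = complex.Im z + complex.Im w.
Proof. by case: z w => [a b] [c d]. Qed.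
Lemma ReN z : complex.Re (- z) = - complex.Re z.
Proof. by case: z. Qed.
Lemma ImN z : complex.Im (- z) = - complex.Im z.
Proof. by case: z. Qed.
Lemma Re_sum (I : Type) (r : seq I) (P : pred I) (F : I -> C) :
  complex.Re (\sum_(i <- r | P i) F i) = \sum_(i <- r | P i) complex.Re (F i).
Proof. by apply: (big_morph (@complex.Re R) ReD). Qed.
Lemma ReZ (x : R) z : complex.Re ((x%:C)%C * z) = x * complex.Re z.
Proof. by case: z => a b /=; rewrite mul0r subr0. Qed.
Lemma Re_le_cabs z : `|complex.Re z| <= cabs z.
Proof.
rewrite -(@ler_pXn2r _ 2) ?nnegrE //.
by rewrite cabs_sqr real_normK ?num_real // lerDl sqr_ge0.
Qed.
Lemma Im_le_cabs z : `|complex.Im z| <= cabs z.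
Proof.
rewrite -(@ler_pXn2r _ 2) ?nnegrE //.
by rewrite cabs_sqr real_normK ?num_real // lerDr sqr_ge0.
Qed.
Lemma cabs_le_ReIm z : cabs z <= `|complex.Re z| + `|complex.Im z|.
Proof.
rewrite -(@ler_pXn2r _ 2) ?nnegrE ?addr_ge0 //.
rewrite cabs_sqr sqrrD !real_normK ?num_real // lerD2r lerDl.
by rewrite mulrn_wge0 // mulr_ge0.
Qed.
Lemma mulcJ z : z * (z^*)%C = ((cabs z ^+ 2)%:C)%C.
Proof.
rewrite cabs_sqr; case: z => a b /=; apply/eqP; rewrite eq_complex /=.
by apply/andP; split; apply/eqP; ring.
Qed.

End ComplexModulus.
#[export] Hint Extern 0 (is_true (@Order.le _ _ _ (cabs _))) => exact: cabs_ge0 : core.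

(** * Free ultrafilter limits and measures on the circle *)

Lemma free_ultrafilter_exists :
  exists U : set_system nat, UltraFilter U /\ forall N, U [set n | (N <= n)%N].
Proof.
have [U [UU sub]] := @ultraFilterLemma nat (\oo : set_system nat) _.
exists U; split => // N; apply: sub; exact: nbhs_infty_ge.
Qed.

(** One fixed free ultrafilter replaces every extraction of subsequences: limits along it exist for
    all bounded sequences at once, so families of limits indexed by reals or by coefficients need no
    diagonal argument. *)
Definition ultra : set_system nat := projT1 (cid free_ultrafilter_exists).

Lemma ultraP : UltraFilter ultra /\ forall N, ultra [set n | (N <= n)%N].
Proof. exact: projT2 (cid free_ultrafilter_exists). Qed.

#[local] Instance ultra_ultra : UltraFilter ultra := ultraP.1.

Section UltraLimits.
Context {R : realType}.

Lemma ultra_nonempty (P : set nat) : ultra P -> exists n, P n.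
Proof. by move=> /filter_ex. Qed.

Lemma ultra_large (P : set nat) N : ultra P -> exists2 n, (N <= n)%N & P n.
Proof.
move=> h; have [n [/= nN Pn]] := ultra_nonempty (filterI (ultraP.2 N) h).
by exists n.
Qed.

Definition ulim_to (x : nat -> R) (L : R) :=
  forall e : R, 0 < e -> ultra [set n | `|x n - L| < e].

(** The limit is the supremum of the [y] that lie below [x n] on a set of the ultrafilter; since
    [sup S + e] is not such a [y], maximality of the ultrafilter puts the opposite inequality on one
    of its sets. *)
Lemma ulim_exists (x : nat -> R) (a b : R) :
  (forall n, a <= x n <= b) -> exists L, ulim_to x L.
Proof.
move=> hx.
pose S := [set y : R | ultra [set n | y <= x n]].
have Sa : S a by apply: filterS filterT => n _ /=; case/andP: (hx n).
have Sub : ubound S b.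
  move=> y /ultra_nonempty [n /= yx]; apply: le_trans yx _.
  by case/andP: (hx n).
have hS : has_sup S by split; [exists a | exists b].
exists (sup S) => e e0.
have [y Sy ylt] := sup_adherent e0 hS.
have nS : ultra [set n | ~ (sup S + e <= x n)].
  have [h|//] := in_ultra_setVsetC [set n | sup S + e <= x n] ultra_ultra.
  have : sup S + e <= sup S by apply: sup_upper_bound.
  by rewrite gerDl leNgt e0.
apply: filterS2 Sy nS => n /= h1 /negP; rewrite -ltNge => h2.
rewrite ltr_norml; apply/andP; split; last by rewrite ltrBlDl.
by rewrite ltrBrDl; apply: lt_le_trans h1.
Qed.

End UltraLimits.

Section IntegralComparison.
Local Open Scope ereal_scope.
Context d (T : measurableType d) (R : realType).
Variable mu : {measure set T -> \bar R}.

(* No measurability is needed: the integral of a nonnegative function is a supremum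
   over the simple functions below it. *)
Lemma ge0_integral_mono (f g : T -> \bar R) :
  (forall x, 0 <= g x) -> (forall x, f x <= g x) ->
  \int[mu]_x f x <= \int[mu]_x g x.
Proof.
move=> g0 fg; rewrite integralE.
apply: (@le_trans _ _ (\int[mu]_x (f ^\+ x))).
  by apply: geeDl; rewrite leeNl oppe0 integral_ge0.
rewrite !ge0_integralTE //; apply: ereal_sup_le => _ [h /= hf <-].
exists h => // x; apply: le_trans (hf x) _.
by rewrite unlock ge_max g0 fg.
Qed.

End IntegralComparison.

(** * Upper Darboux sums for the uniform distribution *)

Section UniformDarboux.
Context {R : realType}.
Local Notation P := (uniform_prob (@ltr01 R)).

Lemma uniform_prob_cell (N i : nat) : (i < N)%N ->
  P `[(i%:R / N%:R)%R, (i.+1%:R / N%:R)%R[%classic = (N%:R^-1)%:E.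
Proof.
move=> iN; have N0 : 0 < N%:R :> R by rewrite ltr0n (leq_ltn_trans _ iN).
rewrite /uniform_prob integral_uniform_pdf setIidl; last first.
  move=> x /=; rewrite !in_itv /= => /andP[h1 h2]; apply/andP; split.
    by apply: le_trans h1; rewrite divr_ge0.
  apply: le_trans (ltW h2) _; rewrite ler_pdivrMr // mul1r ler_nat.
  exact: iN.
rewrite (eq_integral (fun=> 1%E)); last first.
  move=> x; rewrite inE /= in_itv /= => /andP[h1 h2].
  rewrite /uniform_pdf ifT ?subr0 ?invr1 //; apply/andP; split.
    by apply: le_trans h1; rewrite divr_ge0.
  apply: le_trans (ltW h2) _; rewrite ler_pdivrMr // mul1r ler_nat.
  exact: iN.
rewrite integral_cst //= mul1e lebesgue_measure_itv /= lte_fin.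
rewrite ltr_pM2r ?invr_gt0 // ltr_nat ltnSn -EFinD -mulrBl.
by rewrite -natr1 addrAC subrr add0r mul1r.
Qed.

Lemma uniform_prob_outside : P (~` `[0%R, 1%R[%classic) = 0%E.
Proof.
rewrite probability_setC // [X in (_ - X)%E](_ : _ = 1%E) ?subee //.
by have := @uniform_prob_cell 1 0 isT; rewrite mul0r invr1 mulr1.
Qed.

Lemma uniform_integral_le (f : R -> \bar R) (N : nat) (b : nat -> R) (M : R) :
  (0 < N)%N -> measurable_fun setT f -> (forall t, 0 <= f t)%E ->
  (forall t, f t <= M%:E)%E -> (forall i, 0 <= b i) ->
  (forall i t, (i < N)%N -> i%:R / N%:R <= t < i.+1%:R / N%:R ->
     (f t <= (b i)%:E)%E) ->
  (\int[P]_t f t <= (N%:R^-1 * \sum_(i < N) b i)%:E)%E.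
Proof.
move=> N0 mf f0 fM b0 fb.
have N0' : 0 < N%:R :> R by rewrite ltr0n.
have M0 : 0 <= M by rewrite -lee_fin; apply: le_trans (f0 0) (fM 0).
pose cell i := `[(i%:R / N%:R)%R, (i.+1%:R / N%:R)%R[%classic : set R.
(* The last term makes [g] dominate [f] outside [[0, 1[] too; it costs nothing, as the uniform
   distribution does not charge that set. *)
pose g (t : R) := (\sum_(i < N) (b i)%:E * (\1_(cell i) t)%:E
   + M%:E * (\1_(~` `[0%R, 1%R[%classic) t)%:E)%E.
have g1 (i : 'I_N) t : (0 <= (b i)%:E * (\1_(cell i) t)%:E)%E.
  by rewrite mule_ge0 // lee_fin ?b0.
apply: (@le_trans _ _ (\int[P]_t g t)%E).
  apply: ge0_integral_mono.
    move=> t; rewrite /g adde_ge0 //; first by rewrite sume_ge0.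
    by rewrite mule_ge0 ?lee_fin.
  move=> t; rewrite /g; have [|] := boolP (t \in `[0%R, 1%R[%classic); last first.
    rewrite notin_setE => nt; rewrite [X in (_ <= _ + _ * X)%E](_ : _ = 1%E); last first.
      by rewrite indicE mem_set.
    by rewrite mule1; apply: le_trans (fM t) _; rewrite leeDr // sume_ge0.
  rewrite inE /= in_itv /= => /andP[t0 t1].
  have tN : 0 <= t * N%:R by rewrite mulr_ge0.
  have /andP[h1 h2] := truncn_itv tN.
  set i := Num.truncn _ in h1 h2.
  have iN : (i < N)%N.
    rewrite -(@ltr_nat R); apply: le_lt_trans h1 _.
    by rewrite gtr_pMl.
  have hi : i%:R / N%:R <= t < i.+1%:R / N%:R.
    by rewrite ler_pdivrMr // h1 /= ltr_pdivlMr.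
  apply: le_trans (fb i t iN hi) _.
  rewrite (bigD1 (Ordinal iN)) //= -addeA.
  have -> : (\1_(cell i) t : R)%:E = 1%E by rewrite indicE mem_set //= in_itv.
  rewrite mule1 leeDl //.
  by rewrite adde_ge0 ?sume_ge0 // mule_ge0 ?lee_fin.
have mI (A : set R) : measurable A -> measurable_fun [set: R] (EFin \o (\1_A : R -> R)).
  by move=> mA; apply/measurable_EFinP; apply: measurable_indic.
have mZ (k : R) (A : set R) : measurable A ->
    measurable_fun [set: R] (fun t => (k%:E * (\1_A t : R)%:E)%E).
  by move=> mA; apply: measurable_funeM; apply: mI.
have mcell i : measurable (cell i) by exact: measurable_itv.
rewrite /g ge0_integralD //=; last 4 first.
- by move=> t _; rewrite sume_ge0.
- by apply: emeasurable_sum => i _; apply: mZ.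
- by move=> t _; rewrite mule_ge0 ?lee_fin.
- by apply: mZ; apply: measurableC.
rewrite ge0_integral_sum //; last by move=> i; apply: mZ.
rewrite ge0_integralZl_EFin //; last by apply: mI; apply: measurableC.
rewrite integral_indic //; last exact: measurableC.
rewrite setIT [X in (_ + _ * X)%E](_ : _ = 0%E); last exact: uniform_prob_outside.
rewrite mule0 adde0.
rewrite mulr_sumr -sumEFin; apply: lee_sum => i _.
rewrite ge0_integralZl_EFin //; last exact: mI.
rewrite integral_indic //; last exact: mcell.
rewrite setIT [X in (_ * X)%E](_ : _ = (N%:R^-1)%:E).
  by rewrite -EFinM mulrC.
exact: uniform_prob_cell.
Qed.

End UniformDarboux.

(** * Angles and the truncated logarithm of the distance *)

Section CircleParametrization.
Context {R : realType}.
Local Notation C := R[i].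

Definition circ (t : R) : R * R := (cos t, sin t).

Lemma lip1_of_derive (f df : R -> R) :
  (forall x : R, is_derive x (1 : R) f (df x)) -> (forall x, `|df x| <= 1) ->
  forall a b, `|f a - f b| <= `|a - b|.
Proof.
move=> fd df1; have W a b : a <= b -> `|f b - f a| <= `|b - a|.
  move=> ab.
  have [|c _ ->] := @MVT_segment R f df a b ab (fun x _ => fd x).
    apply: continuous_subspaceT => x.
    by apply/differentiable_continuous/derivable1_diffP; case: (fd x).
  by rewrite normrM ler_piMl.
move=> a b; have [ab|/ltW ba] := leP b a; first exact: W.
by rewrite distrC (distrC a) W.
Qed.

Lemma cos_lip (a b : R) : `|cos a - cos b| <= `|a - b|.
Proof.
apply: (@lip1_of_derive cos (fun x => - sin x)) => x.
by rewrite normrN ler_norml sin_geN1 sin_le1.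
Qed.

Lemma sin_lip (a b : R) : `|sin a - sin b| <= `|a - b|.
Proof.
apply: (@lip1_of_derive sin cos) => x.
by rewrite ler_norml cos_geN1 cos_le1.
Qed.

Lemma toC_sub (p q : R * R) :
  cabs (toC p - toC q) = Num.sqrt ((p.1 - q.1) ^+ 2 + (p.2 - q.2) ^+ 2).
Proof. by []. Qed.

Lemma cabs_circ t : cabs (toC (circ t)) = 1.
Proof. by rewrite /cabs /= cos2Dsin2 sqrtr1. Qed.

Lemma circ_lip (a b : R) : cabs (toC (circ a) - toC (circ b)) <= 2 * `|a - b|.
Proof.
apply: le_trans (cabs_le_ReIm _) _; rewrite /= mulr2n mulrDl mul1r.
by apply: lerD; [apply: cos_lip | apply: sin_lip].
Qed.

(** The range [[-4, 4]] is a rational stand-in for [[-pi, pi]]: it gives the angles an explicit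
    bound. *)
Lemma circ_surj (z : C) : cabs z = 1 -> exists2 t, -4 <= t <= 4 & z = toC (circ t).
Proof.
case: z => x y h.
have h1 : x ^+ 2 + y ^+ 2 = 1 by rewrite -[1](expr1n _ 2) -h cabs_sqr.
have x1 : -1 <= x <= 1.
  rewrite -ler_norml -(@ler_pXn2r _ 2) ?nnegrE // expr1n real_normK ?num_real //.
  by rewrite -h1 lerDl sqr_ge0.
have pi4 : pi <= 4 :> R by have := pihalf_lt2 R; rewrite ltr_pdivrMr //; lra.
have a0 := acos_ge0 x1; have ap := acos_lepi x1.
have sq : Num.sqrt (1 - x ^+ 2) = `|y|.
  by rewrite -h1 addrAC subrr add0r sqrtr_sqr.
have [y0|y0] := leP 0 y.
  exists (acos x); first by lra.
  by rewrite /toC /circ /= acosK // sin_acos // sq ger0_norm.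
exists (- acos x); first by lra.
by rewrite /toC /circ /= cosN sinN acosK // sin_acos // sq ltr0_norm // opprK.
Qed.


(** The distance is clamped to [[c, 1]]. The lower clamp makes the kernel bounded and Lipschitz; the
    upper one makes it nonnegative, as monotone convergence and Tonelli require. *)
Definition trunc_log (c d : R) : R := - ln (Num.min 1 (Num.max d c)).

Lemma trunc_log_arg (c d : R) : 0 < c <= 1 -> c <= Num.min 1 (Num.max d c) <= 1.
Proof. by case/andP=> c0 c1; rewrite le_min c1 le_max lexx orbT /= ge_min lexx. Qed.

Lemma trunc_log_ge0 (c d : R) : 0 < c <= 1 -> 0 <= trunc_log c d.
Proof.
by move=> /(trunc_log_arg d)/andP[_ h]; rewrite /trunc_log oppr_ge0 ln_le0.
Qed.

Lemma trunc_log_le (c d : R) : 0 < c <= 1 -> trunc_log c d <= - ln c.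
Proof.
move=> hc; have /andP[h _] := trunc_log_arg d hc; have /andP[c0 _] := hc.
by rewrite /trunc_log lerN2 ler_ln ?posrE //; apply: lt_le_trans h.
Qed.

Lemma trunc_log_mono (c c' d : R) : 0 < c' -> c' <= c -> c <= 1 ->
  trunc_log c d <= trunc_log c' d.
Proof.
move=> c0 cc c1; have c0' := lt_le_trans c0 cc.
have /(trunc_log_arg d)/andP[h1 _] : 0 < c' <= 1 by rewrite c0 (le_trans cc).
have /(trunc_log_arg d)/andP[h2 _] : 0 < c <= 1 by rewrite c0'.
rewrite /trunc_log lerN2 ler_ln ?posrE; last 2 first.
- exact: lt_le_trans h1.
- exact: lt_le_trans h2.
rewrite le_min ge_min lexx /= ge_min; apply/orP; right.
by rewrite ge_max !le_max lexx cc orbT.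
Qed.

(** Clamping is 1-Lipschitz and [ln] has slope at most [1 / c] on [[c, 1]], which is read off
    [ln (1 + u) <= u]. *)
Lemma trunc_log_lip (c d d' : R) : 0 < c <= 1 ->
  trunc_log c d <= trunc_log c d' + `|d - d'| / c.
Proof.
move=> hc; have /andP[c0 c1] := hc.
have /andP[h1 h2] := trunc_log_arg d hc; have /andP[h3 h4] := trunc_log_arg d' hc.
rewrite /trunc_log; set x := Num.min _ _ in h1 h2 *; set y := Num.min _ _ in h3 h4 *.
have x0 : 0 < x by exact: lt_le_trans h1.
have y0 : 0 < y by exact: lt_le_trans h3.
rewrite -lerBlDl opprK addrC -ln_div ?posrE //.
have -> : y / x = 1 + (y - x) / x by field; rewrite gt_eqF.
apply: le_trans (le_ln1Dx _) _.
  by rewrite mulrBl divff ?gt_eqF // ltrBrDl subrr divr_gt0.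
have yx : y - x <= `|d - d'|.
  have hd : d' <= d + `|d - d'|.
    by rewrite -lerBlDl distrC ler_norm.
  rewrite lerBlDl /y; have /orP[/eqP xe|xe] : (x == 1) || (Num.max d c <= x).
  - by rewrite /x minEle; case: ifP; rewrite ?eqxx ?lexx ?orbT.
  - by rewrite xe ge_min; apply/orP; left; rewrite lerDl.
  rewrite ge_min; apply/orP; right; move: xe; rewrite !ge_max => /andP[dx cx].
  rewrite (le_trans hd) ?lerD2r //=.
  by apply: (le_trans cx); rewrite lerDl.
apply: (@le_trans _ _ (`|d - d'| / x)); first by rewrite ler_pM2r ?invr_gt0.
by rewrite ler_wpM2l // lef_pV2.
Qed.

End CircleParametrization.

(** * Double averages over sorted lists *)

Section GridSums.
Context {R : realType}.

Lemma block_sum_le (T : seq R) (N n : nat) (F : R -> R) (G : nat -> R) (x0 : R) :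
  size T = (N * n)%N ->
  (forall i k, (i < N)%N -> (i * n <= k < i.+1 * n)%N -> G i <= F (nth x0 T k)) ->
  n%:R * \sum_(i < N) G i <= \sum_(a <- T) F a.
Proof.
move=> sT h; rewrite (big_nth x0) sT.
have -> : \sum_(0 <= k < N * n) F (nth x0 T k) =
   \sum_(i < N) \sum_(i * n <= k < i.+1 * n) F (nth x0 T k).
  elim: (N) => [|m IH]; first by rewrite mul0n big_geq // big_ord0.
  rewrite big_ord_recr /= -IH (@big_cat_nat _ _ _ (m * n)) //=.
  by rewrite leq_mul2r leqnSn orbT.
rewrite mulr_sumr; apply: ler_sum => i _.
rewrite (@le_trans _ _ (\sum_(i * n <= k < i.+1 * n) G i)) //.
  by rewrite sumr_const_nat mulSn addnK mulr_natl.
by apply: ler_sum_nat => k hk; apply: h.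
Qed.

Lemma double_gap_sum (h : nat -> nat -> R) (x : nat -> R) (L : R) N :
  \sum_(i < N) \sum_(j < N) (h i j + L * ((x i.+1 - x i) + (x j.+1 - x j))) =
  \sum_(i < N) \sum_(j < N) h i j + L * (N%:R * 2 * (x N - x 0%N)).
Proof.
have tel : \sum_(i < N) (x i.+1 - x i) = x N - x 0%N.
  by rewrite -(big_mkord xpredT (fun i => x i.+1 - x i)) telescope_sumr.
have E (i : 'I_N) : \sum_(j < N) (h i j + L * ((x i.+1 - x i) + (x j.+1 - x j))) =
    \sum_(j < N) h i j + L * (N%:R * (x i.+1 - x i) + (x N - x 0%N)).
  rewrite big_split -mulr_sumr big_split /= tel sumr_const card_ord.
  by rewrite mulr_natl.
rewrite (eq_bigr _ (fun i _ => E i)) big_split /= -mulr_sumr big_split /=.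
rewrite -mulr_sumr tel sumr_const card_ord -[(_ - _) *+ N]mulr_natl.
by congr (_ + L * _); rewrite -mulrDr -mulrA [2 * _]mulr_natl mulr2n.
Qed.

(** The list is sorted, so the variations over its [N] blocks add up to at most the total length 8:
    replacing each point by the first one of its block costs at most [L * (N * 2 * 8) / N ^ 2]. *)
Lemma grid_sum_le (h : R -> R -> R) (L : R) (T : seq R) (N n : nat) :
  (forall x y x' y', h x y <= h x' y' + L * (`|x - x'| + `|y - y'|)) ->
  0 <= L -> sorted <=%R T -> (forall t, t \in T -> -4 <= t <= 4) ->
  size T = (N * n)%N -> (0 < N)%N -> (0 < n)%N ->
  (N%:R ^+ 2)^-1 * \sum_(i < N) \sum_(j < N) h (nth 4 T (i * n)) (nth 4 T (j * n))
  <= ((size T)%:R ^+ 2)^-1 * (\sum_(a <- T) \sum_(b <- T) h a b) + 16 * L / N%:R.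
Proof.
move=> hL L0 sT bT szT N0 n0.
pose x i := nth 4 T (i * n).
(* The default 4 bounds all entries, so [nth 4 T] stays nondecreasing beyond the end of the list;
   [x N] itself is this default. *)
have mono k l : (k <= l)%N -> nth 4 T k <= nth 4 T l.
  move=> kl; have [lT|lT] := ltnP l (size T); last first.
    rewrite (nth_default _ lT); have [kT|kT] := ltnP k (size T).
      by case/andP: (bT _ (mem_nth 4 kT)).
    by rewrite nth_default.
  apply: (sorted_leq_nth le_trans lexx) => //.
  by rewrite inE (leq_ltn_trans kl).
have N0' : 0 < N%:R :> R by rewrite ltr0n.
have n0' : 0 < n%:R :> R by rewrite ltr0n.
have H : n%:R * (n%:R * \sum_(i < N) \sum_(j < N)
     (h (x i) (x j) + (- L) * ((x i.+1 - x i) + (x j.+1 - x j))))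
     <= \sum_(a <- T) \sum_(b <- T) h a b.
  rewrite [n%:R * \sum_(i < N) _]mulr_sumr.
  apply: (block_sum_le (x0 := 4) (F := fun a => \sum_(b <- T) h a b) (G := fun i => n%:R *
    \sum_(j < N) (h (x i) (x j) + - L * (x i.+1 - x i + (x j.+1 - x j)))) szT).
  move=> i k iN /andP[k1 k2].
  apply: (block_sum_le (x0 := 4) (F := h (nth 4 T k)) (G := fun j =>
    h (x i) (x j) + - L * (x i.+1 - x i + (x j.+1 - x j))) szT).
  move=> j l jN /andP[l1 l2].
  rewrite mulNr lerBlDr; apply: le_trans (hL _ _ (nth 4 T k) (nth 4 T l)) _.
  rewrite lerD2l; apply: ler_wpM2l => //; apply: lerD.
    by rewrite distrC ger0_norm ?subr_ge0 ?mono // lerD2r mono // ltnW.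
  by rewrite distrC ger0_norm ?subr_ge0 ?mono // lerD2r mono // ltnW.
have rng k : -4 <= nth 4 T k <= 4.
  have [kT|kT] := ltnP k (size T); first exact/bT/mem_nth.
  by rewrite nth_default //; lra.
have x8 : x N - x 0%N <= 8.
  by have := rng (N * n)%N; have := rng (0 * n)%N; rewrite /x; lra.
move: H; rewrite (double_gap_sum (fun i j => h (x i) (x j)) x (- L) N); set S := \sum_(i < N) _; set Q := \sum_(a <- T) _.
move=> H.
have H2 : S - 16 * L * N%:R <= Q / n%:R ^+ 2.
  rewrite ler_pdivlMr ?exprn_gt0 //; apply: le_trans H.
  rewrite [n%:R * (n%:R * _)]mulrA -expr2 [leLHS]mulrC.
  apply: ler_wpM2l; first by rewrite exprn_ge0.
  rewrite lerD2l mulNr lerN2.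
  have -> : 16 * L * N%:R = L * (N%:R * 2 * 8) by ring.
  apply: ler_wpM2l => //; apply: ler_wpM2l; last exact: x8.
  by rewrite mulr_ge0.
have -> : ((size T)%:R ^+ 2)^-1 = (N%:R ^+ 2)^-1 * (n%:R ^+ 2)^-1 :> R.
  by rewrite szT natrM exprMn invfM.
rewrite -lerBlDr.
have -> : 16 * L / N%:R = (N%:R ^+ 2)^-1 * (16 * L * N%:R).
  by field; rewrite gt_eqF.
rewrite -mulrBr -[leRHS]mulrA; apply: ler_wpM2l; first by rewrite invr_ge0 exprn_ge0.
by rewrite [leRHS]mulrC.
Qed.

End GridSums.

(** * Monotone approximation of the logarithmic kernel *)

Section LogKernel.
Context {R : realType}.
Local Notation C := R[i].

Lemma measurable_trunc_log (c : R) :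
  measurable_fun [set: (R * R) * (R * R)]
    (fun pq => trunc_log c (cabs (toC pq.1 - toC pq.2))).
Proof.
have mf (f : (R * R) * (R * R) -> R) : measurable_fun setT f ->
    measurable_fun setT (fun pq => trunc_log c (f pq)).
  move=> hf; rewrite /trunc_log; apply: measurable_funN.
  apply: (measurableT_comp (@measurable_ln R)).
  apply: measurable_minr; first exact: measurable_cst.
  by apply: measurable_maxr => //; exact: measurable_cst.
apply: mf; under eq_fun do rewrite toC_sub.
apply: (measurableT_comp (f := @Num.sqrt R)).
  by apply: continuous_measurable_fun; exact: sqrt_continuous.
have m1 (f g : (R * R) * (R * R) -> R) : measurable_fun setT f ->
    measurable_fun setT g -> measurable_fun setT (fun x => (f x - g x) ^+ 2).
  by move=> hf hg; apply: measurable_funX; exact: measurable_funB.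
apply: measurable_funD; apply: m1.
- exact: (measurableT_comp measurable_fst measurable_fst).
- exact: (measurableT_comp measurable_fst measurable_snd).
- exact: (measurableT_comp measurable_snd measurable_fst).
- exact: (measurableT_comp measurable_snd measurable_snd).
Qed.

Definition log_kernel_seq (p q : R * R) (M : nat) : \bar R :=
  (trunc_log M.+1%:R^-1 (cabs (toC p - toC q)))%:E.

Let cM (M : nat) : 0 < (M.+1%:R^-1 : R) <= 1.
Proof. by rewrite invr_gt0 ltr0n /= invf_le1 ?ltr0n // ler1n. Qed.

Lemma log_kernel_seq_ge0 p q M : (0 <= log_kernel_seq p q M)%E.
Proof. by rewrite lee_fin trunc_log_ge0. Qed.

Lemma log_kernel_seq_nd p q :
  {homo log_kernel_seq p q : m n / (m <= n)%N >-> (m <= n)%E}.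
Proof.
move=> m n mn; rewrite lee_fin; have /andP[? ?] := cM n; have /andP[? ?] := cM m.
by apply: trunc_log_mono => //; rewrite lef_pV2 ?posrE ?ltr0n // ler_nat.
Qed.

Lemma log_kernel_seq_le_lim p q M :
  (log_kernel_seq p q M <= limn (log_kernel_seq p q))%E.
Proof.
have /cvg_lim -> // := ereal_nondecreasing_cvgn (log_kernel_seq_nd p q).
by apply: ereal_sup_ubound; exists M.
Qed.

(** Not an equality: at distances above 1 the truncated kernels are 0 while [logk] is negative. The
    inequality goes in the direction that bounds the energy from above. *)
Lemma logk_le_lim p q : (logk p q <= limn (log_kernel_seq p q))%E.
Proof.
rewrite /logk; case: eqP => [->|pq].
  suff -> : limn (log_kernel_seq q q) = +oo%E by [].
  (* At distance 0 the truncated kernel equals [ln (M + 1)], and [M + 1 > expR A]. *)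
  apply/eqyP => A A0; pose M := Num.truncn (expR A).
  apply: le_trans (log_kernel_seq_le_lim q q M).
  have /andP[c0 c1] := cM M.
  rewrite lee_fin /trunc_log subrr cabs0 (max_idPr (ltW c0)) (min_idPr c1).
  rewrite lnV ?posrE ?ltr0n // opprK -[A]expRK ler_ln ?posrE ?expR_gt0 ?ltr0n //.
  exact/ltW/truncnS_gt.
have d0 : 0 < cabs (toC p - toC q).
  rewrite cabs_gt0 subr_eq0; apply/eqP => h; apply: pq.
  by case: p q h => [a b] [a' b'] [-> ->].
pose M := Num.truncn (cabs (toC p - toC q))^-1.
apply: le_trans (log_kernel_seq_le_lim p q M).
rewrite lee_fin -toC_sub /trunc_log lerN2.
have hM : M.+1%:R^-1 <= cabs (toC p - toC q).
  rewrite -[leRHS]invrK lef_pV2 ?posrE ?ltr0n ?invr_gt0 //.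
  exact/ltW/truncnS_gt.
rewrite (max_idPl hM) ler_ln ?posrE ?ge_min ?lexx ?orbT //.
by rewrite lt_min ltr01.
Qed.

(** [logk] is first replaced by the limit of the truncated kernels; then monotone convergence is
    applied to the inner and to the outer integral. *)
Lemma log_energy_le (mu : probability (R * R)%type R) (B : R) :
  (forall M, \int[mu]_p \int[mu]_q log_kernel_seq p q M <= B%:E)%E ->
  (log_energy mu <= B%:E)%E.
Proof.
move=> hB.
have mK M : measurable_fun [set: (R * R) * (R * R)]
    (fun pq => log_kernel_seq pq.1 pq.2 M).
  by apply/measurable_EFinP; exact: measurable_trunc_log.
have mKp M p : measurable_fun [set: R * R] (fun q => log_kernel_seq p q M).
  exact: (measurable_fun_pair2 p (mK M)).
have mI M : measurable_fun [set: R * R] (fun p => \int[mu]_q log_kernel_seq p q M)%E.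
  apply: (measurable_fun_fubini_tonelli_F (m2 := mu) _ (mK M)) => x.
  exact: log_kernel_seq_ge0.
have lim0 p q : (0 <= limn (log_kernel_seq p q))%E.
  exact: le_trans (log_kernel_seq_ge0 p q 0) (log_kernel_seq_le_lim p q 0).
apply: (@le_trans _ _ (\int[mu]_p \int[mu]_q limn (log_kernel_seq p q))%E).
  apply: ge0_integral_mono => p; first exact: integral_ge0.
  by apply: ge0_integral_mono => q; [exact: lim0 | exact: logk_le_lim].
have ndI p : {homo (fun M => \int[mu]_q log_kernel_seq p q M)%E :
    m n / (m <= n)%N >-> (m <= n)%E}.
  move=> m n mn; apply: ge0_integral_mono => q; first exact: log_kernel_seq_ge0.
  exact: log_kernel_seq_nd.
rewrite (eq_integral (fun p => limn (fun M => \int[mu]_q log_kernel_seq p q M)%E)); last first.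
  move=> p _; rewrite monotone_convergence //.
  - by move=> M; exact: mKp.
  - by move=> M q _; exact: log_kernel_seq_ge0.
  - by move=> q _ m n mn; exact: log_kernel_seq_nd.
rewrite monotone_convergence //; last first.
  by move=> M p _; apply: integral_ge0 => q _; exact: log_kernel_seq_ge0.
apply: lime_le.
  apply: ereal_nondecreasing_is_cvgn => m n mn.
  apply: ge0_integral_mono => p; last exact: ndI.
  by apply: integral_ge0 => q _; exact: log_kernel_seq_ge0.
by apply: nearW => M; exact: hB.
Qed.

End LogKernel.

(** * Ultralimits of finite configurations *)

Section LimitMeasure.
Context {R : realType}.
Local Notation C := R[i].
Variables (E : set C) (B : R) (S : nat -> seq R).
Hypothesis Eclosed : closed_in_C E.
Hypothesis S0 : forall m, S m != [::].
Hypothesis SE : forall m t, t \in S m -> -4 <= t <= 4 /\ E (toC (circ t)).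

Definition circ_kernel (c a b : R) : R :=
  trunc_log c (cabs (toC (circ a) - toC (circ b))).

Hypothesis SB : forall c, 0 < c <= 1 -> exists m0, forall m, (m0 <= m)%N ->
  \sum_(a <- S m) \sum_(b <- S m) circ_kernel c a b <= B * (size (S m))%:R ^+ 2.

Lemma circ_kernel_lip c x y x' y' : 0 < c <= 1 ->
  circ_kernel c x y <= circ_kernel c x' y' + (2 / c) * (`|x - x'| + `|y - y'|).
Proof.
move=> hc; have /andP[c0 _] := hc.
apply: le_trans (trunc_log_lip _ (cabs (toC (circ x') - toC (circ y'))) hc) _.
rewrite lerD2l mulrAC ler_pM2r ?invr_gt0 //.
have tri (u v : C) : `|cabs u - cabs v| <= cabs (u - v).
  rewrite ler_norml cabs_tri andbT lerNl opprB cabsBC; exact: cabs_tri.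
apply: le_trans (tri _ _) _.
have -> : toC (circ x) - toC (circ y) - (toC (circ x') - toC (circ y')) =
  (toC (circ x) - toC (circ x')) - (toC (circ y) - toC (circ y')) by ring.
by apply: le_trans (cabsB _ _) _; rewrite mulrDr lerD // circ_lip.
Qed.

(* The lists are replicated [m`!] times so that every [N <= m] divides the length of
   the [m]-th one. *)
Definition samples m : seq R := sort <=%R (flatten (nseq m`! (S m))).

Lemma sum_samples m (F : R -> R) :
  \sum_(a <- samples m) F a = (m`!)%:R * \sum_(a <- S m) F a.
Proof.
rewrite (perm_big _ (permEl (perm_sort _ _))) /=.
elim: (m`!) => [|k IH] /=; first by rewrite big_nil mul0r.
by rewrite big_cat /= IH -natr1 mulrDl mul1r addrC.
Qed.

Lemma size_samples m : size (samples m) = (m`! * size (S m))%N.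
Proof.
rewrite size_sort; elim: (m`!) => [|k IH] //=.
by rewrite size_cat IH mulSn.
Qed.

Lemma mem_samples m t : t \in samples m -> -4 <= t <= 4 /\ E (toC (circ t)).
Proof.
rewrite mem_sort => /flattenP [s]; rewrite mem_nseq => /andP[_ /eqP ->].
exact: SE.
Qed.

Lemma size_samples_gt0 m : (0 < size (samples m))%N.
Proof. by rewrite size_samples muln_gt0 fact_gt0 lt0n size_eq0 S0. Qed.

(** Quantile function of the uniform distribution on the list. Its pointwise ultralimit serves as
    quantile function of the limit measure, in place of weak compactness of measures: being
    nondecreasing it is measurable, and its oscillations over a grid add up to at most 8. *)
Definition quantile m (t : R) : R :=
  nth 4 (samples m) (Num.truncn (t * (size (samples m))%:R)).

Lemma nth_samples_range m k : -4 <= nth 4 (samples m) k <= 4.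
Proof.
have [kT|kT] := ltnP k (size (samples m)).
  by case: (mem_samples (mem_nth 4 kT)).
by rewrite nth_default //; lra.
Qed.

Lemma sorted_samples m : sorted <=%R (samples m).
Proof. by apply: sort_sorted; exact: le_total. Qed.

Lemma quantile_mono m s t : s <= t -> quantile m s <= quantile m t.
Proof.
move=> st; rewrite /quantile; set k := Num.truncn _; set l := Num.truncn _.
have kl : (k <= l)%N by apply: le_truncn; rewrite ler_wpM2r.
have [lT|lT] := ltnP l (size (samples m)); last first.
  by rewrite (nth_default _ lT); case/andP: (nth_samples_range m k).
apply: (sorted_leq_nth le_trans lexx) => //; first exact: sorted_samples.
by rewrite inE (leq_ltn_trans kl).
Qed.

Lemma limit_quantile_exists t : exists L, ulim_to (fun m => quantile m t) L.
Proof. by apply: (@ulim_exists _ _ (-4) 4) => m; exact: nth_samples_range. Qed.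

Definition limit_quantile t : R := projT1 (cid (limit_quantile_exists t)).

Lemma limit_quantileP t : ulim_to (fun m => quantile m t) (limit_quantile t).
Proof. exact: projT2 (cid (limit_quantile_exists t)). Qed.

Lemma limit_quantile_mono : nondecreasing_fun limit_quantile.
Proof.
move=> s t st; apply/ler_addgt0Pr => e e0.
have e2 : 0 < e / 2 by rewrite divr_gt0.
have [m []] := ultra_nonempty (filterI (limit_quantileP s e2) (limit_quantileP t e2)).
have := quantile_mono m st; rewrite /= !ltr_norml; lra.
Qed.

Lemma limit_quantile_range t : -4 <= limit_quantile t <= 4.
Proof.
apply/andP; split; apply/ler_addgt0Pr => e e0;
  have [m /=] := ultra_nonempty (limit_quantileP t e0);
  have := nth_samples_range m (Num.truncn (t * (size (samples m))%:R));
  rewrite -/(quantile m t) ltr_norml; lra.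
Qed.

(** At [t = 1] the index is the length of the list and [nth] returns its default, hence the strict
    inequality. Below 1 all quantiles are angles of points of [E], which is closed. *)
Lemma limit_quantile_E t : 0 <= t < 1 -> E (toC (circ (limit_quantile t))).
Proof.
case/andP=> t0 t1; apply: Eclosed => e e0.
have e2 : 0 < e / 2 by rewrite divr_gt0.
have [m /= hm] := ultra_nonempty (limit_quantileP t e2).
exists (toC (circ (quantile m t))).
  apply: (proj2 (mem_samples (mem_nth 4 _))).
  rewrite truncn_lt_nat ?mulr_ge0 //.
  by rewrite gtr_pMl // ltr0n size_samples_gt0.
apply: le_lt_trans (circ_lip _ _) _.
by rewrite distrC mulrC -ltr_pdivlMr.
Qed.

Lemma limit_grid_sum c N : 0 < c <= 1 -> (0 < N)%N ->
  (N%:R ^+ 2)^-1 * \sum_(i < N) \sum_(j < N)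
    circ_kernel c (limit_quantile (i%:R / N%:R)) (limit_quantile (j%:R / N%:R))
  <= B + 33 * (2 / c) / N%:R.
Proof.
move=> hc N0; have [m0 hm0] := SB hc; have /andP[c0 _] := hc.
have N0' : 0 < N%:R :> R by rewrite ltr0n.
set d : R := (2 * N%:R)^-1.
have d0 : 0 < d by rewrite invr_gt0 mulr_gt0.
(* One [m] serves all [N] grid points: finitely many conditions are met together along the
   ultrafilter, at arbitrarily large indices. *)
have [m mM hm] : exists2 m, (maxn m0 N <= m)%N & forall i : 'I_N,
    `|quantile m (i%:R / N%:R) - limit_quantile (i%:R / N%:R)| < d.
  by apply: ultra_large; apply: filter_forall => i; exact: limit_quantileP.
have Nm : (N <= m)%N by apply: leq_trans mM; exact: leq_maxr.
have : (N %| size (samples m))%N.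
  by rewrite size_samples dvdn_mulr // dvdn_fact // N0.
move=> /dvdnP [n sn]; rewrite mulnC in sn.
have n0 : (0 < n)%N.
  by have := size_samples_gt0 m; rewrite sn muln_gt0 N0.
(* Since [N] divides the length, the grid point [i / N] falls exactly on the index [i * n]. *)
have qE i : quantile m (i%:R / N%:R) = nth 4 (samples m) (i * n).
  rewrite /quantile sn natrM mulrA mulfVK ?gt_eqF // -natrM.
  by rewrite natrK.
set L := 2 / c; have L0 : 0 <= L by rewrite divr_ge0 // ltW.
have := grid_sum_le (h := circ_kernel c) (L := L) (fun x y x' y' => circ_kernel_lip x y x' y' hc)
  L0 (sorted_samples m) (fun t ht => proj1 (mem_samples ht)) sn N0 n0.
rewrite sum_samples; under [X in _ * (_ * X)]eq_bigr do rewrite sum_samples.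
rewrite -mulr_sumr => H.
have H2 : ((size (samples m))%:R ^+ 2)^-1 * ((m`!)%:R * ((m`!)%:R *
   \sum_(i <- S m) \sum_(a <- S m) circ_kernel c i a)) <= B.
  rewrite size_samples natrM mulrC ler_pdivrMr; last first.
    by rewrite exprn_gt0 // mulr_gt0 ?ltr0n ?fact_gt0 // lt0n size_eq0 S0.
  rewrite exprMn mulrA -expr2 mulrCA; apply: ler_wpM2l; first by rewrite exprn_ge0.
  by apply: hm0; apply: leq_trans mM; exact: leq_maxl.
have H3 : (N%:R ^+ 2)^-1 * \sum_(i < N) \sum_(j < N)
    circ_kernel c (limit_quantile (i%:R / N%:R)) (limit_quantile (j%:R / N%:R))
   <= (N%:R ^+ 2)^-1 * \sum_(i < N) \sum_(j < N)
     circ_kernel c (nth 4 (samples m) (i * n)) (nth 4 (samples m) (j * n)) + L / N%:R.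
  have -> : L / N%:R = (N%:R ^+ 2)^-1 * \sum_(i < N) \sum_(j < N) (L * (d + d)).
    rewrite !sumr_const !card_ord -[_ *+ N *+ N]mulrnA -[_ *+ (N * N)]mulr_natr natrM /d.
    by field; rewrite gt_eqF.
  rewrite -mulrDr; apply: ler_wpM2l; first by rewrite invr_ge0 exprn_ge0.
  rewrite -big_split /=; apply: ler_sum => i _.
  rewrite -big_split /=; apply: ler_sum => j _; rewrite -!qE.
  apply: le_trans (circ_kernel_lip _ _ (quantile m (i%:R / N%:R))
    (quantile m (j%:R / N%:R)) hc) _; rewrite lerD2l.
  by apply: ler_wpM2l => //; apply: lerD; rewrite distrC ltW.
(* 16 comes from [grid_sum_le] and 1 from passing to the limit quantiles; the rest of 33 is
   slack. *)
have -> : 33 * L / N%:R = 16 * L / N%:R + L / N%:R + 16 * L / N%:R by ring.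
have : 0 <= 16 * L / N%:R by rewrite divr_ge0 // mulr_ge0.
lra.
Qed.


Definition limit_curve (t : R) : R * R := circ (limit_quantile t).

Lemma measurable_limit_curve : measurable_fun [set: R] limit_curve.
Proof.
have mq : measurable_fun [set: R] limit_quantile.
  by apply: nondecreasing_measurable => //; exact: limit_quantile_mono.
apply: measurable_fun_pair.
  apply: (measurableT_comp (f := @cos R)) => //.
  by apply: continuous_measurable_fun; exact: continuous_cos.
apply: (measurableT_comp (f := @sin R)) => //.
by apply: continuous_measurable_fun; exact: continuous_sin.
Qed.

(* [uniform_prob] lives on [measurableTypeR R], whose display differs from that of the
   instance found on [R]. *)
Let plane : measurableType _ := (R * R)%type.
Let limit_curveT : measurableTypeR R -> plane := limit_curve.

Let measurable_limit_curveT : measurable_fun setT limit_curveT.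
Proof. exact: measurable_limit_curve. Qed.

Definition limit_measure : probability plane R :=
  distribution (uniform_prob (@ltr01 R)) (mfun_Sub (mem_set measurable_limit_curveT)).

Lemma limit_measureE A :
  limit_measure A = uniform_prob (@ltr01 R) (limit_curve @^-1` A).
Proof. by []. Qed.

Lemma integral_limit_measure (f : R * R -> \bar R) :
  measurable_fun setT f -> (forall p, 0 <= f p)%E ->
  (\int[limit_measure]_p f p = \int[uniform_prob (@ltr01 R)]_t f (limit_curve t))%E.
Proof. by move=> mf f0; rewrite ge0_integral_distribution. Qed.

Lemma limit_kernel_integral c : 0 < c <= 1 ->
  (\int[uniform_prob (@ltr01 R)]_s \int[uniform_prob (@ltr01 R)]_t
    (circ_kernel c (limit_quantile s) (limit_quantile t))%:E <= (B + 1)%:E)%E.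
Proof.
move=> hc; have /andP[c0 _] := hc; set th := limit_quantile.
set L := 2 / c; have L0 : 0 <= L by rewrite divr_ge0 // ltW.
(* 33 from [limit_grid_sum] and 16 from the oscillation of [limit_quantile] over the cells make 49;
   this [N] brings the total error below 1. *)
pose N := (Num.truncn (49 * L)).+1.
have N0 : (0 < N)%N by [].
have N0' : 0 < N%:R :> R by rewrite ltr0n.
have NL : 49 * L / N%:R <= 1.
  by rewrite ler_pdivrMr // mul1r ltW // truncnS_gt.
pose x i := th (i%:R / N%:R).
have xx i : 0 <= x i.+1 - x i.
  by rewrite subr_ge0; apply: limit_quantile_mono; rewrite ler_pM2r ?invr_gt0 // ler_nat.
pose b i j := circ_kernel c (x i) (x j) + L * ((x i.+1 - x i) + (x j.+1 - x j)).
have b0 i j : 0 <= b i j.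
  by rewrite addr_ge0 ?trunc_log_ge0 // mulr_ge0 // addr_ge0.
have key i j s t : i%:R / N%:R <= s < i.+1%:R / N%:R ->
    j%:R / N%:R <= t < j.+1%:R / N%:R -> circ_kernel c (th s) (th t) <= b i j.
  move=> /andP[s1 s2] /andP[t1 t2].
  apply: le_trans (circ_kernel_lip _ _ (x i) (x j) hc) _; rewrite lerD2l.
  apply: ler_wpM2l => //; apply: lerD.
    rewrite ger0_norm; first by rewrite lerD2r limit_quantile_mono // ltW.
    by rewrite subr_ge0 limit_quantile_mono.
  rewrite ger0_norm; first by rewrite lerD2r limit_quantile_mono // ltW.
  by rewrite subr_ge0 limit_quantile_mono.
have mpair : measurable_fun [set: R * R]
    (fun st => (circ_kernel c (th st.1) (th st.2))%:E).
  apply/measurable_EFinP.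
  apply: (measurableT_comp (measurable_trunc_log c)
    (g := fun st : R * R => (limit_curve st.1, limit_curve st.2))).
  apply: measurable_fun_pair.
    exact: (measurableT_comp measurable_limit_curve measurable_fst).
  exact: (measurableT_comp measurable_limit_curve measurable_snd).
have ker0 s t : (0 <= (circ_kernel c (th s) (th t))%:E)%E.
  by rewrite lee_fin trunc_log_ge0.
have kerM s t : ((circ_kernel c (th s) (th t))%:E <= (- ln c)%:E)%E.
  by rewrite lee_fin trunc_log_le.
have ms s : measurable_fun [set: R] (fun t => (circ_kernel c (th s) (th t))%:E).
  exact: (measurable_fun_pair2 s mpair).
have inner_le s (e : nat -> R) : (forall j, 0 <= e j) ->
    (forall j t, (j < N)%N -> j%:R / N%:R <= t < j.+1%:R / N%:R ->
      circ_kernel c (th s) (th t) <= e j) ->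
    (\int[uniform_prob (@ltr01 R)]_t (circ_kernel c (th s) (th t))%:E
       <= (N%:R^-1 * \sum_(j < N) e j)%:E)%E.
  by move=> e0 he; exact: (uniform_integral_le (M := - ln c)).
have lc0 : 0 <= - ln c by rewrite oppr_ge0 ln_le0 //; case/andP: hc.
apply: (@le_trans _ _ (N%:R^-1 * \sum_(i < N) (N%:R^-1 * \sum_(j < N) b i j))%:E).
  apply: (uniform_integral_le (M := - ln c)
    (b := fun i => N%:R^-1 * \sum_(j < N) b i j)) => //.
  - pose T : measurableType _ := measurableTypeR R.
    pose f : T * T -> \bar R := fun st => (circ_kernel c (th st.1) (th st.2))%:E.
    have mf : measurable_fun setT f by exact: mpair.
    have f0 st : (0 <= f st)%E by case: st.
    have := measurable_fun_fubini_tonelli_F (m2 := uniform_prob (@ltr01 R)) f mf f0.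
    exact.
  - by move=> s; apply: integral_ge0.
  - move=> s; apply: le_trans (inner_le s (fun=> - ln c) _ _) _ => //.
      by move=> j t _ _; rewrite -lee_fin.
    by rewrite sumr_const card_ord -[- ln c *+ N]mulr_natl mulrA mulVf ?mul1r ?gt_eqF.
  - by move=> i; rewrite mulr_ge0 ?invr_ge0 // sumr_ge0.
  - by move=> i s iN hs; apply: inner_le => // j t jN ht; exact: key.
rewrite lee_fin -mulr_sumr mulrA -invfM -expr2.
rewrite (double_gap_sum (fun i j => circ_kernel c (x i) (x j)) x L N) mulrDr.
have h1 := limit_grid_sum hc N0.
have h2 : (N%:R ^+ 2)^-1 * (L * (N%:R * 2 * (x N - x 0%N))) <= 16 * L / N%:R.
  have -> : 16 * L / N%:R = (N%:R ^+ 2)^-1 * (L * (N%:R * 2 * 8)).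
    by field; rewrite gt_eqF.
  apply: ler_wpM2l; first by rewrite invr_ge0 exprn_ge0.
  apply: ler_wpM2l => //; apply: ler_wpM2l; first by rewrite mulr_ge0.
  have := limit_quantile_range (N%:R / N%:R).
  have := limit_quantile_range (0%N%:R / N%:R); rewrite /x /th; lra.
apply: le_trans (lerD h1 h2) _.
have -> : B + 33 * (2 / c) / N%:R + 16 * L / N%:R = B + 49 * L / N%:R by rewrite /L; ring.
by rewrite lerD2l.
Qed.

(** On [[0, 1[] the curve stays in [E], so the preimage of the complement meets the unit interval at
    most in the point 1. *)
Lemma limit_measure_support : limit_measure [set p | ~ E (toC p)] = 0%E.
Proof.
rewrite limit_measureE /uniform_prob; set U := _ @^-1` _.
apply/eqP; rewrite eq_le; apply/andP; split; last first.
  by apply: integral_ge0 => x _; rewrite lee_fin uniform_pdf_ge0.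
rewrite integral_mkcond.
apply: (@le_trans _ _ (\int[lebesgue_measure]_x (\1_[set (1 : R)] x)%:E)%E).
  apply: ge0_integral_mono => x; first by rewrite lee_fin.
  rewrite patchE; case: ifPn => [|_]; last by rewrite lee_fin.
  rewrite inE => Ux; rewrite lee_fin /uniform_pdf; case: ifP => // /andP[x0 x1].
  rewrite subr0 invr1 indicE; case: (eqVneq x 1) => [->|xn1]; first by rewrite mem_set.
  case: Ux; apply: limit_quantile_E; rewrite x0 /=.
  by rewrite lt_neqAle xn1.
rewrite integral_indic // setIT [leLHS](_ : _ = 0%E) //.
exact: lebesgue_measure_set1.
Qed.

Lemma limit_measure_energy : (log_energy limit_measure <= (B + 1)%:E)%E.
Proof.
apply: log_energy_le => M.
have hc : 0 < (M.+1%:R^-1 : R) <= 1.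
  by rewrite invr_gt0 ltr0n /= invf_le1 ?ltr0n // ler1n.
have mK : measurable_fun [set: (R * R) * (R * R)]
    (fun pq => log_kernel_seq pq.1 pq.2 M).
  by apply/measurable_EFinP; exact: measurable_trunc_log.
rewrite integral_limit_measure; last 2 first.
- apply: (measurable_fun_fubini_tonelli_F (m2 := limit_measure) _ mK) => x.
  exact: log_kernel_seq_ge0.
- by move=> p; apply: integral_ge0 => q _; exact: log_kernel_seq_ge0.
under eq_integral => s _.
  rewrite integral_limit_measure; last 2 first.
  - exact: (measurable_fun_pair2 _ mK).
  - by move=> q; exact: log_kernel_seq_ge0.
  over.
exact: limit_kernel_integral.
Qed.

End LimitMeasure.


Section EnergyUnbounded.
Context {R : realType}.
Local Notation C := R[i].

Lemma log_capacity_zero_energy (E : set C) (B : R) (S : nat -> seq R) :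
  closed_in_C E -> log_capacity_zero E ->
  (forall m, S m != [::]) ->
  (forall m t, t \in S m -> -4 <= t <= 4 /\ E (toC (circ t))) ->
  (forall c, 0 < c <= 1 -> exists m0, forall m, (m0 <= m)%N ->
    \sum_(a <- S m) \sum_(b <- S m) circ_kernel c a b
      <= B * (size (S m))%:R ^+ 2) -> False.
Proof.
move=> Ecl Ecap S0 SE SB.
have := @limit_measure_energy R E B S S0 SE SB.
by rewrite (Ecap _ (limit_measure_support Ecl S0 SE)).
Qed.

End EnergyUnbounded.

(** * Truncated logarithmic kernels *)

Section TruncatedLogKernel.
Context {R : realType}.
Local Notation C := R[i].
Implicit Types z w : C.

(** Taylor polynomial of [- log (1 - z)]. For [w] on the circle, [kern n] at [z] times the conjugate
    of [w] is a polynomial in [z] whose real part is a smooth version of [- ln |z - w|]. *)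
Definition kern (n : nat) z : C := \sum_(k < n) z ^+ k.+1 / k.+1%:R.

Definition harmonic (n : nat) : R := \sum_(k < n) k.+1%:R^-1.

Lemma harmonic_ge0 n : 0 <= harmonic n.
Proof. by apply: sumr_ge0 => k _; rewrite invr_ge0. Qed.

Lemma ln_le_harmonic n : ln n.+1%:R <= harmonic n.
Proof.
elim: n => [|n IH]; first by rewrite /harmonic big_ord0 ln1.
rewrite /harmonic big_ord_recr /=.
have n0 : 0 < n.+1%:R :> R by rewrite ltr0n.
have -> : n.+2%:R = n.+1%:R * (1 + n.+1%:R^-1) :> R.
  by rewrite mulrDr mulr1 divff ?gt_eqF // natr1.
have p0 : 0 < 1 + n.+1%:R^-1 :> R by rewrite addr_gt0 ?invr_gt0.
rewrite lnM ?posrE //.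
apply: lerD => //; apply: le_ln1Dx.
by apply: lt_trans (_ : 0 < _); rewrite ?ltrN10 // invr_gt0.
Qed.

Lemma inv_le_sqrt_gap (k : nat) :
  (Num.sqrt k.+1%:R)^-1 <= 2 * (Num.sqrt k.+1%:R - Num.sqrt k%:R) :> R.
Proof.
have k0 : 0 < Num.sqrt k.+1%:R :> R by rewrite sqrtr_gt0 ltr0n.
have kk : Num.sqrt k%:R <= Num.sqrt k.+1%:R :> R by rewrite ler_wsqrtr // ler_nat.
have e : Num.sqrt k.+1%:R ^+ 2 - Num.sqrt k%:R ^+ 2 = 1 :> R.
  by rewrite !sqr_sqrtr // -natr1 addrAC subrr add0r.
have b0 : 0 <= Num.sqrt k%:R :> R by exact: sqrtr_ge0.
move: k0 kk e b0; set a := Num.sqrt k.+1%:R; set b := Num.sqrt _ => a0 ba e b0.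
rewrite -[a^-1]mul1r ler_pdivrMr // -[leLHS]e subr_sqr.
by rewrite [2 * _]mulrC -mulrA; apply: ler_wpM2l; [rewrite subr_ge0 | lra].
Qed.

Lemma sum_inv_sqrt_le n : \sum_(k < n) (Num.sqrt k.+1%:R)^-1 <= 2 * Num.sqrt n%:R :> R.
Proof.
apply: (@le_trans _ _ (\sum_(k < n) 2 * (Num.sqrt k.+1%:R - Num.sqrt k%:R))).
  by apply: ler_sum => k _; exact: inv_le_sqrt_gap.
rewrite -mulr_sumr -(big_mkord xpredT (fun k => Num.sqrt k.+1%:R - Num.sqrt k%:R)).
by rewrite (telescope_sumr (fun k => Num.sqrt k%:R)) // sqrtr0 subr0.
Qed.

(** Cruder than the logarithm, but inverse square roots of distances are summed by telescoping and
    remain integrable, which is all that [level_avoid] requires. *)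
Lemma harmonic_le_sqrt n : harmonic n <= 2 * Num.sqrt n%:R.
Proof.
apply: le_trans (sum_inv_sqrt_le n); apply: ler_sum => k _.
rewrite lef_pV2 ?posrE ?sqrtr_gt0 ?ltr0n //.
rewrite -[leRHS]sqr_sqrtr // expr2 ler_peMl ?sqrtr_ge0 //.
by rewrite -[leLHS]sqrtr1 ler_wsqrtr // ler1n.
Qed.

Lemma inv_natC (k : nat) : k%:R^-1 = (((k%:R : R)^-1)%:C)%C :> C.
Proof. by rewrite fmorphV (rmorph_nat (real_complex R)). Qed.

Lemma cabs_inv_nat (k : nat) : cabs (k%:R^-1 : C) = k%:R^-1.
Proof. by rewrite cabsV cabs_nat. Qed.

Lemma cabs_expr_le1 z k : cabs z <= 1 -> cabs (z ^+ k) <= 1.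
Proof. by move=> z1; rewrite cabsX exprn_ile1. Qed.

Lemma cabs_kern_le_harmonic n z : cabs z <= 1 -> cabs (kern n z) <= harmonic n.
Proof.
move=> z1; apply: le_trans (cabs_sum _ _ _) _; apply: ler_sum => k _.
by rewrite cabsM cabs_inv_nat ler_piMl ?invr_ge0 // cabs_expr_le1.
Qed.

Lemma abel_kern_tail K m z : cabs z <= 1 ->
  cabs ((1 - z) * \sum_(k < m) z ^+ (K + k).+1 / (K + k).+1%:R) <= 2 / K.+1%:R.
Proof.
move=> z1.
(* Abel summation with the boundary term put back: [A] starts at the first monomial of the sum, and
   each step moves it by at most the drop of the coefficients, so the moves telescope. *)
pose A m := (1 - z) * (\sum_(k < m) z ^+ (K + k).+1 / (K + k).+1%:R)
  + z ^+ (K + m).+1 / (K + m).+1%:R.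
have step j : A j.+1 = A j - z ^+ (K + j).+2 * ((K + j).+1%:R^-1 - (K + j).+2%:R^-1).
  rewrite /A big_ord_recr /= addnS mulrDr [z ^+ (K + j).+2]exprS.
  by set a := (K + j).+1%:R^-1; set b := (K + j).+2%:R^-1; ring.
have bA j : cabs (A j) <= 2 / K.+1%:R - (K + j).+1%:R^-1.
  elim: j => [|j IH].
    rewrite /A big_ord0 mulr0 add0r addn0 cabsM cabs_inv_nat.
    rewrite [leRHS](_ : _ = K.+1%:R^-1); last by ring.
    by rewrite ler_piMl ?invr_ge0 // cabs_expr_le1.
  rewrite step; apply: le_trans (cabsB _ _) _.
  have h : cabs (z ^+ (K + j).+2 * ((K + j).+1%:R^-1 - (K + j).+2%:R^-1)) <=
     (K + j).+1%:R^-1 - (K + j).+2%:R^-1.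
    have h0 : 0 <= ((K + j).+1%:R^-1 - (K + j).+2%:R^-1 : R).
      by rewrite subr_ge0 lef_pV2 ?posrE ?ltr0n // ler_nat.
    rewrite cabsM (_ : cabs (_ - _) = (K + j).+1%:R^-1 - (K + j).+2%:R^-1).
      by rewrite ler_piMl // cabs_expr_le1.
    by rewrite !inv_natC -rmorphB cabs_real ger0_norm.
  by rewrite addnS; apply: le_trans (lerD IH h) _; rewrite addrA subrK.
have -> : (1 - z) * (\sum_(k < m) z ^+ (K + k).+1 / (K + k).+1%:R) =
   A m - z ^+ (K + m).+1 / (K + m).+1%:R by rewrite /A addrK.
apply: le_trans (cabsB _ _) _; rewrite -lerBrDr; apply: le_trans (bA m) _.
by rewrite lerD2l lerN2 cabsM cabs_inv_nat ler_piMl ?invr_ge0 // cabs_expr_le1.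
Qed.

Lemma cabs_kern_le_inv n z : cabs z <= 1 -> z != 1 ->
  cabs (kern n z) <= 2 / cabs (1 - z).
Proof.
move=> z1 zn1; have d0 : 0 < cabs (1 - z) by rewrite cabs_gt0 subr_eq0 eq_sym.
rewrite ler_pdivlMr // mulrC -cabsM.
have := abel_kern_tail 0 n z1; rewrite invr1 mulr1.
by under eq_bigr do rewrite add0n.
Qed.

Lemma cabs_sub_expr z k : cabs z <= 1 -> cabs (1 - z ^+ k) <= k%:R * cabs (1 - z).
Proof.
move=> z1; elim: k => [|k IH]; first by rewrite expr0 subrr cabs0 mul0r.
have -> : 1 - z ^+ k.+1 = (1 - z) + z * (1 - z ^+ k) by rewrite exprS; ring.
apply: le_trans (cabsD _ _) _; rewrite -natr1 mulrDl mul1r addrC lerD2r.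
by apply: le_trans IH; rewrite cabsM ler_piMl.
Qed.

Lemma Re_divn z k : complex.Re (z / k%:R) = complex.Re z / k%:R.
Proof.
rewrite mulrC [RHS]mulrC -ReZ; congr (complex.Re (_ * _)).
exact: inv_natC.
Qed.

(** Each term [z ^ k / k] differs from [1 / k] by at most [|1 - z|], as
    [|1 - z ^ k| <= k |1 - z|]. *)
Lemma Re_kern_head K z : cabs z <= 1 ->
  harmonic K - K%:R * cabs (1 - z) <= complex.Re (kern K z).
Proof.
move=> z1; rewrite Re_sum mulr_natl -[K in _ *+ K]card_ord -sumr_const.
rewrite -sumrB; apply: ler_sum => k _; rewrite Re_divn.
have k0 : 0 < k.+1%:R :> R by rewrite ltr0n.
rewrite ler_pdivlMr // mulrBl mulVf ?gt_eqF // [_ * k.+1%:R]mulrC.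
rewrite lerBlDl -lerBlDr.
apply: le_trans (cabs_sub_expr k.+1 z1).
apply: le_trans (Re_le_cabs _); rewrite ReD ReN; exact: ler_norm.
Qed.

Lemma kern_split K n z : (K <= n)%N ->
  kern n z = kern K z + \sum_(k < n - K) z ^+ (K + k).+1 / (K + k).+1%:R.
Proof.
move=> Kn; rewrite /kern -[n in LHS](subnKC Kn) big_split_ord /=.
by congr (_ + _).
Qed.

(* The cut-off [K] is about [1 / |1 - z|]: below it the powers of [z] are close to
   [1], above it Abel summation applies. *)
Lemma kern_cutoff n z : cabs z <= 1 -> exists K,
  [/\ (K <= n)%N, K%:R * cabs (1 - z) <= 1,
      (K == n) || (1 < K.+1%:R * cabs (1 - z)),
      harmonic K - 3 <= complex.Re (kern n z) &
      cabs (kern n z) <= harmonic K + 2].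
Proof.
move=> z1; set d := cabs (1 - z).
have [K [Kn Kd Kc]] : exists K, [/\ (K <= n)%N, K%:R * d <= 1 &
    (K == n) || (1 < K.+1%:R * d)].
  have [h|h] := leP (n%:R * d) 1; first by exists n; rewrite leqnn h eqxx.
  have d0 : 0 < d.
    by rewrite lt_neqAle cabs_ge0 andbT; apply/eqP => e; move: h; rewrite -e mulr0 ltr10.
  have hv : 0 <= d^-1 by rewrite invr_ge0 ltW.
  have /andP[h1 h2] := truncn_itv hv; exists (Num.truncn d^-1); split.
  - rewrite -(@ler_nat R) (le_trans h1) //.
    by rewrite -[d^-1]mul1r ler_pdivrMr // ltW.
  - by rewrite -ler_pdivlMr // mul1r.
  - by apply/orP; right; rewrite -ltr_pdivrMr // mul1r.
exists K; split=> //.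
all: have := Re_kern_head K z1; rewrite -/d (kern_split z Kn) => hH.
all: set tl := \sum_(k < n - K) _.
all: have htl : cabs tl <= 2.
1,3: case/orP: Kc => [/eqP Ke|Kc].
1,3: by rewrite /tl Ke subnn big_ord0 cabs0.
1,2: have := abel_kern_tail K (n - K) z1; rewrite -/tl cabsM -/d.
1,2: rewrite ler_pdivlMr ?ltr0n // mulrAC mulrC => h.
1,2: have := cabs_ge0 tl; nra.
(* The 3 is 1 lost on the head, where [K |1 - z| <= 1], plus 2 for the tail. *)
- rewrite ReD; have := Re_le_cabs tl; rewrite ler_norml; lra.
- by apply: le_trans (cabsD _ _) _; apply: lerD => //; exact: cabs_kern_le_harmonic.
Qed.

Lemma Re_kern_ge n z : cabs z <= 1 -> -3 <= complex.Re (kern n z).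
Proof.
by move=> z1; have [K [_ _ _ h _]] := kern_cutoff n z1; have := harmonic_ge0 K; lra.
Qed.

(** If the cut-off is below [n], then [harmonic K >= ln (K + 1)] exceeds [- ln |1 - z|]; if it is
    [n], the truncation level [c >= 1 / n] caps the left side at [ln n]. *)
Lemma trunc_log_le_kern c n z : cabs z <= 1 -> 0 < c <= 1 -> c^-1 <= n%:R ->
  trunc_log c (cabs (1 - z)) <= complex.Re (kern n z) + 3.
Proof.
move=> z1 hc cn; have /andP[c0 c1] := hc.
have [K [Kn Kd Kc h _]] := kern_cutoff n z1.
rewrite -lerBlDr; apply: le_trans h; rewrite lerD2r.
apply: le_trans (ln_le_harmonic K).
case/orP: Kc => [/eqP ->|Kc].
  apply: le_trans (trunc_log_le _ hc) _.
  rewrite -lnV ?posrE // ler_ln ?posrE ?invr_gt0 ?ltr0n //.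
  by apply: le_trans cn _; rewrite ler_nat.
have /andP[h1 h2] := trunc_log_arg (cabs (1 - z)) hc.
rewrite /trunc_log lerNl -lnV ?posrE ?ltr0n // ler_ln ?posrE ?invr_gt0 ?ltr0n //; last first.
  exact: lt_le_trans h1.
rewrite le_min invf_le1 ?ltr0n // ler1n /= le_max; apply/orP; left.
by rewrite -[leLHS]mul1r ler_pdivrMr ?ltr0n // mulrC ltW.
Qed.

Lemma cabs_kern_le_sqrt n z : cabs z <= 1 -> z != 1 ->
  cabs (kern n z) <= 2 * (Num.sqrt (cabs (1 - z)))^-1 + 2.
Proof.
move=> z1 zn1; have [K [_ Kd _ _ h]] := kern_cutoff n z1.
have d0 : 0 < cabs (1 - z) by rewrite cabs_gt0 subr_eq0 eq_sym.
apply: le_trans h _; rewrite lerD2r; apply: le_trans (harmonic_le_sqrt K) _.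
rewrite ler_pM2l // -sqrtrV ?(ltW d0) //; apply: ler_wsqrtr.
by rewrite -[leRHS]mul1r ler_pdivlMr.
Qed.

Lemma kern_harmonic n : kern n 1 = ((harmonic n)%:C)%C.
Proof.
rewrite /kern /harmonic rmorph_sum; apply: eq_bigr => k _.
by rewrite expr1n mul1r; exact: inv_natC.
Qed.

Lemma cabs_one_subJ z w : cabs w = 1 -> cabs (1 - z * (w^*)%C) = cabs (z - w).
Proof.
move=> w1; rewrite -[LHS]mul1r -{1}w1 -cabsM mulrBr mulr1 mulrCA mulcJ w1 expr1n.
by rewrite mulr1 cabsBC.
Qed.

Definition energy (n : nat) (s : seq C) : R :=
  \sum_(z <- s) \sum_(w <- s) complex.Re (kern n (z * (w^*)%C)).

(** The order [n] is uniform over all configurations. If no order worked, the [m]-th counterexample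
    would have small energy for the kernel of order [m], which dominates the truncation at any fixed
    [c] up to 3 once [m > 1 / c]; all truncated averages would then end up below [B + 3]. *)
Lemma energy_unbounded (E : set C) (B : R) :
  in_circle E -> closed_in_C E -> log_capacity_zero E ->
  exists n, forall s : seq C, s != [::] -> (forall z, z \in s -> E z) ->
    B * (size s)%:R ^+ 2 <= energy n s.
Proof.
move=> ET Ecl Ecap; apply: contrapT => /forallNP hn.
have {hn} hn n : exists s : seq R, [/\ s != [::],
    forall t, t \in s -> -4 <= t <= 4 /\ E (toC (circ t)) &
    energy n (map (fun t => toC (circ t)) s) < B * (size s)%:R ^+ 2].
  have /existsNP [s /not_implyP [s0 /not_implyP [sE /negP hs]]] := hn n.
  have [f hf] : exists f : C -> R, forall z, E z ->
      -4 <= f z <= 4 /\ z = toC (circ (f z)).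
    have h z : exists t, E z -> -4 <= t <= 4 /\ z = toC (circ t).
      have [Ez|nEz] := pselect (E z); last by exists 0.
      by have [t ht zt] := circ_surj (ET z Ez); exists t.
    by have [f hf] := choice h; exists f.
  exists (map f s); split; first by case: (s) s0.
    by move=> t /mapP [z zs ->]; have [h1 h2] := hf z (sE z zs); rewrite -h2; split => //; exact: sE.
  rewrite size_map -map_comp ltNge.
  have -> : map ((fun t => toC (circ t)) \o f) s = s; last exact: hs.
  by rewrite -[RHS]map_id; apply/eq_in_map => z zs /=; case: (hf z (sE z zs)).
have {hn} [S hS] := choice hn.
apply: (@log_capacity_zero_energy _ E (B + 3) S Ecl Ecap).
- by move=> m; case: (hS m).
- by move=> m t; case: (hS m) => _ h _; exact: h.
move=> c hc; exists (Num.truncn c^-1).+1 => m hm.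
have cm : c^-1 <= m%:R.
  by apply: ltW (lt_le_trans (truncnS_gt _) _); rewrite ler_nat.
have [_ _ /ltW hE] := hS m.
have -> : (B + 3) * (size (S m))%:R ^+ 2 = B * (size (S m))%:R ^+ 2 +
    \sum_(a <- S m) \sum_(b <- S m) 3.
  rewrite mulrDl !big_const_seq !count_predT !iter_addr_0; ring.
apply: le_trans (lerD hE (lexx _)); rewrite /energy big_map -big_split /=.
apply: ler_sum => a _; rewrite big_map -big_split /=; apply: ler_sum => b _.
rewrite /circ_kernel -(cabs_one_subJ _ (cabs_circ b)).
apply: trunc_log_le_kern => //.
by rewrite cabsM cabsJ !cabs_circ mulr1.
Qed.

End TruncatedLogKernel.

(** * Partitions of sets of capacity zero *)

Section Partition.
Context {R : realType}.
Local Notation C := R[i].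
Implicit Types z w : C.

Lemma ulimC_exists (x : nat -> C) (M : R) : (forall n, cabs (x n) <= M) ->
  exists L : C, forall e, 0 < e -> ultra [set n | cabs (x n - L) < e].
Proof.
move=> xM.
have bnd (f : C -> R) : (forall z, `|f z| <= cabs z) -> exists L, ulim_to (f \o x) L.
  move=> hf; apply: (@ulim_exists _ _ (- M) M) => n /=.
  by rewrite -ler_norml; apply: le_trans (hf _) (xM n).
have [a ha] := bnd _ (@Re_le_cabs R).
have [b hb] := bnd _ (@Im_le_cabs R).
exists (Complex a b) => e e0; have e2 : 0 < e / 2 by rewrite divr_gt0.
apply: filterS2 (ha _ e2) (hb _ e2) => n /= h1 h2.
apply: le_lt_trans (cabs_le_ReIm _) _; rewrite ReD ImD ReN ImN /=; lra.
Qed.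

Lemma closed_ulim (E : set C) (x : nat -> C) (L : C) : closed_in_C E ->
  (forall n, E (x n)) -> (forall e, 0 < e -> ultra [set n | cabs (x n - L) < e]) -> E L.
Proof.
move=> Ecl xE hL; apply: Ecl => e e0.
by have [n hn] := ultra_nonempty (hL e e0); exists (x n) => //; rewrite cabsBC.
Qed.

Lemma inv_nat_small (e : R) : 0 < e -> exists N : nat, forall n, (N <= n)%N ->
  n.+1%:R^-1 < e.
Proof.
move=> e0; exists (Num.truncn e^-1) => n hn.
rewrite -[e]invrK ltf_pV2 ?posrE ?invr_gt0 ?ltr0n //.
by apply: lt_le_trans (truncnS_gt _) _; rewrite ler_nat.
Qed.

Lemma dist_level_pos (E : set C) (l : C -> R) (x : R) :
  in_circle E -> closed_in_C E -> (forall z w, `|l z - l w| <= cabs (z - w)) ->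
  (forall z, E z -> l z != x) ->
  exists2 d, 0 < d & forall z, E z -> d <= `|l z - x|.
Proof.
move=> ET Ecl llip hx; apply: contrapT => hn.
have h n : exists z, E z /\ `|l z - x| < n.+1%:R^-1.
  apply: contrapT => /forallNP hz; apply: hn; exists n.+1%:R^-1.
    by rewrite invr_gt0.
  by move=> z Ez; rewrite leNgt; apply/negP => hlt; apply: (hz z).
have [z hz] := choice h.
have [L hL] : exists L : C, forall e, 0 < e -> ultra [set n | cabs (z n - L) < e].
  by apply: (@ulimC_exists z 1) => n; rewrite ET //; case: (hz n).
have EL : E L by apply: closed_ulim hL => // n; case: (hz n).
suff : l L = x by move/eqP; exact/negP/hx.
apply/eqP; rewrite -subr_eq0 -normr_le0; apply/ler_addgt0Pl => e e0.
rewrite addr0; have e2 : 0 < e / 2 by rewrite divr_gt0.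
have [N hN] := inv_nat_small e2.
have [n Nn /= hn'] := ultra_large N (hL _ e2).
have h1 := hN n Nn; have [_ h2] := hz n; have h3 := llip L (z n).
rewrite cabsBC in h3.
apply: le_trans (ler_distD (l (z n)) _ _) _.
have h4 := lt_trans h2 h1; rewrite [e]splitr; apply: lerD; last exact: ltW.
exact: le_trans h3 (ltW hn').
Qed.

(** With truncated subtraction [(i - j) + (j - i)] is the distance of the indices. The diagonal term
    is the inverse of 0, hence 0, and each side of it contributes at most [2 sqrt m]. *)
Lemma sum_inv_sqrt_dist (m i : nat) : (i < m)%N ->
  \sum_(j < m) (Num.sqrt ((i - j) + (j - i))%N%:R)^-1 <= 4 * Num.sqrt m%:R :> R.
Proof.
move=> im.
have mono (k : nat) : (k <= m)%N -> 2 * Num.sqrt k%:R <= 2 * Num.sqrt m%:R :> R.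
  by move=> km; rewrite ler_pM2l //; apply: ler_wsqrtr; rewrite ler_nat.
have -> : 4 * Num.sqrt m%:R = 2 * Num.sqrt m%:R + 2 * Num.sqrt m%:R :> R by ring.
pose f (j : nat) : R := (Num.sqrt ((i - j) + (j - i))%N%:R)^-1.
rewrite -(big_mkord xpredT f) (@big_cat_nat _ _ _ i.+1) //= big_mkord.
have -> : \sum_(i.+1 <= j < m) f j = \sum_(k < m - i.+1) f (k + i.+1)%N.
  by rewrite -{1}[i.+1]add0n big_addn big_mkord.
apply: lerD; last first.
  apply: le_trans (mono (m - i.+1)%N (leq_subr _ _)).
  apply: le_trans (sum_inv_sqrt_le _); apply: ler_sum => k _.
  by rewrite /f (_ : (_ + _)%N = k.+1) //; lia.
apply: le_trans (mono i (ltnW im)); apply: le_trans (sum_inv_sqrt_le _).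
rewrite big_ord_recr /= [f i]/f subnn sqrtr0 invr0 addr0.
rewrite (reindex_inj rev_ord_inj) /=; apply: ler_sum => k _.
by rewrite /f (_ : (_ + _)%N = k.+1) //; have := ltn_ord k; lia.
Qed.

(** If [l] took on [E] every value of the interval, points of [E] at equally spaced levels would be
    at distance at least [h |i - j|], and the kernel bound in [1 / sqrt] would keep their average
    energy below a constant that does not depend on the order of the kernel. *)
Lemma level_avoid (E : set C) (l : C -> R) (x1 x2 : R) :
  in_circle E -> closed_in_C E -> log_capacity_zero E ->
  (forall z w, `|l z - l w| <= cabs (z - w)) -> x1 < x2 ->
  exists2 x, x1 < x < x2 & forall z, E z -> l z != x.
Proof.
move=> ET Ecl Ecap llip x12; apply: contrapT => hn.
have h x : exists z, x1 < x < x2 -> E z /\ l z = x.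
  have [hx|hx] := pselect (x1 < x < x2); last by exists 0.
  apply: contrapT => /forallNP hz; apply: hn; exists x => // z Ez.
  by apply/eqP => lz; apply: (hz z).
have {h} [zf hz] := choice h.
pose D := x2 - x1; have D0 : 0 < D by rewrite subr_gt0.
pose sD := Num.sqrt D; have sD0 : 0 < sD by rewrite sqrtr_gt0.
(* [16 / sD] bounds the singular off-diagonal part, 2 is the additive constant of the kernel bound,
   1 is for the diagonal and 1 remains for strictness. There will be [m = n + 1] points, so that a
   diagonal term, at most [n], is below [m]. *)
have [n hE] := energy_unbounded (4 + 16 / sD) ET Ecl Ecap.
pose m := n.+1; pose h : R := D / m.+1%:R.
have h0 : 0 < h by rewrite divr_gt0.
pose p (j : nat) := x1 + h * j.+1%:R.
have pin j : (j < m)%N -> x1 < p j < x2.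
  move=> jm; rewrite /p ltrDl mulr_gt0 //= -ltrBrDl -/D /h mulrAC.
  by rewrite ltr_pdivrMr // ltr_pM2l // ltr_nat.
pose s := [seq zf (p j) | j <- iota 0 m].
have sE z : z \in s -> E z.
  move=> /mapP [j]; rewrite mem_iota add0n => jm ->.
  by have [] := hz _ (pin j jm).
have := hE s isT sE; apply/negP; rewrite -ltNge.
have -> : size s = m by rewrite size_map size_iota.
pose r : R := (Num.sqrt h)^-1; have r0 : 0 < r by rewrite invr_gt0 sqrtr_gt0.
have pair i j : (i < m)%N -> (j < m)%N ->
   complex.Re (kern n (zf (p i) * ((zf (p j))^*)%C)) <=
   (i == j)%:R * n%:R + 2 * r * (Num.sqrt ((i - j) + (j - i))%N%:R)^-1 + 2.
  move=> im jm; have [Ei li] := hz _ (pin i im); have [Ej lj] := hz _ (pin j jm).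
  have c1 : cabs (zf (p i) * ((zf (p j))^*)%C) <= 1 by rewrite cabsM cabsJ !ET // mulr1.
  apply: le_trans (ler_norm _) _; apply: le_trans (Re_le_cabs _) _.
  have [->|ij] := eqVneq i j.
    rewrite mul1r -addrA; apply: le_trans (cabs_kern_le_harmonic n _) _.
      by rewrite cabsM cabsJ !ET // mulr1.
    rewrite -[leLHS]addr0; apply: lerD; last first.
      by rewrite addr_ge0 // mulr_ge0 ?invr_ge0 ?sqrtr_ge0 // mulr_ge0 // ltW.
    apply: le_trans (_ : \sum_(k < n) 1 <= _); last by rewrite sumr_const card_ord.
    by apply: ler_sum => k _; rewrite invf_le1 ?ltr0n // ler1n.
  rewrite mul0r add0r.
  have dij : h * ((i - j) + (j - i))%N%:R <= cabs (zf (p i) - zf (p j)).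
    apply: le_trans (llip _ _); rewrite li lj /p.
    have -> : x1 + h * i.+1%:R - (x1 + h * j.+1%:R) = h * (i%:R - j%:R).
      by rewrite -!natr1; ring.
    rewrite normrM gtr0_norm // ler_pM2l //.
    have [ji|ij'] := leqP i j.
      by rewrite (eqP ji : (i - j)%N = 0%N) add0n natrB // distrC ler_norm.
    by rewrite (_ : (j - i)%N = 0%N) ?addn0 ?natrB ?(ltnW ij') ?ler_norm //; lia.
  have k0 : (0 < (i - j) + (j - i))%N by lia.
  have dpos : 0 < cabs (zf (p i) - zf (p j)).
    by apply: lt_le_trans dij; rewrite mulr_gt0 // ltr0n.
  have nz1 : zf (p i) * ((zf (p j))^*)%C != 1.
    apply/eqP => e1; move: dpos.
    by rewrite -(cabs_one_subJ _ (ET _ Ej)) e1 subrr cabs0 ltxx.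
  apply: le_trans (cabs_kern_le_sqrt n c1 nz1) _.
  rewrite (cabs_one_subJ _ (ET _ Ej)) lerD2r -mulrA ler_pM2l //.
  rewrite /r -invfM -sqrtrM ?(ltW h0) // lef_pV2 ?posrE ?sqrtr_gt0 ?mulr_gt0 ?ltr0n //.
  exact: ler_wsqrtr.
have -> : energy n s = \sum_(i < m) \sum_(j < m)
    complex.Re (kern n (zf (p i) * ((zf (p j))^*)%C)).
  rewrite /energy big_map -[m]subn0 -/(index_iota 0 m) big_mkord.
  by apply: eq_bigr => i _; rewrite big_map -/(index_iota 0 m) big_mkord.
have row (i : 'I_m) : \sum_(j < m) complex.Re (kern n (zf (p i) * ((zf (p j))^*)%C))
   <= n%:R + 2 * r * (4 * Num.sqrt m%:R) + 2 * m%:R.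
  apply: (@le_trans _ _ (\sum_(j < m) ((val i == val j)%:R * n%:R +
      2 * r * (Num.sqrt ((i - j) + (j - i))%N%:R)^-1 + 2))).
    by apply: ler_sum => j _; exact: pair.
  rewrite !big_split /= -mulr_suml -mulr_sumr sumr_const card_ord [2 * m%:R]mulr_natl mulr2n.
  apply: lerD => //; apply: lerD.
    rewrite (bigD1 i) //= eqxx big1 ?addr0 ?mul1r // => j ji.
    by case: eqP => // /val_inj e; move: ji; rewrite e eqxx.
  by rewrite ler_pM2l ?mulr_gt0 //; exact: sum_inv_sqrt_dist.
apply: (@le_lt_trans _ _ (\sum_(i < m) (n%:R + 2 * r * (4 * Num.sqrt m%:R) + 2 * m%:R))).
  by apply: ler_sum => i _; exact: row.
have sc (c : R) : \sum_(i < m) c = c * m%:R by rewrite sumr_const card_ord mulr_natr.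
rewrite sc.
have rs : r * Num.sqrt m%:R <= 2 * m%:R / sD.
  have nz : Num.sqrt m.+1%:R != 0 :> R by rewrite gt_eqF // sqrtr_gt0 ltr0n.
  have -> : r = Num.sqrt m.+1%:R / sD.
    by rewrite /r /h sqrtrM ?(ltW D0) // sqrtrV ?ler0n // invfM invrK mulrC.
  rewrite mulrAC ler_pM2r ?invr_gt0 //.
  have h1 : Num.sqrt m%:R <= Num.sqrt m.+1%:R :> R by rewrite ler_wsqrtr // ler_nat.
  apply: (@le_trans _ _ (Num.sqrt m.+1%:R ^+ 2)).
    by rewrite expr2; apply: ler_wpM2l => //; exact: sqrtr_ge0.
  by rewrite sqr_sqrtr // -natrM ler_nat mul2n -addnn /m; lia.
have m0 : 0 < m%:R :> R by rewrite ltr0n.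
have nm : n%:R <= m%:R :> R by rewrite ler_nat.
rewrite expr2 mulrA ltr_pM2r //.
have -> : (4 + 16 / sD) * m%:R = 4 * m%:R + 8 * (2 * m%:R / sD) by ring.
nra.
Qed.

End Partition.

Section CellPartition.
Context {R : realType}.
Local Notation C := R[i].
Variable E : set C.
Hypotheses (ET : in_circle E) (Ecl : closed_in_C E) (Ecap : log_capacity_zero E).

Lemma finite_pos_lower_bound (N : nat) (d : nat -> R) :
  (forall i, (i < N)%N -> 0 < d i) ->
  exists2 e, 0 < e & forall i, (i < N)%N -> e <= d i.
Proof.
elim: N => [|N IH] h; first by exists 1.
have [i iN|e e0 he] := IH; first by apply: h; exact: ltnW.
exists (Num.min e (d N)); first by rewrite lt_min e0 h.
move=> i; rewrite ltnS leq_eqVlt => /orP[/eqP ->|iN]; first by rewrite ge_min lexx orbT.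
by rewrite ge_min he.
Qed.

(** Between two neighbouring grid points there is a level that [l] avoids on [E], and the cell of a
    point is the number of these levels below it. Points of different cells are separated by such a
    level, from which [l] keeps a positive distance on [E]. *)
Lemma level_partition (l : C -> R) (e : R) :
  (forall z w, `|l z - l w| <= cabs (z - w)) -> (forall z, E z -> `|l z| <= 1) ->
  0 < e -> exists (J : nat) (cell : C -> nat) (d : R), [/\ 0 < d,
    forall z, (cell z < J)%N,
    forall z w, E z -> E w -> cell z = cell w -> `|l z - l w| <= e &
    forall z w, E z -> E w -> cell z <> cell w -> d <= cabs (z - w)].
Proof.
move=> llip l1 e0; pose N := (Num.truncn (4 / e)).+1.
have N0 : 0 < N%:R :> R by rewrite ltr0n.
have eN : 4 / N%:R < e.
  by rewrite ltr_pdivrMr // mulrC -ltr_pdivrMr // truncnS_gt.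
pose g (i : nat) : R := -1 + 2 * i%:R / N%:R.
have gg i : g i < g i.+1.
  by rewrite /g ltrD2l ltr_pM2r ?invr_gt0 // ltr_pM2l // ltr_nat.
have hx i : exists x, g i < x < g i.+1 /\ forall z, E z -> l z != x.
  by have [x h1 h2] := level_avoid ET Ecl Ecap llip (gg i); exists x.
have [x {}hx] := choice hx.
have hd i : exists d, 0 < d /\ forall z, E z -> d <= `|l z - x i|.
  by have [d h1 h2] := dist_level_pos ET Ecl llip (hx i).2; exists d.
have [d {}hd] := choice hd.
have [dm dm0 hdm] := @finite_pos_lower_bound N d (fun i _ => (hd i).1).
pose cell (z : C) := (\sum_(i < N) (x i < l z)%R)%N.
exists N.+1, cell, dm; split => //.
- move=> z; rewrite ltnS; apply: (@leq_trans (\sum_(i < N) 1)%N).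
    by apply: leq_sum => i _; case: (x i < l z).
  by rewrite sum_nat_const card_ord muln1.
- have W z w : E z -> E w -> l z <= l w -> cell z = cell w -> l w - l z <= e.
    move=> Ez Ew zw cc; rewrite leNgt; apply/negP => far.
    have lz := l1 z Ez; have lw := l1 w Ew; rewrite !ler_norml in lz lw.
    (* [k] is the grid interval containing [l z]. The avoided level of the next interval lies above
       [l z] by at most [4 / N < e], hence below [l w], and so separates the cells. *)
    pose k := Num.truncn ((l z + 1) * N%:R / 2); pose i := k.+1.
    have p0 : 0 <= (l z + 1) * N%:R / 2 by rewrite divr_ge0 // mulr_ge0 //; lra.
    have /andP[i1 i2] := truncn_itv p0; rewrite -/k -/i in i1 i2.
    have gi : l z < g i.
      rewrite /g -ltrBlDl opprK ltr_pdivlMr // -[2 * _]mulrC -ltr_pdivrMr //.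
    have gi2 : g i.+1 <= l z + 4 / N%:R.
      have -> : g i.+1 = -1 + 2 * k%:R / N%:R + 4 / N%:R.
        by rewrite /g /i -addn2 natrD; field; rewrite gt_eqF.
      rewrite lerD2r -lerBrDl opprK ler_pdivrMr // mulrC -ler_pdivlMr //.
    have xi := hx i; have {xi} [/andP[x1 x2] _] := xi.
    have iN : (i < N)%N.
      rewrite -(@ltr_nat R) -(ltr_pM2l (_ : 0 < 2 / N%:R)) ?divr_gt0 //.
      have -> : 2 / N%:R * N%:R = 2 :> R by rewrite mulfVK // gt_eqF.
      have : g i < 1 by apply: lt_trans x1 _; lra.
      by rewrite /g mulrAC; lra.
    have : (cell z < cell w)%N.
      rewrite /cell (bigD1 (Ordinal iN)) //= [X in (_ < X)%N](bigD1 (Ordinal iN)) //=.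
      have -> : (x i < l z) = false by apply/negbTE; rewrite -leNgt; lra.
      have -> : (x i < l w) = true by lra.
      rewrite add0n add1n ltnS; apply: leq_sum => j _.
      by case: ltP => // h; rewrite (lt_le_trans h zw).
    by rewrite cc ltnn.
  move=> z w Ez Ew cc; have [zw|/ltW wz] := leP (l z) (l w).
    by rewrite distrC ger0_norm ?subr_ge0 // W.
  by rewrite ger0_norm ?subr_ge0 // W.
- move=> z w Ez Ew /eqP cc; apply: le_trans (llip z w).
  have [i hi] : exists i : 'I_N, (x i < l z) != (x i < l w).
    apply: contrapT => /forallNP h; move/eqP: cc; apply; apply: eq_bigr => i _.
    by have /negP := h i; rewrite negbK => /eqP ->.
  apply: le_trans (hdm i (ltn_ord i)) _.
  have h1 := (hd i).2 z Ez; have h2 := (hd i).2 w Ew; have d0 := (hd i).1.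
  move: hi h1 h2; case: (ltP (x i) (l z)) => a; case: (ltP (x i) (l w)) => b //= _.
    rewrite (gtr0_norm (_ : 0 < l z - x i)) ?subr_gt0 // => h1 h2.
    by rewrite ger0_norm; lra.
  move=> h1; rewrite (gtr0_norm (_ : 0 < l w - x i)) ?subr_gt0 // => h2.
  by rewrite ler0_norm; lra.
Qed.

(** Real and imaginary parts are 1-Lipschitz; the pair of their cells is coded in base [J2]. *)
Lemma cell_partition (e : R) : 0 < e ->
  exists (J : nat) (cell : C -> nat) (d : R), [/\ 0 < d,
    forall z, (cell z < J)%N,
    forall z w, E z -> E w -> cell z = cell w -> cabs (z - w) <= e &
    forall z w, E z -> E w -> cell z <> cell w -> d <= cabs (z - w)].
Proof.
move=> e0; have e2 : 0 < e / 2 by rewrite divr_gt0.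
have Rlip (z w : C) : `|complex.Re z - complex.Re w| <= cabs (z - w).
  by rewrite -ReN -ReD Re_le_cabs.
have Ilip (z w : C) : `|complex.Im z - complex.Im w| <= cabs (z - w).
  by rewrite -ImN -ImD Im_le_cabs.
have [z Ez|J1 [c1 [d1 [d10 b1 h1 s1]]]] := level_partition Rlip _ e2.
  by rewrite -(ET Ez) Re_le_cabs.
have [z Ez|J2 [c2 [d2 [d20 b2 h2 s2]]]] := level_partition Ilip _ e2.
  by rewrite -(ET Ez) Im_le_cabs.
exists (J1 * J2)%N, (fun z => c1 z * J2 + c2 z)%N, (Num.min d1 d2); split.
- by rewrite lt_min d10.
- by move=> z; have := b1 z; have := b2 z; nia.
- move=> z w Ez Ew hc; have := b2 z; have := b2 w => bw bz.
  have hd : c1 z = c1 w.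
    have := congr1 (fun n => n %/ J2)%N hc.
    by rewrite !divnMDl ?(leq_trans _ bz) // !divn_small // !addn0.
  have hm : c2 z = c2 w by move: hc; rewrite hd => /addnI.
  rewrite [e]splitr; apply: le_trans (cabs_le_ReIm _) _; rewrite ReD ImD ReN ImN.
  by apply: lerD; [apply: h1 | apply: h2].
- move=> z w Ez Ew hc; have [h|h] := eqVneq (c1 z) (c1 w).
    have [h'|h'] := eqVneq (c2 z) (c2 w); first by case: hc; rewrite h h'.
    by apply: le_trans (s2 z w Ez Ew (elimN eqP h')); rewrite ge_min lexx orbT.
  by apply: le_trans (s1 z w Ez Ew (elimN eqP h)); rewrite ge_min lexx.
Qed.

End CellPartition.

(** * The Dirichlet norm *)

Section DirichletNorm.
Context {R : realType}.
Local Notation C := R[i].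
Implicit Types a b : nat -> C.

Definition dsum a (n : nat) : R := \sum_(k < n) k.+1%:R * cabs (a k) ^+ 2.

(** Meaningful only under [inD]: [fine] sends an infinite value to 0. Bounds on [dn] are therefore
    proved together with membership in the space. *)
Definition dn a : R := Num.sqrt (fine (dnorm2 a)).

Lemma dterm_ge0 a k : 0 <= k.+1%:R * cabs (a k) ^+ 2.
Proof. by rewrite mulr_ge0 // exprn_ge0. Qed.

Lemma dsum_ge0 a n : 0 <= dsum a n.
Proof. by apply: sumr_ge0 => k _; exact: dterm_ge0. Qed.

Lemma dnorm2_ge0 a : (0 <= dnorm2 a)%E.
Proof. by apply: nneseries_ge0 => k _ _; rewrite lee_fin dterm_ge0. Qed.

Lemma dsum_le_dnorm2 a n : ((dsum a n)%:E <= dnorm2 a)%E.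
Proof.
rewrite /dnorm2 /dsum -(big_mkord xpredT (fun k => k.+1%:R * cabs (a k) ^+ 2)) -sumEFin.
by apply: nneseries_lim_ge => k _; rewrite lee_fin dterm_ge0.
Qed.

Lemma dnorm2_leP a (M : R) : (dnorm2 a <= M%:E)%E <-> forall n, dsum a n <= M.
Proof.
split=> h.
  by move=> n; rewrite -lee_fin; apply: le_trans h; exact: dsum_le_dnorm2.
apply: lime_le; first by apply: is_cvg_nneseries => k _ _; rewrite lee_fin dterm_ge0.
apply: nearW => n; rewrite sumEFin lee_fin big_mkord; exact: h.
Qed.

Lemma dn_ge0 a : 0 <= dn a. Proof. exact: sqrtr_ge0. Qed.
Hint Resolve dn_ge0 : core.

Lemma inD_dnorm2E a : inD a -> dnorm2 a = (dn a ^+ 2)%:E.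
Proof.
move=> h; rewrite /dn sqr_sqrtr ?fine_ge0 ?dnorm2_ge0 // fineK //.
by rewrite ge0_fin_numE ?dnorm2_ge0.
Qed.

Lemma inD_bound a (M : R) : (forall n, dsum a n <= M) -> inD a.
Proof. by move=> /dnorm2_leP h; apply: le_lt_trans h _; exact: ltry. Qed.

Lemma dn_le a (M : R) : 0 <= M -> (forall n, dsum a n <= M ^+ 2) -> inD a /\ dn a <= M.
Proof.
move=> M0 h; have Da := inD_bound h; split=> //.
move/dnorm2_leP: h; rewrite inD_dnorm2E // lee_fin.
by rewrite ler_pXn2r ?nnegrE.
Qed.

Lemma dsum_le_dn a n : inD a -> dsum a n <= dn a ^+ 2.
Proof. by move=> h; rewrite -lee_fin -inD_dnorm2E //; exact: dsum_le_dnorm2. Qed.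

Lemma ddist_ltE a b (e : R) : 0 < e -> inD (fun k => a k - b k) ->
  ddist_lt a b e <-> dn (fun k => a k - b k) < e.
Proof.
move=> e0 h; rewrite /ddist_lt inD_dnorm2E // lte_fin.
by rewrite ltr_pXn2r ?nnegrE // ltW.
Qed.

Lemma ddist_lt_inD a b (e : R) : ddist_lt a b e -> inD (fun k => a k - b k).
Proof. by move=> h; apply: lt_trans h _; exact: ltry. Qed.

Lemma cabs_le_dn a k : inD a -> cabs (a k) <= dn a.
Proof.
move=> h; rewrite -(@ler_pXn2r _ 2) ?nnegrE //.
apply: le_trans (dsum_le_dn k.+1 h).
rewrite /dsum big_ord_recr /= -[leLHS]add0r; apply: lerD; first exact: dsum_ge0.
by rewrite ler_peMl ?exprn_ge0 // ler1n.
Qed.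

(** Minkowski without Cauchy-Schwarz: termwise [(x + y) ^ 2 <= (1 + B / A) x ^ 2 + (1 + A / B) y ^
    2], the difference being a multiple of the square of [B x - A y]. *)
Lemma dsumD_le a b n (A B : R) : 0 < A -> 0 < B ->
  dsum a n <= A ^+ 2 -> dsum b n <= B ^+ 2 ->
  dsum (fun k => a k + b k) n <= (A + B) ^+ 2.
Proof.
move=> A0 B0 ha hb.
have -> : (A + B) ^+ 2 = (1 + B / A) * A ^+ 2 + (1 + A / B) * B ^+ 2.
  by field; rewrite !gt_eqF.
apply: (@le_trans _ _ ((1 + B / A) * dsum a n + (1 + A / B) * dsum b n)); last first.
  by apply: lerD; rewrite ler_pM2l // addr_gt0 // divr_gt0.
rewrite /dsum !mulr_sumr -big_split /=; apply: ler_sum => k _.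
rewrite ![_ * (k.+1%:R * _)]mulrCA -mulrDr ler_pM2l ?ltr0n //.
have xy := cabsD (a k) (b k); set x := cabs (a k) in xy *; set y := cabs (b k) in xy *.
apply: (@le_trans _ _ ((x + y) ^+ 2)).
  by rewrite ler_pXn2r ?nnegrE ?addr_ge0 // cabs_ge0.
rewrite -subr_ge0.
have -> : (1 + B / A) * x ^+ 2 + (1 + A / B) * y ^+ 2 - (x + y) ^+ 2 =
   (B * x - A * y) ^+ 2 / (A * B) by field; rewrite !gt_eqF.
by rewrite divr_ge0 ?sqr_ge0 // mulr_ge0 // ltW.
Qed.

Lemma dnD a b : inD a -> inD b ->
  inD (fun k => a k + b k) /\ dn (fun k => a k + b k) <= dn a + dn b.
Proof.
move=> ha hb.
(* Padding by [e / 2] makes positive the two bounds given to [dsumD_le]. *)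
have key (e : R) : 0 < e -> inD (fun k => a k + b k) /\
    dn (fun k => a k + b k) <= dn a + dn b + e.
  move=> e0; apply: dn_le; first by rewrite addr_ge0 ?addr_ge0 // ltW.
  move=> n; have -> : dn a + dn b + e = (dn a + e / 2) + (dn b + e / 2).
    by rewrite addrACA -splitr.
  have e2 : 0 < e / 2 by rewrite divr_gt0.
  have pos (x : R) : 0 <= x -> 0 < x + e / 2 by move=> x0; rewrite ltr_wpDl.
  by apply: dsumD_le; rewrite ?pos // (le_trans (dsum_le_dn n _)) //
    ler_pXn2r ?nnegrE ?(ltW (pos _ _)) // lerDl ltW.
split; first by case: (key 1 ltr01).
by apply/ler_addgt0Pr => e /key[].
Qed.

Lemma dnZ (c : C) a : inD a ->
  inD (fun k => c * a k) /\ dn (fun k => c * a k) <= cabs c * dn a.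
Proof.
move=> ha; apply: dn_le; first by rewrite mulr_ge0.
move=> n; rewrite exprMn.
have -> : dsum (fun k => c * a k) n = cabs c ^+ 2 * dsum a n.
  rewrite /dsum mulr_sumr; apply: eq_bigr => k _.
  by rewrite cabsM exprMn mulrCA.
by apply: ler_wpM2l; [rewrite exprn_ge0 | exact: dsum_le_dn].
Qed.

Lemma eq_dn a b : a =1 b -> dn a = dn b.
Proof. by move=> /funext ->. Qed.

Lemma eq_inD a b : a =1 b -> inD a -> inD b.
Proof. by move=> /funext ->. Qed.

Lemma dnN a : inD a -> inD (fun k => - a k) /\ dn (fun k => - a k) <= dn a.
Proof.
move=> ha; have [h1 h2] := dnZ (-1) ha.
have e : (fun k => -1 * a k) = (fun k => - a k) by apply/funext => k; rewrite mulN1r.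
by rewrite -e; split => //; apply: le_trans h2 _; rewrite cabsN cabs1 mul1r.
Qed.

Lemma dnB a b : inD a -> inD b ->
  inD (fun k => a k - b k) /\ dn (fun k => a k - b k) <= dn a + dn b.
Proof.
move=> ha hb; have [h1 h2] := dnN hb; have [h3 h4] := dnD ha h1.
by split=> //; apply: le_trans h4 _; rewrite lerD2l.
Qed.

Lemma dnBC a b : dn (fun k => a k - b k) = dn (fun k => b k - a k).
Proof.
rewrite /dn /dnorm2; congr (Num.sqrt (fine _)); apply: eq_eseriesr => k _.
by rewrite cabsBC.
Qed.

Lemma inDBC a b : inD (fun k => a k - b k) -> inD (fun k => b k - a k).
Proof. by move=> /dnN[h _]; apply: eq_inD h => k; rewrite opprB. Qed.

Lemma dn_triB a b c : inD (fun k => a k - b k) -> inD (fun k => b k - c k) ->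
  inD (fun k => a k - c k) /\
  dn (fun k => a k - c k) <= dn (fun k => a k - b k) + dn (fun k => b k - c k).
Proof.
move=> h1 h2; have [h3 h4] := dnD h1 h2.
have e : (fun k => a k - b k + (b k - c k)) = (fun k => a k - c k).
  by apply/funext => k; rewrite addrA subrK.
by rewrite e in h3 h4.
Qed.

Definition shiftseq (i : nat) a (k : nat) : C := if (i <= k)%N then a (k - i)%N else 0.

Lemma shiftseq_lt i a k : (k < i)%N -> shiftseq i a k = 0.
Proof. by move=> ki; rewrite /shiftseq leqNgt ki. Qed.

(** The weights [k + 1] grow by a factor at most [i + 1] under the shift; its square root is bounded
    by [i + 1]. *)
Lemma dn_shift i a : inD a ->
  inD (shiftseq i a) /\ dn (shiftseq i a) <= i.+1%:R * dn a.
Proof.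
move=> ha; apply: dn_le; first by rewrite mulr_ge0.
move=> n; have [ni|/ltnW ni] := leqP n i.
  rewrite /dsum big1; first by rewrite exprn_ge0 // mulr_ge0.
  by move=> k _; rewrite shiftseq_lt ?cabs0 ?expr0n ?mulr0 // (leq_trans (ltn_ord k)).
rewrite /dsum -(big_mkord xpredT (fun k => k.+1%:R * cabs (shiftseq i a k) ^+ 2)).
rewrite (@big_cat_nat _ _ _ i) //= [X in X + _]big_nat big1 ?add0r; last first.
  by move=> k /andP[_ ki]; rewrite shiftseq_lt // cabs0 expr0n mulr0.
rewrite -{1}(add0n i) big_addn big_mkord.
apply: (@le_trans _ _ (i.+1%:R * dsum a (n - i))).
  rewrite /dsum mulr_sumr; apply: ler_sum => k _.
  rewrite /shiftseq leq_addl addnK mulrA; apply: ler_wpM2r; first by rewrite exprn_ge0.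
  by rewrite -natrM ler_nat; lia.
rewrite exprMn; apply: ler_pM => //; first exact: dsum_ge0.
- by rewrite ler_peMl // ler1n.
- exact: dsum_le_dn.
Qed.

Lemma dn_sum (I : Type) (r : seq I) (F : I -> nat -> C) :
  (forall i, inD (F i)) ->
  inD (fun k => \sum_(i <- r) F i k) /\
  dn (fun k => \sum_(i <- r) F i k) <= \sum_(i <- r) dn (F i).
Proof.
move=> hF; elim: r => [|i r [IH1 IH2]].
  rewrite big_nil.
  have -> : (fun k => \sum_(i <- [::]) F i k) = (fun=> 0).
    by apply/funext => k; rewrite big_nil.
  apply: dn_le => // n; rewrite /dsum big1 ?expr0n // => k _.
  by rewrite cabs0 expr0n mulr0.
have [h1 h2] := dnD (hF i) IH1.
have e : (fun k => F i k + \sum_(j <- r) F j k) = (fun k => \sum_(j <- i :: r) F j k).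
  by apply/funext => k; rewrite big_cons.
rewrite e in h1 h2; split => //; rewrite big_cons; apply: le_trans h2 _.
by rewrite lerD2l.
Qed.

Definition mulbound (q : {poly C}) : R := \sum_(i < size q) cabs q`_i * i.+1%:R.

Lemma pmulE q a k : pmul q a k = \sum_(i < size q) q`_i * shiftseq i a k.
Proof.
rewrite /pmul; set n := maxn (size q) k.+1.
rewrite (big_ord_widen n (fun i => q`_i * a (k - i)%N)) ?leq_maxr //.
rewrite (big_ord_widen n (fun i => q`_i * shiftseq i a k)) ?leq_maxl //.
rewrite big_mkcond [RHS]big_mkcond /=; apply: eq_bigr => i _.
rewrite /shiftseq ltnS; case: (leqP i k) => ik; case: (ltnP i (size q)) => iq //=.
- by rewrite nth_default // mul0r.
- by rewrite mulr0.
Qed.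

Lemma dn_pmul q a : inD a -> inD (pmul q a) /\ dn (pmul q a) <= mulbound q * dn a.
Proof.
move=> ha.
have hF (i : 'I_(size q)) : inD (fun k => q`_i * shiftseq i a k).
  by have [h _] := dn_shift i ha; have [] := dnZ q`_i h.
have [h1 h2] := dn_sum (index_enum 'I_(size q)) hF.
have e : (fun k => \sum_(i < size q) q`_i * shiftseq i a k) = pmul q a.
  by apply/funext => k; rewrite pmulE.
rewrite e in h1 h2; split=> //; apply: le_trans h2 _.
rewrite /mulbound mulr_suml; apply: ler_sum => i _.
have [h3 h4] := dn_shift i ha; have [_ h5] := dnZ q`_i h3.
by apply: le_trans h5 _; rewrite -mulrA; apply: ler_wpM2l.
Qed.

Definition pc (p : {poly C}) (k : nat) : C := p`_k.

(** Wiener norm: it dominates the supremum on the closed disc, is submultiplicative, and differs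
    from [dn] only by factors of the size. *)
Definition l1 (p : {poly C}) : R := \sum_(k < size p) cabs p`_k.

Lemma l1_ge0 p : 0 <= l1 p.
Proof. exact: sumr_ge0. Qed.

Lemma dsum_pc p n : dsum (pc p) n <= \sum_(k < size p) k.+1%:R * cabs p`_k ^+ 2.
Proof.
rewrite /dsum /pc; set m := maxn n (size p).
rewrite (big_ord_widen m (fun k => k.+1%:R * cabs p`_k ^+ 2)) ?leq_maxl //.
rewrite [leRHS](big_ord_widen m (fun k => k.+1%:R * cabs p`_k ^+ 2)) ?leq_maxr //.
rewrite big_mkcond [leRHS]big_mkcond; apply: ler_sum => k _.
have := dterm_ge0 (pc p) k; rewrite /pc.
case: (ltnP k n) => kn; case: (ltnP k (size p)) => kp // _.
by rewrite nth_default // cabs0 expr0n mulr0.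
Qed.

Lemma inD_pc p : inD (pc p).
Proof. by apply: inD_bound => n; exact: dsum_pc. Qed.

Lemma cabs_horner_le_l1 p z : cabs z <= 1 -> cabs p.[z] <= l1 p.
Proof.
move=> z1; rewrite horner_coef; apply: le_trans (cabs_sum _ _ _) _.
apply: ler_sum => k _; rewrite cabsM ler_piMr // cabsX exprn_ile1 //.
Qed.

Lemma l1_le_dn p : l1 p <= (size p)%:R * dn (pc p).
Proof.
have -> : (size p)%:R * dn (pc p) = \sum_(k < size p) dn (pc p).
  by rewrite sumr_const card_ord mulr_natl.
by apply: ler_sum => k _; exact: (cabs_le_dn k (inD_pc p)).
Qed.

Lemma dn_le_l1 p : dn (pc p) <= (size p)%:R * l1 p.
Proof.
apply: (proj2 (dn_le _ _)); first by rewrite mulr_ge0 ?l1_ge0.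
move=> n; apply: le_trans (dsum_pc p n) _.
have kb (k : 'I_(size p)) : cabs p`_k <= l1 p.
  by rewrite /l1 (bigD1 k) //= lerDl sumr_ge0.
apply: (@le_trans _ _ (\sum_(k < size p) (size p)%:R * l1 p ^+ 2)).
  apply: ler_sum => k _; apply: ler_pM => //; first by rewrite exprn_ge0.
    by rewrite ler_nat.
  by rewrite ler_pXn2r ?nnegrE ?l1_ge0.
have sc (c : R) : \sum_(i < size p) c = (size p)%:R * c.
  by rewrite sumr_const card_ord mulr_natl.
by rewrite sc exprMn mulrA -expr2.
Qed.

Lemma pmul_pc q p : pmul q (pc p) =1 pc (q * p).
Proof. by move=> k; rewrite /pc coefM. Qed.

Lemma qf_minus1_pc q p : qf_minus1 q (pc p) =1 pc (q * p - 1).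
Proof. by move=> k; rewrite /qf_minus1 pmul_pc /pc coefB coef1. Qed.

End DirichletNorm.
#[export] Hint Extern 0 (is_true (@Order.le _ _ _ (dn _))) => exact: dn_ge0 : core.
#[export] Hint Extern 0 (is_true (@Order.le _ _ _ (l1 _))) => exact: l1_ge0 : core.

(** * Optimal polynomial approximants *)

Section OptimalApproximants.
Context {R : realType}.
Local Notation C := R[i].
Implicit Types (a b : nat -> C) (p q : {poly C}).

Lemma l1E p m : (size p <= m)%N -> l1 p = \sum_(k < m) cabs p`_k.
Proof.
move=> pm; rewrite /l1 (big_ord_widen m (fun k => cabs p`_k)) // big_mkcond /=.
apply: eq_bigr => k _; case: ltnP => // h.
by rewrite nth_default // cabs0.
Qed.

Lemma l1D p q : l1 (p + q) <= l1 p + l1 q.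
Proof.
set m := maxn (size p) (size q).
rewrite (@l1E p m) ?leq_maxl // (@l1E q m) ?leq_maxr // (@l1E (p + q) m) ?size_polyD //.
by rewrite -big_split /=; apply: ler_sum => k _; rewrite coefD cabsD.
Qed.

Lemma l1N p : l1 (- p) = l1 p.
Proof. by rewrite /l1 size_polyN; apply: eq_bigr => k _; rewrite coefN cabsN. Qed.

Lemma cabs_coef_le_l1 p i : cabs p`_i <= l1 p.
Proof.
have [ip|ip] := ltnP i (size p); last by rewrite nth_default // cabs0.
by rewrite /l1 (bigD1 (Ordinal ip)) //= lerDl sumr_ge0.
Qed.

Lemma mulbound_le_l1 p m : (size p <= m)%N -> mulbound p <= m%:R * l1 p.
Proof.
move=> pm; rewrite /mulbound /l1 mulr_sumr; apply: ler_sum => i _.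
rewrite mulrC; apply: ler_wpM2r => //; rewrite ler_nat.
exact: leq_trans (ltn_ord i) pm.
Qed.

Lemma dn_pmul_l1 p a m : (size p <= m)%N -> inD a ->
  inD (pmul p a) /\ dn (pmul p a) <= m%:R * l1 p * dn a.
Proof.
move=> pm ha; have [h1 h2] := dn_pmul p ha; split=> //.
by apply: le_trans h2 _; apply: ler_wpM2r => //; exact: mulbound_le_l1.
Qed.

Lemma pmulDl p q a k : pmul (p + q) a k = pmul p a k + pmul q a k.
Proof. by rewrite /pmul -big_split /=; apply: eq_bigr => i _; rewrite coefD mulrDl. Qed.

Lemma pmulNl p a k : pmul (- p) a k = - pmul p a k.
Proof. by rewrite /pmul -sumrN; apply: eq_bigr => i _; rewrite coefN mulNr. Qed.

Lemma pmulBl p q a k : pmul (p - q) a k = pmul p a k - pmul q a k.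
Proof. by rewrite pmulDl pmulNl. Qed.

Lemma pmulBr p a b k : pmul p (fun k => a k - b k) k = pmul p a k - pmul p b k.
Proof. by rewrite /pmul -sumrB; apply: eq_bigr => i _; rewrite mulrBr. Qed.

Definition one_seq (k : nat) : C := (k == 0%N)%:R.

Lemma dn_one : inD one_seq /\ dn one_seq <= 1.
Proof.
apply: dn_le => // n; rewrite expr1n /dsum.
case: n => [|n]; first by rewrite big_ord0.
rewrite big_ord_recl big1 ?addr0; first by rewrite cabs1 expr1n mulr1.
move=> i _; have -> : one_seq (lift ord0 i) = 0 by [].
by rewrite cabs0 expr0n mulr0.
Qed.

Definition err a q : R := dn (qf_minus1 q a).

Lemma inD_qf q a : inD a -> inD (qf_minus1 q a).
Proof.
move=> ha; have [h _] := dn_pmul q ha.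
by have [] := dnB h dn_one.1.
Qed.

Lemma err_ge0 a q : 0 <= err a q. Proof. exact: dn_ge0. Qed.

Lemma errQE a q : inD a -> errQ a q = (err a q ^+ 2)%:E.
Proof. by move=> ha; rewrite /errQ inD_dnorm2E //; exact: inD_qf. Qed.

Lemma errQ_le a p q : inD a -> (errQ a q <= errQ a p)%E = (err a q <= err a p).
Proof. by move=> ha; rewrite !errQE // lee_fin ler_pXn2r ?nnegrE ?err_ge0. Qed.

Lemma err0 a : err a 0 <= 1.
Proof.
rewrite /err (eq_dn (b := fun k => - one_seq k)).
  by apply: le_trans (dnN dn_one.1).2 dn_one.2.
by move=> k; rewrite /qf_minus1 /pmul big1 ?sub0r // => i _; rewrite coef0 mul0r.
Qed.

Lemma dn_pmul_le_err a q : inD a -> dn (pmul q a) <= err a q + 1.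
Proof.
move=> ha; have [_ h] := dnD (inD_qf q ha) dn_one.1.
have e : (fun k => qf_minus1 q a k + one_seq k) =1 pmul q a.
  by move=> k; rewrite /qf_minus1 subrK.
by rewrite -(eq_dn e); apply: le_trans h _; rewrite lerD2l dn_one.2.
Qed.

Lemma err_lip a p q : inD a -> err a p <= err a q + dn (pmul (p - q) a).
Proof.
move=> ha; have [h _] := dn_pmul (p - q) ha.
have [_ h2] := dnD (inD_qf q ha) h.
apply: le_trans h2; rewrite /err le_eqVlt; apply/orP; left; apply/eqP.
by apply: eq_dn => k; rewrite /qf_minus1 pmulBl; ring.
Qed.

Lemma err_lipr a b q : inD a -> inD b ->
  err a q <= err b q + dn (pmul q (fun k => a k - b k)).
Proof.
move=> ha hb; have [h _] := dn_pmul q (dnB ha hb).1.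
have [_ h2] := dnD (inD_qf q hb) h.
apply: le_trans h2; rewrite /err le_eqVlt; apply/orP; left; apply/eqP.
by apply: eq_dn => k; rewrite /qf_minus1 pmulBr; ring.
Qed.

(** With [k0] the order of vanishing of [a] at 0, the coefficients of [p] are recovered one after
    the other from those of the product, each time dividing by [a k0]. This is coercivity on
    polynomials of bounded degree. *)
Lemma coef_le_dn_pmul a : inD a -> ~ is_zero_fun a -> forall m,
  exists2 K : R, 0 < K & forall p, (size p <= m)%N -> l1 p <= K * dn (pmul p a).
Proof.
move=> ha a0 m.
have /existsNP [k0' hk0'] := a0.
have exk : exists k, a k != 0 by exists k0'; apply/eqP.
have [k0 ak0 kmin] := ex_minnP exk => {k0' hk0' exk}.
have c0 : 0 < cabs (a k0) by rewrite cabs_gt0.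
have key i : exists2 K : R, 0 < K & forall p j, (j < i)%N ->
    cabs p`_j <= K * dn (pmul p a).
  elim: i => [|i [K K0 IH]]; first by exists 1.
  pose K' := K + (1 + i%:R * (K * dn a)) / cabs (a k0).
  exists K' => [|p j].
    by rewrite addr_gt0 // divr_gt0 // ltr_wpDr // mulr_ge0 // mulr_ge0 // ltW.
  rewrite ltnS leq_eqVlt => /orP[/eqP -> {j}|ji]; last first.
    apply: le_trans (IH p j ji) _; apply: ler_wpM2r => //.
    rewrite /K' lerDl divr_ge0 // addr_ge0 // mulr_ge0 // mulr_ge0 // ltW //.
  have [hp _] := dn_pmul p ha.
  have e : p`_i * a k0 = pmul p a (k0 + i)%N - \sum_(j < i) p`_j * a (k0 + i - j)%N.
    rewrite /pmul.
    rewrite -(big_mkord xpredT (fun j => p`_j * a (k0 + i - j)%N)).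
    rewrite (@big_cat_nat _ _ _ i.+1) //=; last by rewrite ltnS leq_addl.
    rewrite [X in _ + X - _]big_nat_cond [X in _ + X - _]big1 ?addr0; last first.
      move=> j /andP[/andP[ij jk] _].
      have [->|nz] := eqVneq (a (k0 + i - j)%N) 0; first by rewrite mulr0.
      by have := kmin _ nz; lia.
    by rewrite big_mkord big_ord_recr /= addnK addrAC subrr add0r.
  have h1 : cabs p`_i * cabs (a k0) <= (1 + i%:R * (K * dn a)) * dn (pmul p a).
    rewrite -cabsM e; apply: le_trans (cabsB _ _) _.
    rewrite mulrDl mul1r; apply: lerD; first exact: cabs_le_dn.
    apply: le_trans (cabs_sum _ _ _) _.
    have -> : i%:R * (K * dn a) * dn (pmul p a) = \sum_(j < i) (K * dn a) * dn (pmul p a).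
      by rewrite sumr_const card_ord -mulrA mulr_natl.
    apply: ler_sum => j _; rewrite cabsM mulrAC; apply: ler_pM => //.
      exact: IH.
    exact: cabs_le_dn.
  apply: (@le_trans _ _ ((1 + i%:R * (K * dn a)) / cabs (a k0) * dn (pmul p a))).
    by rewrite mulrAC ler_pdivlMr.
  by apply: ler_wpM2r => //; rewrite /K' lerDr ltW.
have [K K0 hK] := key m.
exists (m.+1%:R * K); first by rewrite mulr_gt0 ?ltr0n.
move=> p pm; rewrite (l1E pm).
apply: (@le_trans _ _ (\sum_(k < m) K * dn (pmul p a))).
  by apply: ler_sum => k _; exact: hK.
rewrite sumr_const card_ord -mulrA [leRHS]mulr_natl mulrSr lerDl.
by rewrite mulr_ge0 // ltW.
Qed.

Lemma dsum_mono a n m : (n <= m)%N -> dsum a n <= dsum a m.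
Proof.
move=> nm; rewrite /dsum (big_ord_widen m (fun k => k.+1%:R * cabs (a k) ^+ 2)) //.
rewrite big_mkcond; apply: ler_sum => k _.
by case: ifP => // _; exact: dterm_ge0.
Qed.

Lemma dsum_approx a (e : R) : inD a -> 0 < e ->
  exists N, forall n, (N <= n)%N -> dn a ^+ 2 - e < dsum a n.
Proof.
move=> ha e0; apply: contrapT => /forallNP hn.
have : (dnorm2 a <= (dn a ^+ 2 - e)%:E)%E.
  apply/dnorm2_leP => n; have /existsNP [m /not_implyP [nm /negP h]] := hn n.
  by rewrite -leNgt in h; apply: le_trans h; exact: dsum_mono.
by rewrite inD_dnorm2E // lee_fin lerDl oppr_ge0 leNgt e0.
Qed.

Lemma parallelogram a b : inD a -> inD b ->
  dn (fun k => (a k - b k) / 2) ^+ 2 + dn (fun k => (a k + b k) / 2) ^+ 2 <=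
  (dn a ^+ 2 + dn b ^+ 2) / 2.
Proof.
move=> ha hb.
have half (c : nat -> C) : inD c -> inD (fun k => c k / 2).
  by move=> hc; have [h _] := dnZ 2^-1 hc; apply: eq_inD h => k; rewrite mulrC.
have hs := half _ (dnD ha hb).1; have hd := half _ (dnB ha hb).1.
apply/ler_addgt0Pr => e e0; have e2 : 0 < e / 2 by rewrite divr_gt0.
have [N1 h1] := dsum_approx hs e2; have [N2 h2] := dsum_approx hd e2.
pose n := maxn N1 N2.
have {}h1 := h1 n (leq_maxl _ _); have {}h2 := h2 n (leq_maxr _ _).
have h3 := dsum_le_dn n ha; have h4 := dsum_le_dn n hb.
have id : dsum (fun k => (a k - b k) / 2) n + dsum (fun k => (a k + b k) / 2) n =
   (dsum a n + dsum b n) / 2.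
  rewrite /dsum -!big_split /= mulr_suml; apply: eq_bigr => k _.
  rewrite -!mulrDr -mulrA; congr (_ * _).
  rewrite !cabsM cabs_inv_nat !exprMn !cabs_sqr !ReD !ImD !ReN !ImN.
  by field.
lra.
Qed.

(** Uniform convexity: the midpoint of [p] and [q] has error at least [mu], so the parallelogram law
    bounds their difference. *)
Lemma near_minimizers_close a m (K mu : R) p q : inD a ->
  (forall p, (size p <= m)%N -> l1 p <= K * dn (pmul p a)) -> 0 < K -> 0 <= mu ->
  (forall p, (size p <= m)%N -> mu <= err a p) ->
  (size p <= m)%N -> (size q <= m)%N ->
  l1 (p - q) ^+ 2 <= 4 * K ^+ 2 * ((err a p ^+ 2 + err a q ^+ 2) / 2 - mu ^+ 2).
Proof.
move=> ha hK K0 mu0 hmu pm qm.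
have pqm : (size (p - q)%R <= m)%N.
  by apply: leq_trans (size_polyD _ _) _; rewrite size_polyN geq_max pm.
have h := parallelogram (inD_qf p ha) (inD_qf q ha).
pose r := (2^-1)%:P * (p + q).
have rm : (size r <= m)%N.
  rewrite /r mul_polyC; apply: leq_trans (size_scale_leq _ _) _.
  by apply: leq_trans (size_polyD _ _) _; rewrite geq_max pm.
have er : dn (fun k => (qf_minus1 p a k + qf_minus1 q a k) / 2) = err a r.
  apply: eq_dn => k; rewrite /qf_minus1.
  have -> : pmul r a k = (pmul p a k + pmul q a k) / 2.
    rewrite -pmulDl /pmul mulr_suml; apply: eq_bigr => i _.
    by rewrite /r coefCM; ring.
  by field.
have ed : dn (pmul (p - q) a) <= 2 * dn (fun k => (qf_minus1 p a k - qf_minus1 q a k) / 2).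
  have hd : inD (fun k => (qf_minus1 p a k - qf_minus1 q a k) / 2).
    have [h0 _] := dnZ 2^-1 (dnB (inD_qf p ha) (inD_qf q ha)).1.
    by apply: eq_inD h0 => k; rewrite mulrC.
  have [_ h2] := dnZ 2 hd; rewrite cabs_nat in h2; apply: le_trans h2.
  rewrite le_eqVlt; apply/orP; left; apply/eqP; apply: eq_dn => k.
  by rewrite pmulBl /qf_minus1; field.
rewrite er in h; have hr := hmu r rm.
set D := dn (fun k => _) in h ed.
have D0 : 0 <= D by exact: dn_ge0.
have h1 : l1 (p - q) <= K * (2 * D).
  by apply: le_trans (hK _ pqm) _; rewrite ler_pM2l.
apply: (@le_trans _ _ ((K * (2 * D)) ^+ 2)).
  by rewrite ler_pXn2r ?nnegrE // mulr_ge0 ?(ltW K0) // mulr_ge0.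
have -> : (K * (2 * D)) ^+ 2 = 4 * K ^+ 2 * D ^+ 2 by ring.
apply: ler_wpM2l; first by rewrite mulr_ge0 // sqr_ge0.
have : mu ^+ 2 <= err a r ^+ 2 by rewrite ler_pXn2r ?nnegrE ?err_ge0.
rewrite /err in h *; lra.
Qed.

Lemma minimizer_exists a m : inD a -> ~ is_zero_fun a -> exists q, IsQm a m q.
Proof.
move=> ha a0; have [K K0 hK] := coef_le_dn_pmul ha a0 m.+1.
pose S := [set x : R | exists2 p : {poly C}, (size p <= m.+1)%N & x = err a p].
have S0 : has_inf S.
  split; first by exists (err a 0), 0; rewrite ?size_poly0.
  by exists 0 => x [p _ ->]; exact: err_ge0.
have minf (p : {poly C}) : (size p <= m.+1)%N -> inf S <= err a p.
  by move=> pm; apply: ge_inf; [exact: S0.2 | exists p].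
have hp n : exists p : {poly C}, (size p <= m.+1)%N /\ err a p < inf S + n.+1%:R^-1.
  have n0 : 0 < n.+1%:R^-1 :> R by rewrite invr_gt0.
  by have [x [p pm ->] h] := inf_adherent n0 S0; exists p.
have [p {}hp] := choice hp.
have i0 : 0 <= inf S by apply: lb_le_inf; [exact: S0.1 | move=> x [q _ ->]; exact: err_ge0].
have pb n : l1 (p n) <= K * (inf S + 2).
  apply: le_trans (hK _ (hp n).1) _; rewrite ler_pM2l //.
  apply: le_trans (dn_pmul_le_err _ ha) _.
  have h1 : n.+1%:R^-1 <= 1 :> R by rewrite invf_le1 ?ltr0n // ler1n.
  move: (hp n).2 h1; move: (n.+1%:R^-1) => u; lra.
have hL i : exists L : C, forall e, 0 < e -> ultra [set n | cabs ((p n)`_i - L) < e].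
  by apply: (@ulimC_exists _ _ (K * (inf S + 2))) => n; apply: le_trans (pb n); exact: cabs_coef_le_l1.
have [L {}hL] := choice hL.
pose q := \poly_(i < m.+1) L i.
have qm : (size q <= m.+1)%N by exact: size_poly.
exists q; split => // r rm; rewrite errQ_le //.
apply: le_trans (minf r rm); apply/ler_addgt0Pr => e e0.
have e2 : 0 < e / 2 by rewrite divr_gt0.
(* One factor [m + 1] counts coefficients, the other is the multiplier bound of [dn_pmul_l1]; adding
   1 to [dn a] avoids a zero divisor. *)
pose d := e / 2 / (m.+1%:R * m.+1%:R * (dn a + 1)).
have dd : 0 < m.+1%:R * m.+1%:R * (dn a + 1).
  by rewrite mulr_gt0 ?mulr_gt0 ?ltr0n // ltr_wpDl.
have d0 : 0 < d by rewrite divr_gt0.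
have [N hN] := inv_nat_small e2.
have [n Nn hn] : exists2 n, (N <= n)%N & forall i : 'I_m.+1, cabs ((p n)`_i - L i) < d.
  by apply: ultra_large; apply: filter_forall => i; exact: hL.
have qpm : (size (q - p n)%R <= m.+1)%N.
  by apply: leq_trans (size_polyD _ _) _; rewrite size_polyN geq_max qm (hp n).1.
apply: le_trans (err_lip q (p n) ha) _.
have h1 : dn (pmul (q - p n) a) <= e / 2.
  apply: le_trans (dn_pmul_l1 qpm ha).2 _.
  have h2 : l1 (q - p n) <= m.+1%:R * d.
    rewrite (l1E qpm) mulr_natl -[X in _ *+ X]card_ord -sumr_const.
    apply: ler_sum => i _; rewrite coefB coef_poly ltn_ord cabsBC ltW //.
  apply: (@le_trans _ _ (m.+1%:R * (m.+1%:R * d) * (dn a + 1))).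
    apply: ler_pM => //; first by rewrite mulr_ge0.
      by rewrite ler_pM2l ?ltr0n.
    by rewrite lerDl.
  by rewrite mulrA mulrAC /d mulrCA divff ?mulr1 // gt_eqF.
move: (hN n Nn) (hp n).2 h1; move: (n.+1%:R^-1) => u; lra.
Qed.

Lemma QmP a m : inD a -> ~ is_zero_fun a -> IsQm a m (Qm a m).
Proof. by move=> ha a0; apply: xgetPex; exact: minimizer_exists. Qed.

Lemma Qm_err_le a m p : inD a -> ~ is_zero_fun a -> (size p <= m.+1)%N ->
  err a (Qm a m) <= err a p.
Proof. by move=> ha a0 pm; rewrite -errQ_le //; apply: (QmP m ha a0).2. Qed.

(** The minimizer for [b] is almost minimal for [a], with an excess linear in the perturbation, and
    near-minimizers are close. Its use is to make the conditions that define universality open. *)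
Lemma Qm_stable a m (e : R) : inD a -> ~ is_zero_fun a -> 0 < e ->
  exists2 d, 0 < d & forall b, inD b -> dn (fun k => a k - b k) < d ->
    ~ is_zero_fun b /\ l1 (Qm b m - Qm a m) < e.
Proof.
move=> ha a0 e0; have [K K0 hK] := coef_le_dn_pmul ha a0 m.+1.
have /existsNP [k0 /eqP ak0] := a0; have c0 : 0 < cabs (a k0) by rewrite cabs_gt0.
set M := m.+1%:R : R; have M0 : 0 < M by rewrite ltr0n.
(* An excess [eta <= 1] over an error at most 1 raises the mean square by at most [3 / 2 * eta], so
   the squared distance is at most [6 K ^ 2 eta], below [e ^ 2]. *)
pose eta := Num.min 1 (e ^+ 2 / (16 * K ^+ 2)).
have eta0 : 0 < eta.
  by rewrite lt_min ltr01 /= divr_gt0 ?exprn_gt0 // mulr_gt0 // exprn_gt0.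
(* The first bound keeps [b k0] nonzero, the second absorbs [l1 q'] in the estimate for itself, the
   third limits the excess to [eta]. *)
pose d := Num.min (cabs (a k0)) (Num.min (2 * K * M)^-1 (eta / (8 * K * M))).
have d0 : 0 < d.
  by rewrite !lt_min c0 invr_gt0 divr_gt0 // !mulr_gt0.
exists d => // b hb hd.
have [d1 d2 d3] : [/\ d <= cabs (a k0), K * M * d <= 1 / 2 & 8 * K * M * d <= eta].
  split; first by rewrite ge_min lexx.
    have : d <= (2 * K * M)^-1 by rewrite !ge_min lexx orbT.
    rewrite -[leRHS]mul1r ler_pdivlMr ?mulr_gt0 //; lra.
  have : d <= eta / (8 * K * M) by rewrite !ge_min lexx !orbT.
  by rewrite ler_pdivlMr ?mulr_gt0 // mulrC.
have hab := dnB ha hb; have hba := dnB hb ha.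
have b0 : ~ is_zero_fun b.
  move=> bz; have := cabs_le_dn k0 hab.1; rewrite bz subr0.
  by rewrite leNgt (lt_le_trans hd).
split=> //.
set q := Qm a m; set q' := Qm b m.
have qm : (size q <= m.+1)%N := (QmP m ha a0).1.
have q'm : (size q' <= m.+1)%N := (QmP m hb b0).1.
have s0 : (size (0%R : {poly C}) <= m.+1)%N by rewrite size_poly0.
have eq1 : err a q <= 1 by apply: le_trans (Qm_err_le ha a0 s0) (err0 a).
have eq'1 : err b q' <= 1 by apply: le_trans (Qm_err_le hb b0 s0) (err0 b).
have h6 : err b q' <= err b q by exact: Qm_err_le.
have qmin p : (size p <= m.+1)%N -> err a q <= err a p by exact: Qm_err_le.
clearbody q q'.
have l1q : l1 q <= K * 2.
  by apply: le_trans (hK q qm) _; rewrite ler_pM2l // (le_trans (dn_pmul_le_err q ha)) // -[2]/(1+1) lerD.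
have small (r : {poly C}) (c c' : nat -> C) : (size r <= m.+1)%N ->
    inD (fun k => c k - c' k) -> dn (fun k => c k - c' k) < d ->
    dn (pmul r (fun k => c k - c' k)) <= M * l1 r * d.
  move=> rm hc hcd; apply: le_trans (dn_pmul_l1 rm hc).2 _.
  by apply: ler_wpM2l; [rewrite mulr_ge0 // ltW | exact: ltW].
have hd' : dn (fun k => b k - a k) < d by rewrite dnBC.
have l1q' : l1 q' <= 4 * K.
  have h1 : dn (pmul q' a) <= 2 + M * l1 q' * d.
    have [hq'b _] := dn_pmul q' hb; have [hq'ab _] := dn_pmul q' hab.1.
    have [_ h] := dnD hq'b hq'ab.
    have e1 : (fun k => pmul q' b k + pmul q' (fun k => a k - b k) k) =1 pmul q' a.
      by move=> k; rewrite pmulBr addrC subrK.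
    rewrite (eq_dn e1) in h; apply: le_trans h _; apply: lerD; last exact: (small q' a b q'm hab.1 hd).
    by apply: le_trans (dn_pmul_le_err q' hb) _; lra.
  have h2 : l1 q' <= K * (2 + M * l1 q' * d).
    by apply: le_trans (hK q' q'm) _; rewrite ler_pM2l.
  have : K * M * d * l1 q' <= 1 / 2 * l1 q' by apply: ler_wpM2r.
  lra.
have h4 : err a q' <= err a q + eta.
  have h5 : err a q' <= err b q' + M * l1 q' * d.
    by apply: le_trans (err_lipr q' ha hb) _; rewrite lerD2l; exact: (small q' a b q'm hab.1 hd).
  have h7 : err b q <= err a q + M * l1 q * d.
    by apply: le_trans (err_lipr q hb ha) _; rewrite lerD2l; exact: (small q b a qm hba.1 hd').
  have h8 : M * l1 q' * d <= 4 * K * M * d.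
    by rewrite ler_pM2r // mulrC ler_pM2r.
  have h9 : M * l1 q * d <= 4 * K * M * d.
    rewrite ler_pM2r // mulrC ler_pM2r //.
    by apply: le_trans l1q _; rewrite mulrC ler_pM2r // ler_nat.
  have h10 : 8 * K * M * d = 4 * K * M * d + 4 * K * M * d by ring.
  rewrite h10 in d3; lra.
have := near_minimizers_close ha hK K0 (err_ge0 a q) qmin q'm qm.
have e'0 := err_ge0 a q'; have eq0 := err_ge0 a q.
have eta1 : eta <= 1 by rewrite ge_min lexx.
have etae : eta * (16 * K ^+ 2) <= e ^+ 2.
  by rewrite -ler_pdivlMr ?mulr_gt0 ?exprn_gt0 // ge_min lexx orbT.
move=> h5; rewrite -(@ltr_pXn2r _ 2) ?nnegrE //; last exact: ltW.
apply: le_lt_trans h5 _.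
have h11 : (err a q' ^+ 2 + err a q ^+ 2) / 2 - err a q ^+ 2 <= 3 / 2 * eta.
  have : err a q' ^+ 2 <= (err a q + eta) ^+ 2.
    by rewrite ler_pXn2r ?nnegrE // addr_ge0 // ltW.
  nra.
apply: (@le_lt_trans _ _ (4 * K ^+ 2 * (3 / 2 * eta))).
  by rewrite ler_pM2l // mulr_gt0 // exprn_gt0.
apply: lt_le_trans etae; have : 0 < K ^+ 2 * eta by rewrite mulr_gt0 // exprn_gt0.
lra.
Qed.

End OptimalApproximants.

(** * Polynomials without zeros on the closed disc *)

Section FastInvertible.
Context {R : realType}.
Local Notation C := R[i].
Implicit Types (p q T u : {poly C}).

Lemma l1_sum (I : Type) (r : seq I) (F : I -> {poly C}) :
  l1 (\sum_(i <- r) F i) <= \sum_(i <- r) l1 (F i).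
Proof.
elim: r => [|i r IH]; first by rewrite !big_nil /l1 size_poly0 big_ord0.
by rewrite !big_cons; apply: le_trans (l1D _ _) _; rewrite lerD2l.
Qed.

Lemma l1Z (c : C) p : l1 (c *: p) <= cabs c * l1 p.
Proof.
rewrite (l1E (size_scale_leq c p)) /l1 mulr_sumr.
by apply: ler_sum => k _; rewrite coefZ cabsM.
Qed.

Lemma l1XnM i p : l1 ('X^i * p) <= l1 p.
Proof.
have sz : (size ('X^i * p)%R <= i + size p)%N.
  by rewrite mulrC; have [->|p0] := eqVneq p 0; rewrite ?mul0r ?size_poly0 // size_mulXn.
rewrite (l1E sz) big_split_ord /= big1 ?add0r; last first.
  by move=> k _; rewrite coefXnM ltn_ord cabs0.
by apply: ler_sum => k _; rewrite coefXnM ltnNge leq_addr /= addKn.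
Qed.

Lemma l1M p q : l1 (p * q) <= l1 p * l1 q.
Proof.
rewrite -{1}(coefK p) poly_def mulr_suml; apply: le_trans (l1_sum _ _) _.
rewrite /l1 mulr_suml; apply: ler_sum => i _; rewrite -scalerAl.
by apply: le_trans (l1Z _ _) _; apply: ler_wpM2l => //; exact: l1XnM.
Qed.

Lemma l1C (c : C) : l1 c%:P = cabs c.
Proof.
by rewrite (l1E (size_polyC_leq1 c)) big_ord1 coefC.
Qed.

Lemma l1_1 : l1 (1 : {poly C}) = 1.
Proof. by rewrite -polyC1 l1C cabs1. Qed.

Lemma l1X p n : l1 (p ^+ n) <= l1 p ^+ n.
Proof.
elim: n => [|n IH]; first by rewrite !expr0 l1_1.
by rewrite !exprS; apply: le_trans (l1M _ _) _; apply: ler_wpM2l.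
Qed.

(* Polynomials whose inverse is approximated at a geometric rate by polynomials of
   linearly growing degree; equivalently, those without zeros on the closed disc. *)
Definition fast p := exists c rho : R, exists d : nat,
  [/\ 0 <= c, 0 < rho < 1 & forall M, exists T,
    (size T <= d * M + 1)%N /\ l1 (T * p - 1) <= c * rho ^+ M].

Lemma fast_const (c : C) : c != 0 -> fast c%:P.
Proof.
move=> c0; exists 0, (1 / 2), 0%N; split=> [//||M]; first by lra.
exists (c^-1)%:P; split; first by rewrite mul0n size_polyC_leq1.
by rewrite -polyCM mulVf // subrr /l1 size_poly0 big_ord0 mul0r.
Qed.

(** Partial sums of the geometric series in [u] are the approximate inverses; the maximum with
    [1 / 2] keeps [rho] positive when [u] is 0. *)
Lemma fast_near_one u : l1 u < 1 -> fast (1 - u).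
Proof.
move=> u1; pose rho : R := Num.max (l1 u) (1 / 2).
have ur : l1 u <= rho by rewrite le_max lexx.
exists 1, rho, (size u); split=> [//||M].
  by rewrite lt_max gt_max u1; apply/andP; split; [apply/orP; right|]; lra.
exists (\sum_(k < M) u ^+ k); split.
  apply: leq_trans (size_sum _ _ _) _; apply/bigmax_leqP => k _.
  apply: leq_trans (size_poly_exp_leq _ _) _; rewrite addn1 ltnS.
  by apply: leq_mul; [exact: leq_pred | exact: ltnW].
have -> : (\sum_(k < M) u ^+ k) * (1 - u) - 1 = - u ^+ M.
  by rewrite mulrC -[1 - u]opprB mulNr -subrX1; ring.
rewrite l1N mul1r; apply: le_trans (l1X _ _) _.
by rewrite lerXn2r ?nnegrE // (le_trans _ ur).
Qed.

(** If the two approximate inverses leave [1 + a] and [1 + b], their product leaves an error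
    [a + b + a b]. *)
Lemma fastM p q : fast p -> fast q -> fast (p * q).
Proof.
move=> [c1 [r1 [d1 [c10 /andP[r10 r11] h1]]]] [c2 [r2 [d2 [c20 /andP[r20 r21] h2]]]].
pose r := Num.max r1 r2.
have r1r : r1 <= r by rewrite le_max lexx.
have r2r : r2 <= r by rewrite le_max lexx orbT.
have r0 : 0 < r := lt_le_trans r10 r1r.
have rl1 : r < 1 by rewrite gt_max r11.
exists (c1 + c2 + c1 * c2), r, (d1 + d2)%N; split=> [||M].
- by rewrite addr_ge0 ?addr_ge0 ?mulr_ge0.
- by rewrite r0.
have [T1 [s1 e1]] := h1 M; have [T2 [s2 e2]] := h2 M.
exists (T1 * T2); split.
  by apply: leq_trans (size_polyMleq _ _) _; lia.
have -> : T1 * T2 * (p * q) - 1 =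
   (T1 * p - 1) + (T2 * q - 1) + (T1 * p - 1) * (T2 * q - 1) by ring.
have pw (s : R) : 0 < s -> s <= r -> s ^+ M <= r ^+ M.
  by move=> s0 sr; rewrite lerXn2r ?nnegrE // ltW // (lt_le_trans s0).
have {}e1 : l1 (T1 * p - 1) <= c1 * r ^+ M.
  by apply: le_trans e1 _; apply: ler_wpM2l => //; exact: pw.
have {}e2 : l1 (T2 * q - 1) <= c2 * r ^+ M.
  by apply: le_trans e2 _; apply: ler_wpM2l => //; exact: pw.
apply: le_trans (l1D _ _) _; rewrite [leRHS]mulrDl [(c1 + c2) * _]mulrDl; apply: lerD.
  by apply: le_trans (l1D _ _) _; exact: lerD.
apply: le_trans (l1M _ _) _.
apply: (@le_trans _ _ ((c1 * r ^+ M) * (c2 * r ^+ M))); first exact: ler_pM.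
have -> : c1 * r ^+ M * (c2 * r ^+ M) = c1 * c2 * r ^+ M * r ^+ M by ring.
rewrite ler_piMr //; first by rewrite !mulr_ge0 // exprn_ge0 // ltW.
by rewrite exprn_ile1 // ltW.
Qed.

Lemma fastX p n : fast p -> fast (p ^+ n).
Proof.
move=> hp; elim: n => [|n IH]; last by rewrite exprS; exact: fastM.
by rewrite expr0 -polyC1; apply: fast_const; exact: oner_neq0.
Qed.

(** Each linear factor is a constant times [1 - X / z] with [|z| > 1], and [X / z] has [l1] norm
    below 1. *)
Lemma fast_of_roots p : p != 0 -> (forall z, cabs z <= 1 -> p.[z] != 0) -> fast p.
Proof.
move=> p0 hp; have [rs e] := closed_field_poly_normal p.
have hr z : z \in rs -> 1 < cabs z.
  move=> zr; rewrite ltNge; apply/negP => z1; have /negP := hp z z1; apply.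
  by rewrite -rootE e rootZ ?lead_coef_eq0 // root_prod_XsubC.
rewrite e -mul_polyC; apply: fastM; first by apply: fast_const; rewrite lead_coef_eq0.
elim: rs hr {e} => [|z rs IH] hr.
  by rewrite big_nil -polyC1; apply: fast_const; exact: oner_neq0.
rewrite big_cons; apply: fastM; last by apply: IH => w wr; apply: hr; rewrite inE wr orbT.
have z1 : 1 < cabs z by apply: hr; rewrite mem_head.
have z0 : z != 0 by rewrite -cabs_gt0 (lt_trans ltr01).
have -> : 'X - z%:P = (- z)%:P * (1 - z^-1 *: 'X).
  rewrite mulrBr mulr1 mul_polyC scalerA mulNr divff // scaleN1r opprK polyCN addrC //.
apply: fastM; first by apply: fast_const; rewrite oppr_eq0.
apply: fast_near_one; apply: le_lt_trans (l1Z _ _) _.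
have lX : l1 ('X : {poly C}) <= 1.
  by have := l1XnM 1 (1 : {poly C}); rewrite expr1 mulr1 l1_1.
apply: (@le_lt_trans _ _ (cabs z^-1 * 1)); first exact: ler_wpM2l.
by rewrite mulr1 cabsV invf_lt1 // (lt_trans ltr01).
Qed.

(** The exponential dominates its cubic Taylor term, [expR x >= x ^ 3 / 6], one power more than the
    polynomial factor. *)
Lemma geometric_poly_small (a b c rho e : R) : 0 <= a -> 0 <= b -> 0 <= c ->
  0 < rho < 1 -> 0 < e ->
  exists N, forall M, (N <= M)%N -> (a * M%:R + b) ^+ 2 * (c * rho ^+ M) < e.
Proof.
move=> a0 b0 c0 /andP[r0 r1] e0.
pose t := - ln rho; have t0 : 0 < t by rewrite oppr_gt0 ln_lt0 // r0.
have hrho M : (t * M%:R) ^+ 3 * rho ^+ M <= 6.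
  have -> : rho ^+ M = (expR (t * M%:R))^-1.
    by rewrite -expRN /t mulNr opprK expRM_natr lnK // posrE.
  rewrite ler_pdivrMr ?expR_gt0 // [leRHS]mulrC -ler_pdivrMr //.
  have h0 : 0 <= t * M%:R by rewrite mulr_ge0 // ltW.
  by have := expR_ge1Dxn 2 h0; rewrite (_ : 3`! = 6%N) //; apply: le_trans; rewrite lerDr.
pose A := (a + b) ^+ 2 * c * 6 / t ^+ 3.
have A0 : 0 <= A.
  by rewrite divr_ge0 ?exprn_ge0 ?(ltW t0) // mulr_ge0 // mulr_ge0 // sqr_ge0.
exists (Num.truncn (A / e)).+1 => M hM.
have M0 : 0 < M%:R :> R by rewrite ltr0n (leq_trans _ hM).
have M1 : 1 <= M%:R :> R by rewrite ler1n (leq_trans _ hM).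
have AM : A / M%:R < e.
  rewrite ltr_pdivrMr // mulrC -ltr_pdivrMr //.
  by apply: lt_le_trans (truncnS_gt _) _; rewrite ler_nat.
apply: le_lt_trans AM.
have h1 : a * M%:R + b <= (a + b) * M%:R by rewrite mulrDl lerD2l ler_peMr.
have h2 : (a * M%:R + b) ^+ 2 <= ((a + b) * M%:R) ^+ 2.
  by rewrite ler_pXn2r ?nnegrE // ?addr_ge0 ?mulr_ge0 ?addr_ge0.
apply: (@le_trans _ _ (((a + b) * M%:R) ^+ 2 * (c * rho ^+ M))).
  by apply: ler_wpM2r => //; rewrite mulr_ge0 // exprn_ge0 // ltW.
have -> : ((a + b) * M%:R) ^+ 2 * (c * rho ^+ M) =
   (a + b) ^+ 2 * c / t ^+ 3 / M%:R * ((t * M%:R) ^+ 3 * rho ^+ M).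
  by field; rewrite !gt_eqF.
have -> : A / M%:R = (a + b) ^+ 2 * c / t ^+ 3 / M%:R * 6 by rewrite /A; ring.
apply: ler_wpM2l; last exact: hrho.
by rewrite divr_ge0 // divr_ge0 ?exprn_ge0 ?(ltW t0) // mulr_ge0 // sqr_ge0.
Qed.

Lemma geometric_small (c rho e : R) : 0 <= c -> 0 < rho < 1 -> 0 < e ->
  exists M, c * rho ^+ M < e.
Proof.
move=> c0 hr e0; have [N h] := geometric_poly_small (lexx 0) ler01 c0 hr e0.
by exists N; have := h N (leqnn N); rewrite mul0r add0r expr1n mul1r.
Qed.

(** An approximate inverse [T] with [|T p - 1| <= 1 / 2] forces [|p| >= 1 / (2 |T|)]. *)
Lemma fast_lower p : fast p -> exists2 c, 0 < c & forall z, cabs z <= 1 -> c <= cabs p.[z].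
Proof.
move=> [c [rho [d [c0 hr h]]]].
have h12 : 0 < 1 / 2 :> R by lra.
have [M hM] := geometric_small c0 hr h12.
have [T [_ hT]] := h M; exists (2 * (l1 T + 1))^-1.
  by rewrite invr_gt0 mulr_gt0 // ltr_wpDl.
move=> z z1; have h1 : cabs (T.[z] * p.[z] - 1) <= 1 / 2.
  have -> : T.[z] * p.[z] - 1 = (T * p - 1).[z] by rewrite !hornerE.
  by apply: le_trans (cabs_horner_le_l1 _ z1) _; apply: le_trans hT _; exact: ltW.
have h2 : 1 / 2 <= cabs T.[z] * cabs p.[z].
  rewrite -cabsM; have := cabs_tri 1 (T.[z] * p.[z] : C).
  by rewrite cabs1 (cabsBC 1); lra.
have h3 : cabs T.[z] * cabs p.[z] <= (l1 T + 1) * cabs p.[z].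
  by apply: ler_wpM2r => //; apply: le_trans (cabs_horner_le_l1 _ z1) _; rewrite lerDl.
have l0 : 0 < l1 T + 1 by rewrite ltr_wpDl.
rewrite -[leLHS]mul1r ler_pdivrMr ?mulr_gt0 //; lra.
Qed.

End FastInvertible.

(** * Uniform convergence of the optimal approximants *)

Section FastApproximants.
Context {R : realType}.
Local Notation C := R[i].
Implicit Types (p q T : {poly C}).

Lemma sum_pc p (z : C) n : (size p <= n)%N -> \sum_(k < n) pc p k * z ^+ k = p.[z].
Proof. by move=> pn; rewrite (horner_coef_wide _ pn). Qed.

Lemma fast_inDnv p : fast p -> inDnv (pc p) /\ ~ is_zero_fun (pc p).
Proof.
move=> hp; have [c c0 hc] := fast_lower hp; split.
  split; first exact: inD_pc.
  right=> z z1 hz; have [N hN] := hz c c0.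
  have := hN (maxn N (size p)) (leq_maxl _ _).
  by rewrite sum_pc ?leq_maxr // subr0 ltNge hc // ltW.
move=> h; have p0 : p = 0 by apply/polyP => k; rewrite coef0; exact: h.
have z1 : cabs (0 : C) <= 1 by rewrite cabs0.
by have := hc 0 z1; rewrite p0 horner0 cabs0 leNgt c0.
Qed.

Lemma err_pc p q : err (pc p) q = dn (pc (q * p - 1)).
Proof. by apply: eq_dn; exact: qf_minus1_pc. Qed.

Lemma size_mul_sub1 q p n : (size q <= n)%N -> (size (q * p - 1)%R <= n + size p + 1)%N.
Proof.
move=> qn; apply: leq_trans (size_polyD _ _) _; rewrite size_polyN size_polyC oner_neq0.
rewrite geq_max; apply/andP; split; last by rewrite addn1.
by apply: leq_trans (size_polyMleq _ _) _; lia.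
Qed.

(** Minimality compares [Q] with the explicit approximate inverse [T] in the Dirichlet norm. Passing
    from [l1] to that norm and back costs the square of the degree, which the geometric rate
    beats. *)
Lemma fast_Qm p n0 (e : R) : fast p -> 0 < e ->
  exists2 m, (n0 <= m)%N & forall z, cabs z <= 1 ->
    cabs ((Qm (pc p) m).[z] * p.[z] - 1) < e.
Proof.
move=> hp e0; have [[hD _] hz] := fast_inDnv hp.
have [c [rho [d [c0 hr h]]]] := hp.
pose s := (size p + 2)%N.
have [N hN] := geometric_poly_small (ler0n R d.+1) (ler0n R s) c0 hr e0.
(* The factor [d + 1] in place of [d] makes [m >= M >= n0] even for [d = 0]. *)
pose M := maxn N n0; pose m := (d.+1 * M)%N.
have {}hN := hN M (leq_maxl _ _).
exists m; first by apply: (@leq_trans M); [exact: leq_maxr | rewrite /m mulSn leq_addr].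
have [T [sT eT]] := h M.
have Tm : (size T <= m.+1)%N by apply: leq_trans sT _; rewrite /m; lia.
have sQ := (QmP m hD hz).1; have eQ := Qm_err_le hD hz Tm.
move: sQ eQ; set Q := Qm _ _ => sQ eQ; clearbody Q => z z1.
have -> : Q.[z] * p.[z] - 1 = (Q * p - 1).[z] by rewrite !hornerE.
apply: le_lt_trans hN; apply: le_trans (cabs_horner_le_l1 _ z1) _.
have bs q : (size q <= m.+1)%N -> (size (q * p - 1))%:R <= d.+1%:R * M%:R + s%:R :> R.
  move=> qm; rewrite -natrM -natrD ler_nat; apply: leq_trans (size_mul_sub1 _ qm) _.
  by rewrite /s /m; lia.
apply: le_trans (l1_le_dn _) _; rewrite expr2 -mulrA; apply: ler_pM => //; first exact: bs.
rewrite -err_pc; apply: le_trans eQ _; rewrite err_pc; apply: le_trans (dn_le_l1 _) _.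
by apply: ler_pM => //; exact: bs.
Qed.

Lemma partial_sum_le (a : nat -> C) (B : R) (z : C) n :
  (forall k, cabs (a k) <= B) -> cabs z < 1 ->
  cabs (\sum_(k < n) a k * z ^+ k) <= B / (1 - cabs z).
Proof.
move=> aB z1; have B0 : 0 <= B by apply: le_trans (aB 0%N).
have d0 : 0 < 1 - cabs z by rewrite subr_gt0.
apply: (@le_trans _ _ (\sum_(k < n) B * cabs z ^+ k)).
  apply: le_trans (cabs_sum _ _ _) _; apply: ler_sum => k _.
  by rewrite cabsM cabsX; apply: ler_wpM2r => //; exact: exprn_ge0.
rewrite -mulr_sumr; apply: ler_wpM2l => //.
rewrite -[leRHS]mul1r ler_pdivlMr // mulrC -opprB mulNr -subrX1 opprB.
by rewrite lerBlDr lerDl exprn_ge0.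
Qed.

End FastApproximants.

(** * Density of the polynomials without zeros on the closed disc *)

Section DilationApproximation.
Context {R : realType}.
Local Notation C := R[i].

Lemma partial_sum_tail (a : nat -> C) (B r : R) (z : C) n m :
  (forall k, cabs (a k) <= B) -> cabs z <= r -> r < 1 -> (n <= m)%N ->
  cabs (\sum_(k < m) a k * z ^+ k - \sum_(k < n) a k * z ^+ k) <= r ^+ n * (B / (1 - r)).
Proof.
move=> aB zr r1 nm; have r0 : 0 <= r := le_trans (cabs_ge0 z) zr.
have B0 : 0 <= B by apply: le_trans (aB 0%N).
have z1 : cabs z < 1 := le_lt_trans zr r1.
rewrite -(subnKC nm) big_split_ord /= addrAC subrr add0r.
have -> : \sum_(k < m - n) a (n + k)%N * z ^+ (n + k) =
  z ^+ n * \sum_(k < m - n) a (n + k)%N * z ^+ k.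
  by rewrite mulr_sumr; apply: eq_bigr => k _; rewrite exprD; ring.
rewrite cabsM; apply: ler_pM => //.
  by rewrite cabsX lerXn2r ?nnegrE.
apply: le_trans (partial_sum_le (a := fun k => a (n + k)%N) _ (fun k => aB _) z1) _.
by apply: ler_wpM2l => //; rewrite lef_pV2 ?posrE ?subr_gt0 // lerD2l lerN2.
Qed.

Lemma partial_sum_lip (a : nat -> C) (B r : R) n :
  (forall k, cabs (a k) <= B) -> 0 <= r -> r < 1 ->
  exists2 L : R, 0 <= L & forall z w : C, cabs z <= r -> cabs w <= r ->
    cabs (\sum_(k < n) a k * z ^+ k - \sum_(k < n) a k * w ^+ k) <= L * cabs (z - w).
Proof.
move=> aB r0 r1; exists (\sum_(k < n) B * k%:R).
  by apply: sumr_ge0 => k _; rewrite mulr_ge0 // (le_trans _ (aB 0%N)).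
move=> z w zr wr; rewrite -sumrB mulr_suml; apply: le_trans (cabs_sum _ _ _) _.
apply: ler_sum => k _; rewrite -mulrBr cabsM -mulrA; apply: ler_pM => //.
rewrite subrXX cabsM mulrC; apply: ler_wpM2r => //.
apply: le_trans (cabs_sum _ _ _) _.
have -> : k%:R = \sum_(i < k) 1 :> R by rewrite sumr_const card_ord.
apply: ler_sum => i _; rewrite cabsM !cabsX mulr_ile1 ?exprn_ge0 ?exprn_ile1 //.
- exact: le_trans zr (ltW r1).
- exact: le_trans wr (ltW r1).
Qed.

(** The bound is for all late partial sums, since values of the function exist only as their limits.
    If it failed, the bad points would accumulate at some [L] in the smaller disc, where the series
    would converge to 0. *)
Lemma zero_free_lower (a : nat -> C) (r : R) : inD a -> zero_free a ->
  0 <= r -> r < 1 -> exists (c : R) (n0 : nat), 0 < c /\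
    forall n z, (n0 <= n)%N -> cabs z <= r -> c <= cabs (\sum_(k < n) a k * z ^+ k).
Proof.
move=> ha hz r0 r1; have aB k := cabs_le_dn k ha.
apply: contrapT => /forallNP hn.
have h m : exists nz : nat * C, [/\ (m <= nz.1)%N, cabs nz.2 <= r &
    cabs (\sum_(k < nz.1) a k * nz.2 ^+ k) < m.+1%:R^-1].
  have /forallNP /(_ m) := hn m.+1%:R^-1 => h1; apply: contrapT => h2; apply: h1.
  split; first by rewrite invr_gt0.
  move=> n z mn zr; rewrite leNgt; apply/negP => hlt.
  by apply: h2; exists (n, z).
have {h} [nz h] := choice h.
have [L hL] : exists L : C, forall e, 0 < e -> ultra [set m | cabs ((nz m).2 - L) < e].
  by apply: (@ulimC_exists _ _ r) => m; case: (h m).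
have Lr : cabs L <= r.
  apply/ler_addgt0Pr => e /hL /ultra_nonempty [m /= hm].
  have [_ h1 _] := h m; have := cabs_tri L (nz m).2; rewrite (cabsBC L); lra.
apply: (hz L (le_lt_trans Lr r1)) => e e0.
have e3 : 0 < e / 3 by rewrite divr_gt0.
have B0 : 0 <= dn a / (1 - r) by rewrite divr_ge0 // subr_ge0 ltW.
have [n1 hn1] : exists n1, forall n, (n1 <= n)%N -> r ^+ n * (dn a / (1 - r)) < e / 3.
  have r'1 : 0 < Num.max r (1 / 2) < 1.
    by rewrite lt_max gt_max r1; apply/andP; split; [apply/orP; right|]; lra.
  have [n1 hn1] := geometric_poly_small (lexx 0) ler01 B0 r'1 e3.
  exists n1 => n nn; have := hn1 n nn; rewrite mul0r add0r expr1n mul1r mulrC.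
  apply: le_lt_trans; apply: ler_wpM2r => //.
  by rewrite lerXn2r ?nnegrE // ?le_max ?lexx ?r0.
exists n1 => n n1n; rewrite subr0.
have [K K0 hK] := partial_sum_lip n aB r0 r1.
have eK : 0 < e / 3 / (K + 1) by rewrite divr_gt0 // ltr_wpDl.
have [N hN] := inv_nat_small e3.
have [m mN /= hm] := ultra_large (maxn N n) (hL _ eK).
have [mn zr hS] := h m.
have nN : (n <= (nz m).1)%N.
  by apply: leq_trans mn; apply: leq_trans mN; exact: leq_maxr.
have h1 := hN m (leq_trans (leq_maxl _ _) mN).
have h2 := partial_sum_tail aB zr r1 nN; have h3 := hn1 n n1n.
have h4 := hK L (nz m).2 Lr zr.
have h5 : K * cabs (L - (nz m).2) <= e / 3.
  rewrite cabsBC; apply: le_trans (_ : (K + 1) * (e / 3 / (K + 1)) <= _).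
    by apply: ler_pM => //; [rewrite lerDl | exact: ltW].
  by rewrite mulrC divfK // gt_eqF // ltr_wpDl.
set SL := \sum_(k < n) a k * L ^+ k in h4 *.
set Sn := \sum_(k < n) a k * (nz m).2 ^+ k in h2 h4.
set SN := \sum_(k < (nz m).1) a k * (nz m).2 ^+ k in hS h2.
have t1 : cabs SL <= cabs (SL - Sn) + cabs (Sn - SN) + cabs SN.
  apply: le_trans (_ : cabs (SL - SN) + cabs SN <= _).
    by rewrite -{1}(subrK SN SL) cabsD.
  by rewrite lerD2r cabs_triB.
rewrite cabsBC in h2.
have h6 := lt_trans hS h1.
lra.
Qed.

(** One [r] must serve all [n >= n1]: [zero_free_lower] then yields an index depending on [r], and
    [n] is chosen last. *)
Lemma dilation_norm (a : nat -> C) (e : R) : inD a -> 0 < e ->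
  exists (r : R) (n1 : nat), [/\ 0 < r, r < 1 & forall n, (n1 <= n)%N ->
    dn (fun k => a k - pc (\poly_(k < n) (a k * ((r ^+ k)%:C)%C)) k) < e].
Proof.
move=> ha e0; have e4 : 0 < e ^+ 2 / 4 by rewrite divr_gt0 // exprn_gt0.
have [n1 hn1] := dsum_approx ha e4.
pose A := dn a; have A0 : 0 <= A by exact: dn_ge0.
(* The first [n1] coefficients change by a relative amount at most [n1 h], in norm at most [e / 2];
   the tail carries at most [e ^ 2 / 4] by the choice of [n1]. *)
pose h : R := Num.min (1 / 2) (e / (2 * (n1.+1%:R * (A + 1)))).
have D0 : 0 < n1.+1%:R * (A + 1) :> R by rewrite mulr_gt0 ?ltr0n // ltr_wpDl.
have h0 : 0 < h.
  by rewrite lt_min; apply/andP; split; [lra | rewrite divr_gt0 // mulr_gt0].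
have h12 : h <= 1 / 2 by rewrite ge_min lexx.
have hA : n1%:R * h * A <= e / 2.
  have : h <= e / (2 * (n1.+1%:R * (A + 1))) by rewrite ge_min lexx orbT.
  rewrite ler_pdivlMr; last by rewrite mulr_gt0.
  move=> h1.
  apply: (@le_trans _ _ (h * (n1.+1%:R * (A + 1)))); last lra.
  have -> : n1%:R * h * A = h * (n1%:R * A) by ring.
  rewrite ler_pM2l //; apply: ler_pM => //; last by rewrite lerDl.
  by rewrite ler_nat.
exists (1 - h), n1; split; [lra|lra|] => n n1n.
set r := 1 - h; have r01 : 0 <= r <= 1 by rewrite /r; lra.
have /andP[r0 r1] := r01.
have rk k : 0 <= r ^+ k <= 1 by rewrite exprn_ge0 // exprn_ile1.
have rb k : 1 - r ^+ k <= k%:R * h.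
  elim: k => [|k IH]; first by rewrite expr0 subrr mul0r.
  rewrite exprS -natr1 [leRHS]mulrDl mul1r.
  move: (rk k) IH; set x := r ^+ k => /andP[x0 x1] IH; have hx : h * x <= h by rewrite ler_piMr // ltW.
  have -> : 1 - r * x = 1 - x + h * x by rewrite /r; ring.
  exact: lerD.
pose b k := a k - pc (\poly_(k < n) (a k * ((r ^+ k)%:C)%C)) k.
have bE k : cabs (b k) ^+ 2 <= cabs (a k) ^+ 2.
  rewrite ler_pXn2r ?nnegrE // /b /pc coef_poly; case: ifP => _; last by rewrite subr0.
  rewrite -[X in cabs (X - _)]mulr1 -mulrBr cabsM ler_piMr //.
  have -> : 1 - ((r ^+ k)%:C)%C = ((1 - r ^+ k)%:C)%C by rewrite rmorphB.
  by rewrite cabs_real ger0_norm; have := rk k; lra.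
have bE1 k : (k < n1)%N -> cabs (b k) ^+ 2 <= cabs (a k) ^+ 2 * (n1%:R * h) ^+ 2.
  move=> kn; rewrite -exprMn ler_pXn2r ?nnegrE ?mulr_ge0 ?(ltW h0) //.
  rewrite /b /pc coef_poly (leq_trans kn n1n).
  rewrite -[X in cabs (X - _)]mulr1 -mulrBr cabsM; apply: ler_wpM2l => //.
  have -> : 1 - ((r ^+ k)%:C)%C = ((1 - r ^+ k)%:C)%C by rewrite rmorphB.
  rewrite cabs_real ger0_norm; last by have := rk k; lra.
  by apply: le_trans (rb k) _; rewrite ler_pM2r // ler_nat ltnW.
have bound m : dsum b m <= (3 / 4 * e) ^+ 2.
  apply: le_trans (dsum_mono b (leq_maxl m n1)) _; set N := maxn m n1.
  have n1N : (n1 <= N)%N by exact: leq_maxr.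
  have split (c : nat -> C) : dsum c N = dsum c n1 +
      \sum_(n1 <= k < N) k.+1%:R * cabs (c k) ^+ 2.
    rewrite /dsum -!(big_mkord xpredT (fun k => k.+1%:R * cabs (c k) ^+ 2)).
    by rewrite (@big_cat_nat _ _ _ n1).
  have tail : \sum_(n1 <= k < N) k.+1%:R * cabs (b k) ^+ 2 <= e ^+ 2 / 4.
    apply: (@le_trans _ _ (\sum_(n1 <= k < N) k.+1%:R * cabs (a k) ^+ 2)).
      by apply: ler_sum => k _; rewrite ler_pM2l ?ltr0n //.
    have := split a; have := dsum_le_dn N ha; have := hn1 n1 (leqnn _); lra.
  have head : dsum b n1 <= (e / 2) ^+ 2.
    apply: (@le_trans _ _ (dsum a n1 * (n1%:R * h) ^+ 2)).
      rewrite /dsum mulr_suml; apply: ler_sum => k _; rewrite -mulrA ler_pM2l ?ltr0n //.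
      exact: bE1.
    apply: (@le_trans _ _ ((n1%:R * h * A) ^+ 2)).
      rewrite [leRHS]exprMn [leLHS]mulrC; apply: ler_wpM2l; first exact: sqr_ge0.
      exact: dsum_le_dn.
    have p1 : 0 <= n1%:R * h * A by rewrite mulr_ge0 // mulr_ge0 // ltW.
    by rewrite ler_pXn2r ?nnegrE //; apply: le_trans hA.
  rewrite split; nra.
have M0 : 0 <= 3 / 4 * e by rewrite mulr_ge0 // ltW.
have [_ hb] := dn_le M0 bound.
by apply: le_lt_trans hb _; lra.
Qed.

(** A dilation moves the zeros off the closed disc and a partial sum of it is a polynomial; the zero
    function is approached by small constants. *)
Lemma approx_fast (a : nat -> C) (e : R) : inDnv a -> 0 < e ->
  exists2 p, fast p & dn (fun k => a k - pc p k) < e.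
Proof.
move=> [ha hz] e0; case: hz => [a0|hz].
  pose p : {poly C} := (((e / 2)%:C)%C)%:P.
  exists p.
    by apply: fast_const; rewrite -cabs_gt0 cabs_real normr_gt0 gt_eqF // divr_gt0.
  have -> : dn (fun k => a k - pc p k) = dn (fun k => pc p k - a k) by exact: dnBC.
  rewrite (eq_dn (b := pc p)); last by move=> k; rewrite a0 subr0.
  apply: le_lt_trans (dn_le_l1 _) _; rewrite l1C cabs_real ger0_norm ?divr_ge0 ?(ltW e0) //.
  apply: (@le_lt_trans _ _ (1 * (e / 2))); last by rewrite mul1r; lra.
  by apply: ler_wpM2r; [rewrite divr_ge0 // ltW | rewrite (ler_nat R _ 1) size_polyC_leq1].
have [r [n1 [r0 r1 hr]]] := dilation_norm ha e0.
have [c [n0 [c0 hc]]] := zero_free_lower ha hz (ltW r0) r1.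
pose n := maxn n0 n1; exists (\poly_(k < n) (a k * ((r ^+ k)%:C)%C)); last first.
  by apply: hr; exact: leq_maxr.
have hP z : cabs z <= 1 -> c <= cabs (\poly_(k < n) (a k * ((r ^+ k)%:C)%C)).[z].
  move=> z1; rewrite horner_poly.
  have -> : \sum_(k < n) a k * ((r ^+ k)%:C)%C * z ^+ k =
     \sum_(k < n) a k * ((r%:C)%C * z) ^+ k.
    by apply: eq_bigr => k _; rewrite exprMn rmorphXn mulrA.
  apply: hc; first exact: leq_maxl.
  by rewrite cabsM cabs_real gtr0_norm // ler_piMr // ltW.
have nz z : cabs z <= 1 -> (\poly_(k < n) (a k * ((r ^+ k)%:C)%C)).[z] != 0.
  by move=> z1; rewrite -cabs_gt0; apply: lt_le_trans (hP z z1).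
apply: fast_of_roots => //; apply/eqP => p0.
have := nz 0; rewrite cabs0 => /(_ ler01).
by rewrite p0 horner0 eqxx.
Qed.

End DilationApproximation.

(** * The Douglas formula *)

Section DouglasFormula.
Context {R : realType}.
Local Notation C := R[i].
Implicit Types (P Q : {poly C}).

Lemma prim_root_exists n : (0 < n)%N -> exists w : C, n.-primitive_root w.
Proof.
move=> n0; pose p : {poly C} := 'X^n - 1; have [rs e] := closed_field_poly_normal p.
rewrite (monicP _) ?monicXnsubC // scale1r in e.
have ars : all n.-unity_root rs by apply/allP => z; rewrite -root_prod_XsubC -e.
have srs : (n < (size rs).+1)%N by rewrite -(size_prod_XsubC rs id) -e size_XnsubC.
have [|w] := hasP (cyclic.has_prim_root n0 ars _ srs); last by exists w.
by rewrite -separable.separable_prod_XsubC -e cyclotomic.separable_Xn_sub_1 // pnatr_eq0 -lt0n.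
Qed.

Variables (N : nat) (w : C).
Hypotheses (N0 : (0 < N)%N) (pw : N.-primitive_root w).

Lemma cabs_prim_root : cabs w = 1.
Proof.
have h : cabs w ^+ N = 1 by rewrite -cabsX (prim_expr_order pw) cabs1.
by apply/eqP; rewrite -(pexpr_eq1 N0 (cabs_ge0 w)) h.
Qed.

Lemma prim_root_mulJ : w * (w^*)%C = 1.
Proof. by rewrite mulcJ cabs_prim_root expr1n. Qed.

Lemma sum_unity (x : C) : x ^+ N = 1 -> \sum_(i < N) x ^+ i = (x == 1)%:R * N%:R.
Proof.
move=> xN; have [->|x1] := eqVneq x 1.
  by under eq_bigr do rewrite expr1n; rewrite sumr_const card_ord mul1r.
rewrite mul0r; apply/eqP; rewrite -(mulrI_eq0 _ (mulfI (_ : x - 1 != 0))) ?subr_eq0 //.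
by rewrite -subrX1 xN subrr.
Qed.

Lemma prim_root_orth (k l : 'I_N) : (w ^+ k * (w^*)%C ^+ l == 1) = (k == l).
Proof.
apply/eqP/eqP => [h|->]; last by rewrite -exprMn prim_root_mulJ expr1n.
apply/val_inj => /=; have : w ^+ k = w ^+ l.
  by rewrite -[LHS]mulr1 -(expr1n _ l) -prim_root_mulJ exprMn mulrCA h mulr1.
by move=> /eqP; rewrite (eq_prim_root_expr pw) !modn_small // => /eqP.
Qed.

Lemma parseval P : (size P <= N)%N ->
  \sum_(i < N) cabs P.[w ^+ i] ^+ 2 = N%:R * \sum_(k < N) cabs P`_k ^+ 2.
Proof.
move=> PN; apply: (@complexI R).
rewrite rmorphM rmorph_nat !rmorph_sum /= mulr_sumr.
have conjX (z : C) n : (z ^+ n)^*%C = (z^*)%C ^+ n by exact: rmorphXn.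
have e (i : 'I_N) : ((cabs P.[w ^+ i] ^+ 2)%:C)%C =
   \sum_(k < N) \sum_(l < N) P`_k * (P`_l)^*%C * (w ^+ k * (w^*)%C ^+ l) ^+ i.
  rewrite -mulcJ (horner_coef_wide _ PN) rmorph_sum /= mulr_suml.
  apply: eq_bigr => k _; rewrite mulr_sumr; apply: eq_bigr => l _.
  rewrite rmorphM /= !conjX exprMn -!exprM [(i * k)%N]mulnC [(i * l)%N]mulnC.
  by ring.
rewrite (eq_bigr _ (fun i _ => e i)) exchange_big /=; apply: eq_bigr => k _.
rewrite exchange_big /= (bigD1 k) //= -mulr_sumr sum_unity; last first.
  by rewrite exprMn -!exprM ![(_ * N)%N]mulnC !exprM -conjX (prim_expr_order pw) conjc1 !expr1n mulr1.
rewrite prim_root_orth eqxx mul1r mulcJ big1 ?addr0; first by rewrite mulrC.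
move=> l lk; rewrite -mulr_sumr sum_unity; last first.
  by rewrite exprMn -!exprM ![(_ * N)%N]mulnC !exprM -conjX (prim_expr_order pw) conjc1 !expr1n mulr1.
by rewrite prim_root_orth eq_sym (negbTE lk) mul0r mulr0.
Qed.

(** Douglas' integral of [|Q(z) - Q(u)| ^ 2 / |z - u| ^ 2] sampled at pairs of distinct roots of
    unity, [u] being [z] rotated by [w ^ j]. *)
Definition douglas_sum Q : R :=
  \sum_(1 <= j < N) (\sum_(i < N) cabs (Q.[w ^+ i] - Q.[w ^+ i * w ^+ j]) ^+ 2)
    / cabs (1 - w ^+ j) ^+ 2.

(** The quotient is the squared modulus at [w ^ j] of [1 + X + ... + X ^ (k - 1)]. Parseval gives
    [N k] for the sum over all [j], from which the term [k ^ 2] of [j = 0] is removed. *)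
Lemma geometric_double_sum (k : nat) : (k <= N)%N ->
  \sum_(1 <= j < N) cabs (1 - w ^+ j ^+ k) ^+ 2 / cabs (1 - w ^+ j) ^+ 2 =
  k%:R * (N%:R - k%:R).
Proof.
move=> kN; pose G : {poly C} := \poly_(t < k) 1.
have GN : (size G <= N)%N by apply: leq_trans kN; exact: size_poly.
have GE z : G.[z] = \sum_(t < k) z ^+ t.
  by rewrite horner_poly; apply: eq_bigr => t _; rewrite mul1r.
have := parseval GN.
have -> : \sum_(t < N) cabs G`_t ^+ 2 = k%:R.
  have -> : k%:R = \sum_(t < k) 1 :> R by rewrite sumr_const card_ord.
  rewrite (big_ord_widen N (fun=> 1)) //.
  rewrite [RHS]big_mkcond; apply: eq_bigr => t _; rewrite coef_poly.
  by case: ifP => _; rewrite ?cabs1 ?expr1n // cabs0 expr0n.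
rewrite -(big_mkord xpredT (fun i => cabs G.[w ^+ i] ^+ 2)) big_ltn //.
have -> : cabs G.[w ^+ 0] = k%:R.
  by rewrite expr0 GE; under eq_bigr do rewrite expr1n; rewrite sumr_const card_ord cabs_nat.
move=> h; have -> : k%:R * (N%:R - k%:R) = N%:R * k%:R - k%:R ^+ 2 :> R by ring.
rewrite -h addrAC subrr add0r; apply: eq_big_nat => j /andP[j0 jN].
have wj : 1 - w ^+ j != 0.
  rewrite subr_eq0 eq_sym; apply/negP => /eqP e.
  have Nj : (N %| j)%N by rewrite (prim_order_dvd pw) e.
  by have := dvdn_leq j0 Nj; rewrite leqNgt jN.
rewrite -expr_div_n -cabsV -cabsM; congr (cabs _ ^+ 2).
have := subrX1 (w ^+ j) k; rewrite -GE => e.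
rewrite -[1 - _ ^+ k]opprB e -[1 - w ^+ j]opprB invrN mulrN mulNr opprK mulrC mulrA mulVf ?mul1r //.
by rewrite -opprB oppr_eq0.
Qed.

(** For fixed [j], Parseval applied to [Q(z) - Q(z w ^ j)] decouples the coefficients;
    [geometric_double_sum] then gives the weights. *)
Lemma douglas_sumE Q : (size Q <= N)%N ->
  douglas_sum Q = N%:R * \sum_(k < N) k%:R * (N%:R - k%:R) * cabs Q`_k ^+ 2.
Proof.
move=> QN; rewrite /douglas_sum.
have e j : \sum_(i < N) cabs (Q.[w ^+ i] - Q.[w ^+ i * w ^+ j]) ^+ 2 =
   N%:R * \sum_(k < N) cabs Q`_k ^+ 2 * cabs (1 - w ^+ j ^+ k) ^+ 2.
  pose S := \poly_(k < N) (Q`_k * (1 - w ^+ j ^+ k)).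
  have := parseval (size_poly N (fun k => Q`_k * (1 - w ^+ j ^+ k))).
  rewrite -/S => h; transitivity (\sum_(i < N) cabs S.[w ^+ i] ^+ 2).
    apply: eq_bigr => i _; congr (cabs _ ^+ 2).
    rewrite horner_poly !(horner_coef_wide _ QN) -sumrB; apply: eq_bigr => k _.
    by rewrite exprMn; ring.
  rewrite h; congr (_ * _); apply: eq_bigr => k _.
  by rewrite coef_poly ltn_ord cabsM exprMn.
under eq_bigr do rewrite e -mulrA mulr_suml.
rewrite -mulr_sumr; congr (_ * _); rewrite exchange_big /=; apply: eq_bigr => k _.
under eq_bigr do rewrite -mulrA.
by rewrite -mulr_sumr geometric_double_sum 1?ltnW // mulrC.
Qed.

Lemma douglas_sum_lip P Q (L : R) : 0 <= L ->
  (forall z u : C, cabs z = 1 -> cabs u = 1 ->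
    cabs (Q.[z] - Q.[u]) <= L * cabs (P.[z] - P.[u])) ->
  douglas_sum Q <= L ^+ 2 * douglas_sum P.
Proof.
move=> L0 h; rewrite /douglas_sum mulr_sumr; apply: ler_sum => j _.
rewrite mulrA; apply: ler_wpM2r; first by rewrite invr_ge0 sqr_ge0.
rewrite mulr_sumr; apply: ler_sum => i _; rewrite -exprMn.
rewrite ler_pXn2r ?nnegrE ?mulr_ge0 //.
by apply: h; rewrite ?cabsM !cabsX !cabs_prim_root !expr1n ?mulr1.
Qed.

End DouglasFormula.

(** * Dirichlet integrals under Lipschitz maps *)

Section DirichletIntegral.
Context {R : realType}.
Local Notation C := R[i].
Implicit Types (P Q : {poly C}).

Definition dirint P : R := \sum_(k < size P) k%:R * cabs P`_k ^+ 2.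

Lemma dirintE P n : (size P <= n)%N -> dirint P = \sum_(k < n) k%:R * cabs P`_k ^+ 2.
Proof.
move=> pm; rewrite /dirint (big_ord_widen n (fun k => k%:R * cabs P`_k ^+ 2)) //.
rewrite big_mkcond /=; apply: eq_bigr => k _; case: ltnP => // h.
by rewrite nth_default // cabs0 expr0n mulr0.
Qed.

(* The Douglas integral is a sum of squared difference quotients, so it can only
   decrease under Lipschitz maps; the factor 2 comes from its discretization at roots
   of unity. *)
Lemma dirint_lip P Q (L : R) : 0 <= L ->
  (forall z u : C, cabs z = 1 -> cabs u = 1 ->
    cabs (Q.[z] - Q.[u]) <= L * cabs (P.[z] - P.[u])) ->
  dirint Q <= 2 * L ^+ 2 * dirint P.
Proof.
(* With [N = 2 n] and degrees below [n], the factor [N - k] stays between [n] and [2 n]. *)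
move=> L0 h; pose n := (maxn (size P) (size Q)).+1; pose N := (n + n)%N.
have N0 : (0 < N)%N by rewrite /N addnS.
have [w pw] := @prim_root_exists R N N0.
have PN : (size P <= n)%N by rewrite leqW // leq_maxl.
have QN : (size Q <= n)%N by rewrite leqW // leq_maxr.
have nN : (n <= N)%N by exact: leq_addr.
have := @douglas_sum_lip _ N w N0 pw P Q L L0 h.
rewrite !douglas_sumE //; try exact: leq_trans nN.
rewrite [L ^+ 2 * _]mulrCA ler_pM2l ?ltr0n // => h1.
rewrite !(@dirintE _ N); try exact: leq_trans nN.
have n0 : 0 < n%:R :> R by rewrite ltr0n.
rewrite -(ler_pM2l n0).
apply: (@le_trans _ _ (\sum_(k < N) k%:R * (N%:R - k%:R) * cabs Q`_k ^+ 2)).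
  rewrite mulr_sumr; apply: ler_sum => k _; rewrite mulrA.
  have [kn|kn] := ltnP k n; last first.
    by rewrite nth_default ?(leq_trans QN) // cabs0 expr0n !mulr0.
  apply: ler_wpM2r; first exact: sqr_ge0.
  rewrite mulrC; apply: ler_wpM2l => //.
  by rewrite lerBrDr -natrD ler_nat /N leq_add2l ltnW.
apply: le_trans h1 _.
have -> : n%:R * (2 * L ^+ 2 * \sum_(k < N) k%:R * cabs P`_k ^+ 2) =
   L ^+ 2 * \sum_(k < N) N%:R * (k%:R * cabs P`_k ^+ 2).
  by rewrite -mulr_sumr /N natrD; ring.
apply: ler_wpM2l; first exact: sqr_ge0.
apply: ler_sum => k _; rewrite -mulrA [N%:R * _]mulrCA; apply: ler_wpM2l => //.
by apply: ler_wpM2r; [exact: sqr_ge0 | rewrite gerDl oppr_le0].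
Qed.

Lemma dn_le_dirint P : P`_0 = 0 -> dn (pc P) ^+ 2 <= 2 * dirint P.
Proof.
move=> P0; rewrite -lee_fin -inD_dnorm2E; last exact: inD_pc.
apply/dnorm2_leP => n; apply: le_trans (dsum_pc P n) _.
rewrite /dirint mulr_sumr; apply: ler_sum => -[[|k] hk] _ /=.
  by rewrite P0 cabs0 expr0n !mulr0.
rewrite mulrA; apply: ler_wpM2r; first exact: sqr_ge0.
by rewrite -natrM ler_nat; lia.
Qed.

End DirichletIntegral.

(** * Peak polynomials *)

Section NearMinimizer.
Context {R : realType}.
Local Notation C := R[i].
Implicit Types (s : seq C).

Definition mutual (n : nat) s1 s2 : R :=
  \sum_(z <- s1) \sum_(w <- s2) complex.Re (kern n (z * (w^*)%C)).

Lemma kernJ n (z : C) : kern n (z^*)%C = ((kern n z)^*)%C.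
Proof.
rewrite /kern rmorph_sum; apply: eq_bigr => k _.
by rewrite rmorphM rmorphXn fmorphV rmorph_nat.
Qed.

Lemma mutualC n s1 s2 : mutual n s1 s2 = mutual n s2 s1.
Proof.
rewrite /mutual exchange_big /=; apply: eq_bigr => w _; apply: eq_bigr => z _.
have -> : w * (z^*)%C = ((z * (w^*)%C)^*)%C by rewrite rmorphM /= conjcK mulrC.
by rewrite kernJ; case: (kern _ _).
Qed.

Lemma mutual_catl n s1 s2 s3 : mutual n (s1 ++ s2) s3 = mutual n s1 s3 + mutual n s2 s3.
Proof. by rewrite /mutual big_cat. Qed.

Lemma mutual_catr n s1 s2 s3 : mutual n s1 (s2 ++ s3) = mutual n s1 s2 + mutual n s1 s3.
Proof. by rewrite mutualC mutual_catl !(mutualC n s1). Qed.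

(** Repetition plays the part of mass: lists with multiplicities stand for measures with integer
    weights. *)
Lemma mutual_repeatl n a s1 s2 : mutual n (flatten (nseq a s1)) s2 = a%:R * mutual n s1 s2.
Proof.
elim: a => [|a IH]; first by rewrite /mutual /= big_nil mul0r.
by rewrite /= mutual_catl IH -natr1 mulrDl mul1r addrC.
Qed.

Lemma mutual_repeatr n a s1 s2 : mutual n s1 (flatten (nseq a s2)) = a%:R * mutual n s1 s2.
Proof. by rewrite mutualC mutual_repeatl mutualC. Qed.

Lemma size_repeat a s : size (flatten (nseq a s)) = (a * size s)%N.
Proof. by elim: a => [|a IH] //=; rewrite size_cat IH mulSn. Qed.

Variable E : set C.
Hypotheses (ET : in_circle E) (Ecl : closed_in_C E) (Ecap : log_capacity_zero E).

(* Mixing a small mass at [z] into a near-minimizer of the energy cannot lower it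
   much, which bounds the potential from below at every point of [E]. *)
Lemma near_minimizer (B : R) : 0 < B -> (exists z, E z) ->
  exists n s, [/\ s != [::], forall w, w \in s -> E w,
    B * (size s)%:R ^+ 2 <= energy n s &
    forall z, E z -> energy n s - (size s)%:R ^+ 2 <=
      (size s)%:R * \sum_(w <- s) complex.Re (kern n (z * (w^*)%C))].
Proof.
move=> B0 [z0 Ez0]; have [n hn] := energy_unbounded B ET Ecl Ecap.
pose avg s := energy n s / (size s)%:R ^+ 2.
pose S := [set x : R | exists s, [/\ s != [::], forall w, w \in s -> E w & x = avg s]].
have sz s : s != [::] -> 0 < (size s)%:R :> R by rewrite ltr0n lt0n size_eq0.
have S0 : has_inf S.
  split.
    exists (avg [:: z0]), [:: z0]; split => // w; by rewrite inE => /eqP ->.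
  exists B => x [s [s0 sE ->]]; rewrite /avg ler_pdivlMr ?exprn_gt0 ?sz //.
  exact: hn.
have Savg s : s != [::] -> (forall w, w \in s -> E w) -> inf S <= avg s.
  by move=> s0 sE; apply: ge_inf; [exact: S0.2 | exists s].
pose D := harmonic n : R; have D0 : 0 <= D := harmonic_ge0 n.
(* The point [z] will receive the fraction [1 / (a + 1)] of the mass; [2 a] outweighs the
   self-energy [D] of a point together with the slack 1 left by [eta]. *)
have [a a0 aD] : exists2 a : nat, 0 < a%:R :> R & 1 + D <= 2 * a%:R.
  exists (Num.truncn ((1 + D) / 2)).+1; first by rewrite ltr0n.
  by rewrite -ler_pdivrMl // mulrC ltW // truncnS_gt.
(* After multiplication by [(a + 1) ^ 2] this slack amounts to exactly one [m ^ 2]. *)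
pose eta : R := (a.+1%:R ^+ 2)^-1.
have eta0 : 0 < eta by rewrite invr_gt0 exprn_gt0 // ltr0n.
have [x [s [s0 sE ->]] hs] := inf_adherent eta0 S0.
exists n, s; split=> //; first exact: hn.
move=> z Ez; set m := (size s)%:R; set U := \sum_(w <- s) _.
have m0 : 0 < m := sz s s0.
pose s' := flatten (nseq a s) ++ flatten (nseq (size s) [:: z]).
have s'0 : s' != [::].
  by rewrite -size_eq0 size_cat !size_repeat muln1 addn_eq0 size_eq0 (negbTE s0) andbF.
have s'E w : w \in s' -> E w.
  rewrite mem_cat => /orP[|] /flattenP [l]; rewrite mem_nseq => /andP[_ /eqP ->].
    exact: sE.
  by rewrite inE => /eqP ->.
have := Savg s' s'0 s'E; rewrite /avg ler_pdivlMr ?exprn_gt0 ?sz //.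
have -> : (size s')%:R = (a%:R + 1) * m :> R.
  by rewrite size_cat !size_repeat muln1 natrD natrM mulrDl mul1r.
have -> : energy n s' = a%:R ^+ 2 * energy n s + 2 * a%:R * m * U + m ^+ 2 * D.
  have e1 : mutual n [:: z] s = U by rewrite /mutual big_seq1.
  have e2 : mutual n [:: z] [:: z] = D.
    by rewrite /mutual !big_seq1 mulcJ (ET Ez) expr1n kern_harmonic.
  rewrite -[LHS]/(mutual n s' s') -[energy n s]/(mutual n s s) /s'.
  rewrite !mutual_catl !mutual_catr !mutual_repeatl !mutual_repeatr.
  by rewrite [mutual n s [:: z]]mutualC e1 e2 /m; ring.
move: hs; rewrite /avg -/m ltr_pdivrMr ?exprn_gt0 //.
set En := energy n s; move=> h1 h2.
have En0 : 0 <= En.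
  apply: le_trans (hn s s0 sE); by rewrite mulr_ge0 ?exprn_ge0 // ltW.
have etaE : (a%:R + 1) ^+ 2 * eta = 1 by rewrite natr1 /eta divff // expf_neq0 // pnatr_eq0.
have h3 : (a%:R + 1) ^+ 2 * En - m ^+ 2 <= inf S * ((a%:R + 1) * m) ^+ 2.
  have h4 : (a%:R + 1) ^+ 2 * En <= (a%:R + 1) ^+ 2 * ((inf S + eta) * m ^+ 2).
    by rewrite ler_pM2l ?exprn_gt0 ?addr_gt0 // ltW.
  have e : (a%:R + 1) ^+ 2 * ((inf S + eta) * m ^+ 2) =
     inf S * ((a%:R + 1) * m) ^+ 2 + (a%:R + 1) ^+ 2 * eta * m ^+ 2 by ring.
  by rewrite e etaE mul1r in h4; rewrite lerBlDr.
have h5 := le_trans h3 h2.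
have h6 : 2 * a%:R * (En - m ^+ 2) <= 2 * a%:R * (m * U).
  have h7 : (1 + D) * m ^+ 2 <= 2 * a%:R * m ^+ 2 by rewrite ler_pM2r ?exprn_gt0.
  have e : (a%:R + 1) ^+ 2 * En = a%:R ^+ 2 * En + 2 * a%:R * En + En by ring.
  rewrite e in h5; rewrite mulrBr mulrA; lra.
by rewrite ler_pM2l ?mulr_gt0 // in h6.
Qed.

End NearMinimizer.

(** * Potentials and the construction of peaks *)

Section PeakPolynomial.
Context {R : realType}.
Local Notation C := R[i].

(** The coefficient of index 0 is divided by 0, that is 0, so the constant term vanishes. *)
Definition kern_poly (n : nat) (w : C) : {poly C} :=
  \poly_(k < n.+1) ((w^*)%C ^+ k / k%:R).

Lemma horner_kern_poly n w z : (kern_poly n w).[z] = kern n (z * (w^*)%C).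
Proof.
rewrite horner_poly big_ord_recl invr0 mulr0 mul0r add0r; apply: eq_bigr => k _.
by rewrite exprMn /=; ring.
Qed.

Definition potential n (s : seq C) : {poly C} := \sum_(w <- s) kern_poly n w.

Lemma horner_potential n s z :
  (potential n s).[z] = \sum_(w <- s) kern n (z * (w^*)%C).
Proof.
by rewrite horner_sum; apply: eq_bigr => w _; exact: horner_kern_poly.
Qed.

Lemma coef_potential n s k : (potential n s)`_k =
  if (k < n.+1)%N then (\sum_(w <- s) (w^*)%C ^+ k) / k%:R else 0.
Proof.
rewrite coef_sum; under eq_bigr do rewrite coef_poly.
by case: ifP => _; [rewrite mulr_suml | rewrite big1].
Qed.

Lemma size_potential n s : (size (potential n s) <= n.+1)%N.
Proof. by apply/leq_sizeP => j hj; rewrite coef_potential ltnNge hj. Qed.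

(** The [k]-th coefficient is a conjugate power sum over [k], so [k] times its squared modulus is
    the [k]-th term of the energy. This identity ties capacity to the Dirichlet norm. *)
Lemma dirint_potential n s : dirint (potential n s) = energy n s.
Proof.
rewrite (dirintE (size_potential n s)) big_ord_recl mul0r add0r /energy.
have e z w : complex.Re (kern n (z * (w^*)%C)) =
    \sum_(k < n) complex.Re (z ^+ k.+1 * (w^*)%C ^+ k.+1) / k.+1%:R.
  by rewrite /kern Re_sum; apply: eq_bigr => k _; rewrite Re_divn exprMn.
under [RHS]eq_bigr do (under eq_bigr do rewrite e).
under [RHS]eq_bigr do rewrite exchange_big /=.
rewrite exchange_big /=; apply: eq_bigr => k _.
under [RHS]eq_bigr do rewrite -mulr_suml -Re_sum -mulr_sumr.
rewrite -mulr_suml -Re_sum -mulr_suml.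
rewrite coef_potential ltnS ltn_ord /=.
set M := \sum_(w <- s) (w^*)%C ^+ _.
have -> : \sum_(z <- s) z ^+ k.+1 = (M^*)%C.
  by rewrite rmorph_sum /=; apply: eq_bigr => z _; rewrite rmorphXn /= conjcK.
rewrite [(M^*)%C * M]mulrC mulcJ /bump add1n cabsM cabs_inv_nat /=.
set c := cabs M; have k0 : k.+1%:R != 0 :> R by rewrite pnatr_eq0.
by rewrite exprMn mulrCA; congr (_ * _); rewrite expr2 mulrA divff // mul1r.
Qed.

Lemma dirintZ (c : C) p : dirint (c *: p) = cabs c ^+ 2 * dirint p.
Proof.
rewrite (dirintE (size_scale_leq c p)) /dirint mulr_sumr; apply: eq_bigr => k _.
by rewrite coefZ cabsM exprMn mulrCA.
Qed.

Lemma exprn_le_of_le (x e : R) k n : 0 <= x -> 1 <= e -> x ^+ n <= e -> (k <= n)%N ->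
  x ^+ k <= e.
Proof.
move=> x0 e1 xn kn; have [x1|/ltW x1] := leP x 1.
  by apply: le_trans e1; exact: exprn_ile1.
by apply: le_trans xn; rewrite ler_weXn2l.
Qed.

(** Meant for [x] and [y] of the form [1 + O(1 / n)]: the factor [n] cancels against their
    difference, and the power is Lipschitz uniformly in [n], as the exponential is. *)
Lemma cabs_subrXX_le (x y : C) (e : R) n : 1 <= e ->
  cabs x ^+ n <= e -> cabs y ^+ n <= e ->
  cabs (x ^+ n - y ^+ n) <= n%:R * e ^+ 2 * cabs (x - y).
Proof.
move=> e1 xe ye; rewrite subrXX cabsM mulrC; apply: ler_wpM2r => //.
apply: le_trans (cabs_sum _ _ _) _.
have -> : n%:R * e ^+ 2 = \sum_(k < n) e ^+ 2 by rewrite sumr_const card_ord mulr_natl.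
apply: ler_sum => k _; rewrite cabsM !cabsX expr2.
apply: ler_pM; rewrite ?exprn_ge0 //; [apply: (exprn_le_of_le _ _ xe) | apply: (exprn_le_of_le _ _ ye)] => //;
  by have := ltn_ord k; lia.
Qed.

Lemma cabs_one_sub_sqr (x : C) (t : R) :
  cabs (1 - (t%:C)%C * x) ^+ 2 = 1 - 2 * t * complex.Re x + t ^+ 2 * cabs x ^+ 2.
Proof. by rewrite !cabs_sqr; case: x => a b /=; ring. Qed.

Lemma exprn_le_expR (x y : R) n : 0 <= 1 + x -> n%:R * x <= y -> (1 + x) ^+ n <= expR y.
Proof.
move=> x0 h; apply: le_trans (_ : expR x ^+ n <= _).
  by rewrite lerXn2r ?nnegrE ?expR_ge0 // expR_ge1Dx.
by rewrite -expRM_natl ler_expR.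
Qed.

Variable E : set C.
Hypotheses (ET : in_circle E) (Ecl : closed_in_C E) (Ecap : log_capacity_zero E).

(** [psi] imitates [1 - exp (- lam F)] for a multiple [F] of the potential of a near-minimizer. The
    real part of [F] is at least [1 / 2] on [E] and hardly negative on the disc, while [F] is small
    far from [E] and in Dirichlet integral; the outer map is Lipschitz where real parts are bounded
    below. *)
Lemma peak_polynomial (eps d : R) : 0 < eps <= 1 -> 0 < d -> (exists z, E z) ->
  exists psi : {poly C}, [/\ psi`_0 = 0,
    forall z, cabs z <= 1 -> cabs psi.[z] <= 1 + expR 1,
    forall z, E z -> cabs (psi.[z] - 1) <= eps,
    forall z, cabs z <= 1 -> (forall w, E w -> d <= cabs (z - w)) -> cabs psi.[z] <= eps &
    dn (pc psi) <= eps].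
Proof.
move=> /andP[e0 e1] d0 Ene.
(* Chosen so that [exp ((1 - lam) / 2) = eps]; the 1 pays for the second-order terms of the
   power. *)
pose lam : R := 1 - 2 * ln eps.
have lam1 : 1 <= lam by rewrite /lam lerDl oppr_ge0 mulr_ge0_le0 // ln_le0.
have lam0 : 0 < lam := lt_le_trans ltr01 lam1.
pose e : R := expR 1.
have ee1 : 1 <= e by rewrite /e -[leLHS]expR0 ler_expR.
have ee0 : 0 < e := expR_gt0 1.
(* One term for each demand: [Re F >= 1 / 2] on [E], boundedness of the power on the disc, smallness
   far from [E], smallness in norm. *)
pose B : R := 2 + 6 * lam + lam * e ^+ 2 * 2 / (d * eps) + 4 * lam ^+ 2 * e ^+ 4 / eps ^+ 2.
have p1 : 0 <= lam * e ^+ 2 * 2 / (d * eps).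
  by rewrite divr_ge0 ?mulr_ge0 ?exprn_ge0 // ltW.
have p2 : 0 <= 4 * lam ^+ 2 * e ^+ 4 / eps ^+ 2.
  by rewrite divr_ge0 ?mulr_ge0 ?exprn_ge0 // ltW.
have [B2 B6 Bd Be] : [/\ 2 <= B, 6 * lam <= B, lam * e ^+ 2 * 2 / (d * eps) <= B &
    4 * lam ^+ 2 * e ^+ 4 / eps ^+ 2 <= B].
  by rewrite /B; split; lra.
have B0 : 0 < B by lra.
have [n [s [s0 sE hI hU]]] := near_minimizer ET Ecl Ecap B0 Ene.
set m := (size s)%:R : R in hI hU; have m0 : 0 < m by rewrite ltr0n lt0n size_eq0.
set En := energy n s in hI hU.
have En0 : 0 < En by apply: lt_le_trans hI; rewrite mulr_gt0 // exprn_gt0.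
(* On [E] the potential is at least about [En / m], so [c] normalizes this bound to 1, up to
   [c m <= 1 / B]. *)
pose c : R := m / En; have c0 : 0 < c by rewrite divr_gt0.
have cmB : c * m * B <= 1.
  have -> : c * m * B = B * m ^+ 2 / En by rewrite /c; ring.
  by rewrite ler_pdivrMr // mul1r.
pose F : {poly C} := (c%:C)%C *: potential n s.
have FE z : F.[z] = (c%:C)%C * \sum_(w <- s) kern n (z * (w^*)%C).
  by rewrite hornerZ horner_potential.
have ReF z : complex.Re F.[z] = c * \sum_(w <- s) complex.Re (kern n (z * (w^*)%C)).
  by rewrite FE ReZ Re_sum.
have zw z w : cabs z <= 1 -> w \in s -> cabs (z * (w^*)%C) <= 1.
  by move=> z1 ws; rewrite cabsM cabsJ (ET (sE w ws)) mulr1.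
have sums (x : R) : \sum_(w <- s) x = m * x.
  by rewrite big_const_seq count_predT iter_addr_0 mulr_natl.
have ReF_E z : E z -> 1 / 2 <= complex.Re F.[z].
  move=> Ez; rewrite ReF; have := hU z Ez; set U := \sum_(w <- s) _ => h.
  have h1 : c * (En - m ^+ 2) <= c * (m * U) by rewrite ler_pM2l.
  have e' : c * En = m by rewrite /c divfK // gt_eqF.
  have h2 : m - c * m * m <= m * (c * U).
    by rewrite mulrCA; apply: le_trans h1; rewrite mulrBr e' expr2 mulrA.
  have h3 : 1 - c * m <= c * U by rewrite -(ler_pM2l m0) mulrBr mulr1 [m * (c * m)]mulrC.
  have : c * m * 2 <= c * m * B by rewrite ler_pM2l // mulr_gt0.
  lra.
have ReF_disc z : cabs z <= 1 -> - 3 / B <= complex.Re F.[z].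
  move=> z1; rewrite ReF.
  have h : m * - 3 <= \sum_(w <- s) complex.Re (kern n (z * (w^*)%C)).
    rewrite -sums big_seq [leRHS]big_seq; apply: ler_sum => w ws.
    by apply: Re_kern_ge; exact: zw.
  apply: (@le_trans _ _ (c * (m * - 3))); last by rewrite ler_pM2l.
  rewrite ler_pdivrMr //.
  have -> : c * (m * -3) * B = (c * m * B) * -3 by ring.
  lra.
have F_bound z (b : R) : (forall w, w \in s -> cabs (kern n (z * (w^*)%C)) <= b) ->
    cabs F.[z] <= c * (m * b).
  move=> h; rewrite FE cabsM cabs_real gtr0_norm // ler_pM2l //.
  apply: le_trans (cabs_sum _ _ _) _; rewrite -sums big_seq [leRHS]big_seq.
  by apply: ler_sum => w; exact: h.
pose r := c * (m * harmonic n).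
have F_disc z : cabs z <= 1 -> cabs F.[z] <= r.
  by move=> z1; apply: F_bound => w ws; apply: cabs_kern_le_harmonic; exact: zw.
have F_far z : cabs z <= 1 -> (forall w, E w -> d <= cabs (z - w)) ->
    cabs F.[z] <= 2 / (d * B).
  move=> z1 hz; apply: le_trans (F_bound z (2 / d) _) _.
    move=> w ws; have dw := hz w (sE w ws); rewrite -(cabs_one_subJ _ (ET (sE w ws))) in dw.
    have nz : z * (w^*)%C != 1.
      by apply/eqP => ez; move: dw; rewrite ez subrr cabs0 leNgt d0.
    apply: le_trans (cabs_kern_le_inv _ (zw z w z1 ws) nz) _.
    by rewrite ler_pM2l // lef_pV2 ?posrE // (lt_le_trans d0).
  have -> : c * (m * (2 / d)) = (c * m * B) * (2 / (d * B)).
    by field; rewrite !gt_eqF.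
  by rewrite ler_piMl // divr_ge0 // mulr_ge0 // ltW.
have F0 : F.[0] = 0.
  rewrite FE big1 ?mulr0 // => w _; rewrite mul0r /kern big1 // => k _.
  by rewrite expr0n mul0r.
(* [N] is so large that the quadratic terms of the [N] factors sum to at most 1. *)
have [N N0 NR] : exists2 N : nat, 0 < N%:R :> R & lam ^+ 2 * r ^+ 2 <= N%:R.
  exists (Num.truncn (lam ^+ 2 * r ^+ 2)).+1; first by rewrite ltr0n.
  by rewrite ltW // truncnS_gt.
pose t : R := lam / N%:R; have t0 : 0 < t by rewrite divr_gt0.
have Nt : N%:R * t = lam by rewrite /t mulrC divfK // gt_eqF.
have Ntt : N%:R * (t ^+ 2 * r ^+ 2) <= 1.
  have -> : N%:R * (t ^+ 2 * r ^+ 2) = lam ^+ 2 * r ^+ 2 / N%:R.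
    by rewrite /t; field; rewrite gt_eqF.
  by rewrite ler_pdivrMr // mul1r.
pose X z : C := 1 - (t%:C)%C * F.[z].
(* Squared moduli are used because [|1 - t F| ^ 2 = 1 - 2 t Re F + t ^ 2 |F| ^ 2] involves only
   [Re F] at first order. *)
have X_pow z (y : R) : cabs z <= 1 -> 1 - 2 * lam * complex.Re F.[z] <= 2 * y ->
    cabs (X z) ^+ N <= expR y.
  move=> z1 hy; rewrite -(@ler_pXn2r _ 2) ?nnegrE ?expR_ge0 ?exprn_ge0 //.
  rewrite -exprM mulnC exprM /X cabs_one_sub_sqr -expRM_natl -addrA.
  apply: exprn_le_expR.
    by rewrite addrA -cabs_one_sub_sqr sqr_ge0.
  rewrite mulrDr; apply: le_trans hy; rewrite addrC; apply: lerD.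
    apply: le_trans Ntt; rewrite ler_pM2l // ler_pM2l ?exprn_gt0 //.
    rewrite ler_pXn2r ?nnegrE //; first exact: F_disc.
    exact: le_trans (F_disc z z1).
  by rewrite le_eqVlt; apply/orP; left; apply/eqP; rewrite -Nt; ring.
have X_disc z : cabs z <= 1 -> cabs (X z) ^+ N <= e.
  move=> z1; apply: X_pow => //; have h := ReF_disc z z1.
  have : 2 * lam * (- 3 / B) <= 2 * lam * complex.Re F.[z].
    by rewrite ler_pM2l // mulr_gt0.
  have : 6 * lam / B <= 1 by rewrite ler_pdivrMr // mul1r.
  have -> : 2 * lam * (- 3 / B) = - (6 * lam / B) by ring.
  lra.
pose psi : {poly C} := 1 - (1 - (t%:C)%C *: F) ^+ N.
have psiE z : psi.[z] = 1 - X z ^+ N by rewrite /psi /X !hornerE.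
have XX z u : X z - X u = (t%:C)%C * (F.[u] - F.[z]) by rewrite /X; ring.
have psi_lip z u : cabs z <= 1 -> cabs u <= 1 ->
    cabs (psi.[z] - psi.[u]) <= lam * e ^+ 2 * cabs (F.[z] - F.[u]).
  move=> z1 u1; rewrite !psiE.
  have -> : 1 - X z ^+ N - (1 - X u ^+ N) = X u ^+ N - X z ^+ N.
    by rewrite opprB addrC addrA subrK.
  apply: le_trans (cabs_subrXX_le ee1 (X_disc u u1) (X_disc z z1)) _.
  rewrite XX cabsM cabs_real gtr0_norm // -Nt.
  by rewrite le_eqVlt; apply/orP; left; apply/eqP; ring.
have psi0 : psi.[0] = 0 by rewrite psiE /X F0 mulr0 subr0 expr1n subrr.
have z01 : cabs (0 : C) <= 1 by rewrite cabs0.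
have psi00 : psi`_0 = 0 by rewrite -horner_coef0.
exists psi; split => //.
- move=> z z1; rewrite psiE; apply: le_trans (cabsB _ _) _.
  by rewrite cabs1 lerD2l cabsX; exact: X_disc.
- move=> z Ez; rewrite psiE addrAC subrr add0r cabsN cabsX.
  have z1 : cabs z <= 1 by rewrite (ET Ez).
  rewrite -[eps]lnK ?posrE //; apply: X_pow => //.
  have : lam * (1 / 2) <= lam * complex.Re F.[z] by rewrite ler_pM2l // ReF_E.
  rewrite /lam; lra.
- move=> z z1 hz; rewrite -[psi.[z]]subr0 -psi0; apply: le_trans (psi_lip z 0 z1 z01) _.
  rewrite F0 subr0; apply: (@le_trans _ _ (lam * e ^+ 2 * (2 / (d * B)))).
    by rewrite ler_pM2l ?mulr_gt0 ?exprn_gt0 //; exact: F_far.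
  have -> : lam * e ^+ 2 * (2 / (d * B)) = lam * e ^+ 2 * 2 / (d * eps) * (eps / B).
    by field; rewrite !gt_eqF.
  apply: (@le_trans _ _ (B * (eps / B))).
    by rewrite ler_pM2r // divr_gt0.
  by rewrite mulrC divfK // gt_eqF.
- have L0 : 0 <= lam * e ^+ 2 by rewrite mulr_ge0 ?exprn_ge0 // ltW.
  have h : dirint psi <= 2 * (lam * e ^+ 2) ^+ 2 * dirint F.
    by apply: dirint_lip => // z u z1 u1; apply: psi_lip; rewrite ?z1 ?u1.
  have h2 := dn_le_dirint psi00.
  have dF : dirint F <= B^-1.
    rewrite /F dirintZ dirint_potential -/En cabs_real gtr0_norm //.
    have -> : c ^+ 2 * En = c * m by rewrite /c; field; rewrite gt_eqF.
    by rewrite -[leRHS]mul1r ler_pdivlMr.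
  rewrite -(@ler_pXn2r _ 2) ?nnegrE ?(ltW e0) //; apply: le_trans h2 _.
  apply: (@le_trans _ _ (2 * (2 * (lam * e ^+ 2) ^+ 2 * B^-1))).
    rewrite ler_pM2l //; apply: le_trans h _.
    by apply: ler_wpM2l; rewrite // mulr_ge0 // sqr_ge0.
  have -> : 2 * (2 * (lam * e ^+ 2) ^+ 2 / B) = 4 * lam ^+ 2 * e ^+ 4 / eps ^+ 2 * (eps ^+ 2 / B).
    by field; rewrite !gt_eqF.
  apply: (@le_trans _ _ (B * (eps ^+ 2 / B))).
    by rewrite ler_pM2r // divr_gt0 // exprn_gt0.
  by rewrite mulrC divfK // gt_eqF.
Qed.

End PeakPolynomial.

(** * Zero-free interpolation *)

Section ComplexRoots.
Context {R : realType}.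
Local Notation C := R[i].

Lemma circD (a b : R) : toC (circ (a + b)) = toC (circ a) * toC (circ b) :> C.
Proof.
by apply/eqP; rewrite eq_complex /= cosD sinD; apply/andP; split; apply/eqP; ring.
Qed.

Lemma circ0 : toC (circ 0) = 1 :> C.
Proof. by rewrite /toC /= cos0 sin0. Qed.

Lemma circMn (a : R) n : toC (circ (n%:R * a)) = toC (circ a) ^+ n :> C.
Proof.
elim: n => [|n IH]; first by rewrite mul0r circ0.
by rewrite -natr1 mulrDl mul1r circD IH exprSr.
Qed.

Lemma expR_sub1_le (y : R) : `|expR y - 1| <= `|y| * expR `|y|.
Proof.
have h1 := expR_ge1Dx y; have h2 := expR_ge1Dx (- y).
have h3 : (1 - y) * expR y <= 1.
  by rewrite -[leRHS](mulVf (lt0r_neq0 (expR_gt0 y))) ler_pM2r ?expR_gt0 // -expRN.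
have e1 : 1 <= expR `|y| by rewrite -[leLHS]expR0 ler_expR.
have y0 : 0 <= `|y| by [].
have ya : y <= `|y| by exact: ler_norm.
have yb : - `|y| <= y by rewrite lerNl -normrN ler_norm.
have ee : expR y <= expR `|y| by rewrite ler_expR.
rewrite ler_norml; apply/andP; split.
  have : `|y| <= `|y| * expR `|y| by rewrite ler_peMr.
  lra.
have : y * expR y <= `|y| * expR `|y|.
  apply: le_trans (_ : `|y| * expR y <= _); first by rewrite ler_pM2r ?expR_gt0.
  by apply: ler_wpM2l.
rewrite mulrBl mul1r in h3; lra.
Qed.

(* The [n]-th root of [s] closest to [1] is [1 + O(1/n)]. *)
Lemma root_near_one (s : C) : s != 0 -> exists2 K : R, 0 <= K &
  forall n, (0 < n)%N -> exists2 c : C, cabs c <= K & (1 + c / n%:R) ^+ n = s.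
Proof.
move=> s0; have r0 : 0 < cabs s by rewrite cabs_gt0.
set r := cabs s in r0; pose x := ln r.
have rC : (r%:C)%C != 0 :> C by rewrite -cabs_gt0 cabs_real normr_gt0 gt_eqF.
have [|th hth sth] := @circ_surj R (s / (r%:C)%C).
  by rewrite cabsM cabsV cabs_real gtr0_norm // divff // gt_eqF.
exists (expR `|x| * (8 + `|x|)); first by rewrite mulr_ge0 ?expR_ge0 ?addr_ge0.
move=> n n0; have n0R : 0 < n%:R :> R by rewrite ltr0n.
have n1R : 1 <= n%:R :> R by rewrite ler1n.
(* Polar form: the logarithm of the modulus and the angle are both divided by [n]. The 8 in the
   bound is the angle bound 4 doubled by [circ_lip]. *)
pose rt : C := ((expR (x / n%:R))%:C)%C * toC (circ (th / n%:R)).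
have nC : (n%:R : C) != 0 by rewrite pnatr_eq0 -lt0n.
exists (n%:R * (rt - 1)); last first.
  rewrite [n%:R * _]mulrC mulfK // addrC subrK /rt exprMn -circMn -rmorphXn /=.
  rewrite -expRM_natl [n%:R * (x / _)]mulrC [n%:R * (th / _)]mulrC !divfK ?gt_eqF //.
  by rewrite /x lnK ?posrE // -sth mulrC divfK.
rewrite cabsM cabs_nat.
have xn : `|x / n%:R| = `|x| / n%:R by rewrite normrM normfV (gtr0_norm n0R).
have xle : `|x / n%:R| <= `|x|.
  by rewrite xn ler_pdivrMr // ler_peMr.
have e1 : expR `|x / n%:R| <= expR `|x| by rewrite ler_expR.
have -> : rt - 1 = ((expR (x / n%:R))%:C)%C * (toC (circ (th / n%:R)) - toC (circ 0)) +
    ((expR (x / n%:R) - 1)%:C)%C.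
  by rewrite circ0 /rt rmorphB /=; ring.
have h1 : cabs (((expR (x / n%:R))%:C)%C * (toC (circ (th / n%:R)) - toC (circ 0))) <=
    expR `|x| * (8 / n%:R).
  rewrite cabsM cabs_real ger0_norm ?expR_ge0 //; apply: ler_pM; rewrite ?expR_ge0 //.
    by apply: le_trans e1; rewrite ler_expR ler_norm.
  apply: le_trans (circ_lip _ _) _; rewrite subr0 normrM normfV (gtr0_norm n0R).
  rewrite mulrA ler_pM2r ?invr_gt0 //.
  have : `|th| <= 4 by rewrite ler_norml.
  lra.
have h2 : cabs (((expR (x / n%:R) - 1)%:C)%C : C) <= `|x| / n%:R * expR `|x|.
  rewrite cabs_real; apply: le_trans (expR_sub1_le _) _; rewrite xn.
  by apply: ler_wpM2l; [rewrite divr_ge0 | rewrite -xn].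
have -> : expR `|x| * (8 + `|x|) =
   n%:R * (expR `|x| * (8 / n%:R) + `|x| / n%:R * expR `|x|).
  by field; rewrite gt_eqF.
rewrite ler_pM2l //; apply: le_trans (cabsD _ _) _; exact: lerD.
Qed.

End ComplexRoots.

(** * Prescribing values on the set by a zero-free polynomial *)

Section ZeroFreeInterpolation.
Context {R : realType}.
Local Notation C := R[i].

Lemma uniform_continuity (E : set C) (g : C -> C) (e : R) :
  in_circle E -> closed_in_C E -> continuous_on E g -> 0 < e ->
  exists2 d, 0 < d & forall z w, E z -> E w -> cabs (z - w) <= d -> cabs (g z - g w) < e.
Proof.
move=> ET Ecl cg e0; apply: contrapT => hn.
have h n : exists zw : C * C, [/\ E zw.1, E zw.2, cabs (zw.1 - zw.2) <= n.+1%:R^-1 &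
    e <= cabs (g zw.1 - g zw.2)].
  apply: contrapT => h; apply: hn; exists n.+1%:R^-1; first by rewrite invr_gt0.
  move=> z w Ez Ew zw; rewrite ltNge; apply/negP => hlt; apply: h.
  by exists (z, w).
have {h} [zw h] := choice h.
have [L hL] : exists L : C, forall e, 0 < e -> ultra [set n | cabs ((zw n).1 - L) < e].
  by apply: (@ulimC_exists _ (fun n => (zw n).1) 1) => n; rewrite ET //; case: (h n).
have EL : E L by apply: (closed_ulim Ecl _ hL) => n; case: (h n).
have e2 : 0 < e / 2 by rewrite divr_gt0.
have [d d0 hd] := cg L EL _ e2.
have d2 : 0 < d / 2 by rewrite divr_gt0.
have [N hN] := inv_nat_small d2.
have [n Nn /= hn'] := ultra_large N (hL _ d2).
have [E1 E2 h3 h4] := h n; have h5 := hN n Nn.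
have g1 : cabs (g (zw n).1 - g L) < e / 2 by apply: hd => //; lra.
have g2 : cabs (g (zw n).2 - g L) < e / 2.
  apply: hd => //; apply: le_lt_trans (cabs_triB _ (zw n).1 _) _.
  rewrite cabsBC; have := le_lt_trans h3 h5; lra.
have := cabs_triB (g (zw n).1) (g L) (g (zw n).2); rewrite (cabsBC (g L)); lra.
Qed.

(** The complement is a countable union of rational boxes missing [F]; comparing masses in
    [log_capacity_zeroS] relies on this measurability. *)
Lemma measurable_outside (F : set C) : closed_in_C F ->
  measurable [set p : R * R | ~ F (toC p)].
Proof.
move=> Fcl.
pose box (q : rat * rat * rat) : set (R * R) :=
  [set p | `|p.1 - ratr q.1.1| < ratr q.2 /\ `|p.2 - ratr q.1.2| < ratr q.2].
pose G (n : nat) : set (R * R) :=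
  if unpickle n is Some q then
    [set p | box q p /\ forall p', box q p' -> ~ F (toC p')] else set0.
have -> : [set p : R * R | ~ F (toC p)] = \bigcup_n G n.
  apply/seteqP; split=> [p /= nF|p [n _]]; last first.
    by rewrite /G; case: unpickle => // q [h1 h2]; exact: h2.
  have [e e0 he] : exists2 e : R, 0 < e & forall w, F w -> e <= cabs (toC p - w).
    apply: contrapT => hn; apply: nF; apply: Fcl => e e0.
    apply: contrapT => hw; apply: hn; exists e => // w Fw.
    by rewrite leNgt; apply/negP => lt; apply: hw; exists w.
  have e4 : 0 < e / 8 by rewrite divr_gt0.
  have [r hr] : exists r : rat, 0 < (ratr r : R) < e / 8.
    have [r] := rat_in_itvoo e4; rewrite in_itv /= => hr; by exists r.
  have /andP[r0 r1] := hr.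
  have near (x : R) : exists q : rat, `|x - ratr q| < ratr r.
    have : x < x + ratr r by rewrite ltrDl.
    move=> /rat_in_itvoo [q]; rewrite in_itv /= => /andP[h1 h2]; exists q.
    rewrite ltr_norml; lra.
  have [q1 h1] := near p.1; have [q2 h2] := near p.2.
  exists (pickle (q1, q2, r)); [exact: I|rewrite /G pickleK].
  split; first by split.
  move=> p' [h3 h4] Fp'.
  have := he _ Fp'; apply/negP; rewrite -ltNge.
  apply: le_lt_trans (cabs_le_ReIm _) _; rewrite ReD ImD ReN ImN /=.
  rewrite /= in h1 h2 h3 h4.
  have t1 := ler_distD (ratr q1) p.1 p'.1; have t2 := ler_distD (ratr q2) p.2 p'.2.
  rewrite (distrC (ratr q1)) in t1; rewrite (distrC (ratr q2)) in t2; lra.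
apply: bigcupT_measurable => n; rewrite /G; case: unpickle => [q|]; last exact: measurable0.
have [hq|hq] := pselect (forall p', box q p' -> ~ F (toC p')); last first.
  rewrite (_ : [set _ | _] = set0); first exact: measurable0.
  by apply/seteqP; split=> // p [].
rewrite (_ : [set _ | _] = [set x : R | `|x - ratr q.1.1| < ratr q.2] `*`
    [set x : R | `|x - ratr q.1.2| < ratr q.2]); last first.
  by apply/seteqP; split=> [p [[h1 h2] _]|p [h1 h2]]; [split | split].
have mI (a b : R) : measurable [set x : R | `|x - a| < b].
  rewrite (_ : [set _ | _] = `]a - b, a + b[%classic); first exact: measurable_itv.
  by apply/seteqP; split=> x /=; rewrite in_itv /= ltr_norml => /andP[]; lra.
by apply: measurableX.
Qed.

Lemma log_capacity_zeroS (E F : set C) : closed_in_C F -> (forall z, F z -> E z) ->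
  closed_in_C E -> log_capacity_zero E -> log_capacity_zero F.
Proof.
move=> Fcl FE Ecl Ecap mu muF; apply: Ecap; apply/eqP; rewrite eq_le measure_ge0 andbT.
rewrite -muF; apply: le_measure.
- by rewrite inE; exact: measurable_outside.
- by rewrite inE; exact: measurable_outside.
- by move=> p /= nE Fp; apply: nE; exact: FE.
Qed.

Lemma dirint_le_dn (p : {poly C}) : dirint p <= dn (pc p) ^+ 2.
Proof.
apply: le_trans (dsum_le_dn (size p) (inD_pc p)).
by apply: ler_sum => k _; apply: ler_wpM2r; [exact: sqr_ge0 | rewrite ler_nat].
Qed.

Variable E : set C.
Hypotheses (ET : in_circle E) (Ecl : closed_in_C E) (Ecap : log_capacity_zero E).

(** [v = (1 + w / N) ^ N] with [w] the sum of the [c j *: psi j] over the cells: on the cell [j] it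
    is close to [(1 + c j / N) ^ N], which equals the prescribed value exactly, and it has no zeros
    on the closed disc once [N] exceeds the [l1] norm of [w]. The choices are made in the order [K],
    [eps], [psi], [N], [c], which is possible because the bounds [K] of [root_near_one] do not
    depend on [N]. *)
Lemma zero_free_interpolation (h : C -> C) (e : R) :
  continuous_on E h -> (forall z, E z -> h z != 0) -> 0 < e ->
  exists v : {poly C}, [/\ fast v, dn (pc (v - 1)) < e &
    forall z, E z -> cabs (v.[z] - h z) < e].
Proof.
move=> ch h0 e0; have e2 : 0 < e / 2 by rewrite divr_gt0.
have [dl dl0 hdl] := uniform_continuity ET Ecl ch e2.
have [J [cell [d [d0 cJ cin cout]]]] := cell_partition ET Ecl Ecap dl0.
have hs j : exists sK : C * R, 0 <= sK.2 /\
    (forall z, E z -> cell z = j -> cabs (sK.1 - h z) < e / 2) /\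
    forall n, (0 < n)%N -> exists2 c : C, cabs c <= sK.2 & (1 + c / n%:R) ^+ n = sK.1.
  have [[z [Ez zj]]|none] := pselect (exists z, E z /\ cell z = j).
    have [K K0 hK] := root_near_one (h0 z Ez).
    exists (h z, K); split=> //; split=> // w Ew wj /=.
    by apply: hdl => //; apply: cin; rewrite ?zj ?wj.
  exists (1, 0); split=> //=; split=> [z Ez zj|n _]; first by case: none; exists z.
  by exists 0; rewrite ?cabs0 // mul0r addr0 expr1n.
have {hs} [sK hs] := choice hs.
pose K j := (sK j).2; pose s j := (sK j).1.
have K0 j : 0 <= K j by case: (hs j).
pose Kt := \sum_(j < J) K j; have Kt0 : 0 <= Kt by exact: sumr_ge0.
(* [W] bounds [w] on the disc and also the [c j], so both lie where the power is Lipschitz with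
   constant [M ^ 2]. *)
pose W : R := Kt * (1 + expR 1).
have W0 : 0 <= W by rewrite mulr_ge0 // addr_ge0 ?expR_ge0.
have KW : Kt <= W by rewrite ler_peMr // lerDl expR_ge0.
pose M := expR W; have M1 : 1 <= M by rewrite /M -[leLHS]expR0 ler_expR.
have M0 : 0 < M by rewrite expR_gt0.
(* The errors to come are [M ^ 2 * Kt * eps] on [E] and twice this in norm. *)
pose eps : R := Num.min 1 (e / (4 * M ^+ 2 * (Kt + 1))).
have D0 : 0 < 4 * M ^+ 2 * (Kt + 1) by rewrite !mulr_gt0 ?exprn_gt0 // ltr_wpDl.
have eps0 : 0 < eps by rewrite lt_min ltr01 divr_gt0.
have eps1 : eps <= 1 by rewrite ge_min lexx.
have epsK : 2 * M ^+ 2 * (Kt * eps) < e.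
  have : eps <= e / (4 * M ^+ 2 * (Kt + 1)) by rewrite ge_min lexx orbT.
  rewrite ler_pdivlMr // => h1.
  have p1 : 0 <= M ^+ 2 * (Kt * eps).
    by rewrite mulr_ge0 ?exprn_ge0 ?(ltW M0) // mulr_ge0 // ltW.
  have p2 : 0 < M ^+ 2 * eps by rewrite mulr_gt0 ?exprn_gt0.
  have e' : eps * (4 * M ^+ 2 * (Kt + 1)) = 4 * (M ^+ 2 * (Kt * eps)) + 4 * (M ^+ 2 * eps).
    by ring.
  rewrite e' in h1; rewrite -mulrA; lra.
have hpsi j : exists psi : {poly C}, [/\ psi`_0 = 0,
    forall z, cabs z <= 1 -> cabs psi.[z] <= 1 + expR 1,
    forall z, E z -> cell z = j -> cabs (psi.[z] - 1) <= eps,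
    forall z, E z -> cell z <> j -> cabs psi.[z] <= eps &
    dn (pc psi) <= eps].
  pose Ej : set C := [set z | E z /\ cell z = j].
  have [ne|none] := pselect (exists z, Ej z); last first.
    exists 0; split; rewrite ?coef0 //.
    - by move=> z _; rewrite horner0 cabs0 addr_ge0 ?expR_ge0.
    - by move=> z Ez zj; case: none; exists z.
    - by move=> z _ _; rewrite horner0 cabs0 ltW.
    - apply: le_trans (dn_le_l1 _) _; rewrite /l1 size_poly0 mul0r; exact: ltW.
  have EjT : in_circle Ej by move=> z [Ez _]; exact: ET.
  have Ejcl : closed_in_C Ej.
    move=> z hz; have Ez : E z.
      by apply: Ecl => r r0; have [w [Ew _] zw] := hz r r0; exists w.
    (* A point of [Ej] within [d] of [z] lies in the same cell as [z], since the cells are [d]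
       apart. *)
    split=> //; have [w [Ew <-] zw] := hz d d0.
    apply/eqP; apply: contraT => /eqP ne'.
    by have := cout z w Ez Ew ne'; rewrite leNgt zw.
  have Ejcap : log_capacity_zero Ej.
    by apply: (log_capacity_zeroS _ _ Ecl Ecap) => // z [].
  have eps01 : 0 < eps <= 1 by rewrite eps0.
  have [psi [p0 p1 p2 p3 p4]] := peak_polynomial EjT Ejcl Ejcap eps01 d0 ne.
  exists psi; split=> //.
    by move=> z Ez zj; apply: p2.
  move=> z Ez zj; apply: p3; first by rewrite ET.
  by move=> w [Ew wj]; apply: cout => // zw; apply: zj; rewrite zw.
have {hpsi} [psi hpsi] := choice hpsi.
(* A bound for [l1 w] in terms of [K] alone, as [N] has to be fixed before the [c j]. *)
pose Lw := \sum_(j < J) K j * l1 (psi j).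
have Lw0 : 0 <= Lw by apply: sumr_ge0 => j _; rewrite mulr_ge0.
have [N N0 NL] : exists2 N : nat, (0 < N)%N & Lw < N%:R.
  by exists (Num.truncn Lw).+1; rewrite ?truncnS_gt.
have N0R : 0 < N%:R :> R by rewrite ltr0n.
have NC : (N%:R : C) != 0 by rewrite pnatr_eq0 -lt0n.
have hc j : exists c : C, cabs c <= K j /\ (1 + c / N%:R) ^+ N = s j.
  by have [_ [_ h3]] := hs j; have [c c1 c2] := h3 N N0; exists c.
have {hc} [c hc] := choice hc.
pose w : {poly C} := \sum_(j < J) c j *: psi j.
have wE z : w.[z] = \sum_(j < J) c j * (psi j).[z].
  by rewrite horner_sum; apply: eq_bigr => j _; rewrite hornerZ.
have sumK (F : nat -> C) (b : R) : (forall j, (j < J)%N -> cabs (F j) <= b) -> 0 <= b ->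
    cabs (\sum_(j < J) c j * F j) <= Kt * b.
  move=> hF b0; apply: le_trans (cabs_sum _ _ _) _; rewrite mulr_suml.
  by apply: ler_sum => j _; rewrite cabsM; apply: ler_pM => //; [case: (hc j) | exact: hF].
have w_disc z : cabs z <= 1 -> cabs w.[z] <= W.
  move=> z1; rewrite wE; apply: (sumK (fun j => (psi j).[z])); last by rewrite addr_ge0 ?expR_ge0.
  by move=> j _; case: (hpsi j) => _ h2 _ _ _; exact: h2.
have w_E z : E z -> cabs (w.[z] - c (cell z)) <= Kt * eps.
  move=> Ez.
  have -> : w.[z] - c (cell z) =
     \sum_(j < J) c j * ((psi j).[z] - (val j == cell z)%:R).
    rewrite wE [X in _ - X](_ : _ = \sum_(j < J) c j * (val j == cell z)%:R).
      by rewrite -sumrB; apply: eq_bigr => j _; rewrite mulrBr.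
    rewrite (bigD1 (Ordinal (cJ z))) //= eqxx mulr1 big1 ?addr0 // => j jz.
    by case: eqP => [jc|_]; [case/eqP: jz; apply: val_inj | rewrite mulr0].
  apply: (sumK (fun j => (psi j).[z] - (j == cell z)%:R)); last exact: ltW.
  move=> j _; have [_ _ h3 h4 _] := hpsi j.
  by case: eqP => [jc|jc]; [apply: h3 | rewrite subr0; apply: h4 => // /esym].
have dw : dn (pc w) <= Kt * eps.
  have hD (j : 'I_J) : inD (fun k => c j * pc (psi j) k) by have [] := dnZ (c j) (inD_pc (psi j)).
  have [_ h2] := dn_sum (index_enum 'I_J) hD.
  rewrite (eq_dn (b := fun k => \sum_(j < J) c j * pc (psi j) k)); last first.
    by move=> k; rewrite /pc coef_sum; apply: eq_bigr => j _; rewrite coefZ.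
  apply: le_trans h2 _; rewrite mulr_suml; apply: ler_sum => j _.
  apply: le_trans (dnZ (c j) (inD_pc (psi j))).2 _; apply: ler_pM => //.
    by case: (hc j).
  by case: (hpsi j).
have w0 : w.[0] = 0.
  by rewrite wE big1 // => j _; rewrite horner_coef0; case: (hpsi j) => -> *; rewrite mulr0.
have lw : l1 w <= Lw.
  apply: le_trans (l1_sum _ _) _; apply: ler_sum => j _.
  apply: le_trans (l1Z _ _) _; apply: ler_wpM2r => //; by case: (hc j).
pose x (y : C) : C := 1 + y / N%:R.
have x_pow y : cabs y <= W -> cabs (x y) ^+ N <= M.
  move=> yW; apply: (@le_trans _ _ ((1 + W / N%:R) ^+ N)).
    rewrite lerXn2r ?nnegrE // ?addr_ge0 ?divr_ge0 //.
    apply: le_trans (cabsD _ _) _; rewrite cabs1 lerD2l cabsM cabs_inv_nat.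
    by rewrite ler_pM2r ?invr_gt0.
  apply: exprn_le_expR; first by rewrite addr_ge0 ?divr_ge0.
  by rewrite mulrC divfK ?gt_eqF.
have x_sub y y' : cabs y <= W -> cabs y' <= W ->
    cabs (x y ^+ N - x y' ^+ N) <= M ^+ 2 * cabs (y - y').
  move=> h1 h2; apply: le_trans (cabs_subrXX_le M1 (x_pow y h1) (x_pow y' h2)) _.
  have -> : x y - x y' = (y - y') / N%:R by rewrite /x mulrBl; ring.
  rewrite cabsM cabs_inv_nat le_eqVlt; apply/orP; left; apply/eqP.
  by field; rewrite gt_eqF.
(* Written with a base of the form [1 - u] to match [fast_near_one]. *)
pose v : {poly C} := (1 - (- N%:R^-1) *: w) ^+ N.
have vE z : v.[z] = x w.[z] ^+ N.
  by rewrite /v /x !hornerE mulNr opprK mulrC.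
have M20 : 0 < M ^+ 2 by rewrite exprn_gt0.
have fv : fast v.
  apply: fastX; apply: fast_near_one; apply: le_lt_trans (l1Z _ _) _.
  rewrite cabsN cabs_inv_nat mulrC ltr_pdivrMr // mul1r.
  exact: le_lt_trans lw NL.
clearbody v; exists v; split=> //.
- have v0 : (v - 1)`_0 = 0.
    by rewrite -horner_coef0 !hornerE vE w0 /x mul0r addr0 expr1n subrr.
  have hl : dirint (v - 1) <= 2 * (M ^+ 2) ^+ 2 * dirint w.
    apply: dirint_lip; first exact: ltW.
    move=> z u z1 u1; rewrite !hornerE !vE.
    have -> : x w.[z] ^+ N - 1 - (x w.[u] ^+ N - 1) = x w.[z] ^+ N - x w.[u] ^+ N.
      by rewrite opprB addrA subrK.
    by apply: x_sub; apply: w_disc; rewrite ?z1 ?u1.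
  apply: le_lt_trans epsK; have h2 := dn_le_dirint v0; have h3 := dirint_le_dn w.
  have p : 0 <= 2 * M ^+ 2 * dn (pc w) by rewrite mulr_ge0 // mulr_ge0 // ltW.
  apply: (@le_trans _ _ (2 * M ^+ 2 * dn (pc w))); last by rewrite ler_pM2l // mulr_gt0.
  rewrite -(@ler_pXn2r _ 2) ?nnegrE //; apply: le_trans h2 _.
  have -> : (2 * M ^+ 2 * dn (pc w)) ^+ 2 = 2 * (2 * (M ^+ 2) ^+ 2 * dn (pc w) ^+ 2) by ring.
  rewrite ler_pM2l //; apply: le_trans hl _; rewrite ler_pM2l // mulr_gt0 // exprn_gt0 //.
- move=> z Ez; rewrite vE; set j := cell z.
  have [_ [h2 _]] := hs j; have {}h2 := h2 z Ez erefl.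
  have [cK cs] := hc j.
  have cW : cabs (c j) <= W.
    apply: le_trans cK _; apply: le_trans KW; rewrite /Kt (bigD1 (Ordinal (cJ z))) //=.
    by rewrite lerDl sumr_ge0.
  apply: le_lt_trans (cabs_triB _ (s j) _) _; rewrite -cs.
  have wW : cabs w.[z] <= W by apply: w_disc; rewrite ET.
  have h4 := x_sub w.[z] (c j) wW cW.
  have h5 : M ^+ 2 * cabs (w.[z] - c j) <= M ^+ 2 * (Kt * eps) by rewrite ler_pM2l // w_E.
  rewrite /x in h4; rewrite -/(s j) -cs in h2; rewrite -mulrA in epsK.
  have := le_trans h4 h5; rewrite /x; lra.
Qed.

End ZeroFreeInterpolation.

(** * Universality and category *)

Section ContinuousOn.
Context {R : realType}.
Local Notation C := R[i].
Implicit Types (E : set C) (g h : C -> C).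

Lemma continuous_onD E g h : continuous_on E g -> continuous_on E h ->
  continuous_on E (fun z => g z + h z).
Proof.
move=> cg ch z Ez e e0; have e2 : 0 < e / 2 by rewrite divr_gt0.
have [d1 d10 h1] := cg z Ez _ e2; have [d2 d20 h2] := ch z Ez _ e2.
exists (Num.min d1 d2); first by rewrite lt_min d10.
move=> w Ew; rewrite lt_min => /andP[w1 w2].
have -> : g w + h w - (g z + h z) = (g w - g z) + (h w - h z) by ring.
apply: le_lt_trans (cabsD _ _) _; rewrite [e]splitr.
by apply: ltrD; [exact: h1 | exact: h2].
Qed.

Lemma continuous_onM E g h : continuous_on E g -> continuous_on E h ->
  continuous_on E (fun z => g z * h z).
Proof.
move=> cg ch z Ez e e0; set a := cabs (g z); set b := cabs (h z).
have a0 : 0 <= a by exact: cabs_ge0.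
have b0 : 0 <= b by exact: cabs_ge0.
have e1 : 0 < Num.min 1 (e / 2 / (b + 1)).
  by rewrite lt_min ltr01 !divr_gt0 // ltr_wpDl.
have e2 : 0 < e / 2 / (a + 1) by rewrite !divr_gt0 // ltr_wpDl.
have [d1 d10 h1] := cg z Ez _ e1; have [d2 d20 h2] := ch z Ez _ e2.
exists (Num.min d1 d2); first by rewrite lt_min d10.
move=> w Ew; rewrite lt_min => /andP[w1 w2].
have := h1 w Ew w1; rewrite lt_min => /andP[g1 g2]; have g3 := h2 w Ew w2.
have -> : g w * h w - g z * h z = g w * (h w - h z) + (g w - g z) * h z by ring.
apply: le_lt_trans (cabsD _ _) _; rewrite !cabsM.
have gw : cabs (g w) <= a + 1.
  have := cabs_triB (g w) (g z) 0; rewrite !subr0; rewrite -/a; lra.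
rewrite ltr_pdivlMr ?ltr_wpDl // in g2; rewrite ltr_pdivlMr ?ltr_wpDl // in g3.
have t1 : cabs (g w) * cabs (h w - h z) <= cabs (h w - h z) * (a + 1).
  by rewrite mulrC; apply: ler_wpM2l.
have t2 : cabs (g w - g z) * cabs (h z) <= cabs (g w - g z) * (b + 1).
  by apply: ler_wpM2l => //; rewrite lerDl.
lra.
Qed.

Lemma continuous_onV E g : continuous_on E g -> (forall z, E z -> g z != 0) ->
  continuous_on E (fun z => (g z)^-1).
Proof.
move=> cg g0 z Ez e e0; set a := cabs (g z).
have a0 : 0 < a by rewrite cabs_gt0 g0.
have e1 : 0 < Num.min (a / 2) (e * (a ^+ 2 / 2)).
  by rewrite lt_min !mulr_gt0 ?invr_gt0 ?exprn_gt0.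
have [d d0 hd] := cg z Ez _ e1; exists d => // w Ew wz.
have := hd w Ew wz; rewrite lt_min => /andP[g1 g2].
have gw : a / 2 < cabs (g w).
  have := cabs_triB (g z) (g w) 0; rewrite !subr0 cabsBC -/a; lra.
have gw0 : 0 < cabs (g w) by apply: lt_trans gw; rewrite divr_gt0.
have -> : (g w)^-1 - (g z)^-1 = (g z - g w) / (g w * g z).
  by field; rewrite !g0.
rewrite cabsM cabsV cabsM -/a ltr_pdivrMr ?mulr_gt0 // cabsBC.
apply: lt_le_trans g2 _; rewrite ler_pM2l //.
have : a * (a / 2) <= a * cabs (g w) by rewrite ler_pM2l // ltW.
by rewrite mulrA -expr2 [a * _]mulrC.
Qed.

Lemma continuous_on_horner E (p : {poly C}) : continuous_on E (fun z => p.[z]).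
Proof.
have cst c : continuous_on E (fun=> c).
  by move=> z _ e e0; exists 1 => // w _ _; rewrite subrr cabs0.
have idc : continuous_on E id by move=> z _ e e0; exists e.
elim/poly_ind: p => [|p c IH].
  by have := cst 0; congr continuous_on; apply/funext => z; rewrite horner0.
have := continuous_onD (continuous_onM IH idc) (cst c).
by congr continuous_on; apply/funext => z; rewrite !hornerE.
Qed.

Lemma continuous_on_bounded E g : in_circle E -> closed_in_C E -> continuous_on E g ->
  exists2 B : R, 1 <= B & forall z, E z -> cabs (g z) <= B.
Proof.
move=> ET Ecl cg; apply: contrapT => hn.
have h n : exists z, E z /\ n.+1%:R < cabs (g z).
  apply: contrapT => h; apply: hn; exists n.+1%:R; first by rewrite ler1n.
  by move=> z Ez; rewrite leNgt; apply/negP => lt; apply: h; exists z.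
have {h} [x h] := choice h.
have [L hL] : exists L : C, forall e, 0 < e -> ultra [set n | cabs (x n - L) < e].
  by apply: (@ulimC_exists _ x 1) => n; rewrite ET //; case: (h n).
have EL : E L by apply: (closed_ulim Ecl _ hL) => n; case: (h n).
have [d d0 hd] := cg L EL 1 ltr01.
pose N := Num.truncn (cabs (g L) + 1).
have [n Nn /= xn] := ultra_large N (hL d d0).
have [Ex lt] := h n; have := hd _ Ex xn.
have := cabs_triB (g (x n)) (g L) 0; rewrite !subr0.
have : cabs (g L) + 1 < n.+1%:R.
  by apply: lt_le_trans (truncnS_gt _) _; rewrite ler_nat.
lra.
Qed.

End ContinuousOn.

(** * A countable dense family of nonvanishing functions *)

Section CountableFamily.
Context {R : realType}.
Local Notation C := R[i].

Lemma nonzero_rational_approx (w : C) (e : R) : 0 < e -> exists q : rat * rat,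
  ((ratr q.1 +i* ratr q.2)%C != 0 :> C) && (cabs ((ratr q.1 +i* ratr q.2)%C - w) < e).
Proof.
move=> e0; have e2 : 0 < e / 2 by rewrite divr_gt0.
have [q1 q10 hq1] : exists2 q : rat, (ratr q : R) != 0 & `|ratr q - complex.Re w| < e / 2.
  have [r0|r0] := leP 0 (complex.Re w).
    have : complex.Re w < complex.Re w + e / 2 by rewrite ltrDl.
    move=> /rat_in_itvoo [q]; rewrite in_itv /= => /andP[h1 h2]; exists q.
      by rewrite gt_eqF //; exact: le_lt_trans h1.
    by rewrite ltr_norml; lra.
  have : complex.Re w - e / 2 < complex.Re w by rewrite ltrBlDr ltrDl.
  move=> /rat_in_itvoo [q]; rewrite in_itv /= => /andP[h1 h2]; exists q.
    by rewrite lt_eqF //; exact: lt_trans r0.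
  by rewrite ltr_norml; lra.
have [q2 hq2] : exists q : rat, `|ratr q - complex.Im w| < e / 2.
  have : complex.Im w < complex.Im w + e / 2 by rewrite ltrDl.
  move=> /rat_in_itvoo [q]; rewrite in_itv /= => /andP[h1 h2]; exists q.
  by rewrite ltr_norml; lra.
exists (q1, q2); apply/andP; split.
  by rewrite eq_complex negb_and q10.
apply: le_lt_trans (cabs_le_ReIm _) _; rewrite ReD ImD ReN ImN /=; lra.
Qed.

Context (E : set C) (ET : in_circle E) (Ecl : closed_in_C E) (Ecap : log_capacity_zero E).

(** Functions constant on the cells of a partition, with nonzero rational values: they are
    continuous because distinct cells are a positive distance apart. They must not vanish, as
    [univ_cond_dense] divides by them, yet they approximate even a [g] that has zeros. *)
Lemma countable_dense_family : exists G : nat -> C -> C,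
  [/\ forall n, continuous_on E (G n), forall n z, G n z != 0 &
    forall g e, continuous_on E g -> 0 < e ->
      exists n, forall z, E z -> cabs (G n z - g z) < e].
Proof.
have hP M : exists P : nat * (C -> nat) * R, [/\ 0 < P.2, forall z, (P.1.2 z < P.1.1)%N,
    forall z w, E z -> E w -> P.1.2 z = P.1.2 w -> cabs (z - w) <= M.+1%:R^-1 &
    forall z w, E z -> E w -> P.1.2 z <> P.1.2 w -> P.2 <= cabs (z - w)].
  have M0 : 0 < M.+1%:R^-1 :> R by rewrite invr_gt0.
  by have [J [cell [d h]]] := cell_partition ET Ecl Ecap M0; exists (J, cell, d).
have {hP} [P hP] := choice hP.
pose cell M := (P M).1.2.
(* A value 0 is replaced by 1, so that every code gives a nonvanishing function. *)
pose val (l : seq (rat * rat)) (j : nat) : C :=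
  let q := nth (1, 0) l j in let v := (ratr q.1 +i* ratr q.2)%C in
  if v == 0 then 1 else v.
pose G (n : nat) (z : C) : C :=
  if unpickle n is Some Ml then val Ml.2 (cell Ml.1 z) else 1.
exists G; split.
- move=> n z Ez e e0; rewrite /G; case: (unpickle n : option (nat * seq (rat * rat))) => [Ml|].
    have [d0 _ _ hd] := hP Ml.1; exists (P Ml.1).2 => // w Ew wz.
    have -> : cell Ml.1 w = cell Ml.1 z.
      apply/eqP; apply: contraT => /eqP ne.
      by have := hd w z Ew Ez ne; rewrite leNgt wz.
    by rewrite subrr cabs0.
  by exists 1 => // w _ _; rewrite subrr cabs0.
- move=> n z; rewrite /G; case: unpickle => [Ml|]; last exact: oner_neq0.
  by rewrite /val; case: ifPn => // _; exact: oner_neq0.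
- move=> g e cg e0; have e2 : 0 < e / 2 by rewrite divr_gt0.
  have [dl dl0 hdl] := uniform_continuity ET Ecl cg e2.
  have [M hM] := inv_nat_small dl0; have {}hM := hM M (leqnn _).
  have [_ cJ cin _] := hP M.
  have hq j : exists q : rat * rat, forall z, E z -> cell M z = j ->
      (ratr q.1 +i* ratr q.2)%C != 0 :> C /\
      cabs ((ratr q.1 +i* ratr q.2)%C - g z) < e.
    have [[z [Ez zj]]|none] := pselect (exists z, E z /\ cell M z = j).
      have [q /andP[q0 hq]] := nonzero_rational_approx (g z) e2.
      exists q => w Ew wj; split=> //.
      apply: le_lt_trans (cabs_triB _ (g z) _) _; rewrite [e]splitr; apply: ltrD => //.
      apply: hdl => //; apply: le_trans (ltW hM).
      by apply: cin => //; rewrite -/(cell M) zj wj.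
    by exists (1, 0) => z Ez zj; case: none; exists z.
  have {hq} [q hq] := choice hq.
  exists (pickle (M, mkseq q (P M).1.1)) => z Ez; rewrite /G pickleK /val /=.
  have [h1 h2] := hq _ z Ez erefl.
  by rewrite nth_mkseq ?cJ // (negbTE h1).
Qed.

End CountableFamily.

(** * Universality as a countable family of open dense conditions *)

Section Universality.
Context {R : realType}.
Local Notation C := R[i].
Context (E : set C) (ET : in_circle E) (Ecl : closed_in_C E) (Ecap : log_capacity_zero E).

(** The bound [e], strictly below [1 / (k + 1)], leaves a margin independent of [z]; this makes the
    condition open. *)
Definition approximates (G : nat -> C -> C) (n k n0 : nat) (a : nat -> C) : Prop :=
  exists m e, [/\ (n0 <= m)%N, e < k.+1%:R^-1 :> R &
    forall z, E z -> cabs ((Qm a m).[z] - G n z) <= e].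

(** One natural number codes the triple; a code without a triple only requires a nonzero
    function. *)
Definition univ_cond (G : nat -> C -> C) (c : nat) : set (nat -> C) :=
  [set a | inDnv a /\ ~ is_zero_fun a /\
    if unpickle c is Some (n, k, n0) then approximates G n k n0 a else True].

Context (G : nat -> C -> C).

Lemma univ_cond_open c : open_in_Dnv (univ_cond G c).
Proof.
split=> [a []//|a [ha [a0 hc]]]; have Da := ha.1; move: hc; rewrite /univ_cond /=.
case: (unpickle c : option (nat * nat * nat)) => [[[n k] n0] [m [e [nm ek he]]]|_].
  have e2 : 0 < (k.+1%:R^-1 - e) / 2 by rewrite divr_gt0 // subr_gt0.
  have [d d0 hd] := Qm_stable m Da a0 e2; exists d => // b hb ab.
  have Dab := ddist_lt_inD ab; move/ddist_ltE: ab => /(_ d0 Dab) ab.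
  have [b0 hQ] := hd b hb.1 ab; split=> //; split=> //.
  exists m, (e + (k.+1%:R^-1 - e) / 2); split=> //.
    by rewrite -ltrBrDl ltr_pdivrMr // ltr_pMr ?subr_gt0 // ltr1n.
  move=> z Ez; apply: le_trans (cabs_triB _ (Qm a m).[z] _) _.
  rewrite addrC; apply: lerD; first exact: he.
  rewrite -hornerN -hornerD; apply: le_trans (ltW hQ).
  by apply: cabs_horner_le_l1; rewrite ET.
(* For a code without a triple, [Qm_stable] is used for its first conclusion, that nearby functions
   are nonzero. *)
have [d d0 hd] := Qm_stable 0 Da a0 ltr01; exists d => // b hb ab.
have Dab := ddist_lt_inD ab; move/ddist_ltE: ab => /(_ d0 Dab) ab.
by have [b0 _] := hd b hb.1 ab.
Qed.

Context (Gc : forall n, continuous_on E (G n)) (G0 : forall n z, G n z != 0)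
  (Gd : forall g e, continuous_on E g -> 0 < e ->
      exists n, forall z, E z -> cabs (G n z - g z) < e).

Lemma UE_univ_cond a : UE E a <-> forall c, univ_cond G c a.
Proof.
split=> [[ha [a0 hU]] c|h].
  split=> //; split=> //.
  case: (unpickle c : option (nat * nat * nat)) => [[[n k] n0]|//].
  have [m [mS hm]] := hU _ (Gc n).
  have mge s : (s <= m s)%N by elim: s => // s IH; exact: leq_ltn_trans (mS s).
  have k0 : 0 < k.+1%:R^-1 / 2 :> R by rewrite divr_gt0 // invr_gt0.
  have [N hN] := hm _ k0.
  exists (m (maxn N n0)), (k.+1%:R^-1 / 2); split.
  - by apply: leq_trans (mge _); exact: leq_maxr.
  - by rewrite ltr_pdivrMr // ltr_pMr ?invr_gt0 // ltr1n.
  - by move=> z Ez; apply: ltW; apply: hN => //; exact: leq_maxl.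
have [ha [a0 _]] := h 0%N; split=> //; split=> // g cg.
have hm (x : nat * nat) : exists m, (x.2 <= m)%N /\
    forall z, E z -> cabs ((Qm a m).[z] - g z) < 2 * x.1.+1%:R^-1.
  have s0 : 0 < x.1.+1%:R^-1 :> R by rewrite invr_gt0.
  have [n hn] := Gd cg s0.
  have := h (pickle (n, x.1, x.2)); rewrite /univ_cond /= pickleK => -[_ [_ [m [e [xm ek he]]]]].
  exists m; split=> // z Ez; apply: le_lt_trans (cabs_triB _ (G n z) _) _.
  rewrite mulr_natl mulr2n; apply: ltrD; last exact: hn.
  by apply: le_lt_trans ek; exact: he.
have {hm} [F hF] := choice hm.
(* Asking for an index at least [m s' + 1] makes the sequence increase, while the tolerance improves
   with [s]. *)
pose m := fix m s := if s is s'.+1 then F (s, (m s').+1) else F (0, 0)%N.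
exists m; split=> [s|e e0]; first by have [] := hF (s.+1, (m s).+1).
have e2 : 0 < e / 2 by rewrite divr_gt0.
have [N hN] := inv_nat_small e2; exists N => s Ns z Ez.
have {}hN := hN s Ns.
apply: (@lt_trans _ _ (2 * s.+1%:R^-1)); last by rewrite mulrC -ltr_pdivlMr.
case: s {Ns hN} => [|s]; first by case: (hF (0, 0)%N) => _; exact.
by case: (hF (s.+1, (m s).+1)) => _; exact.
Qed.

Lemma univ_cond_dense c (p : {poly C}) (e : R) : fast p -> 0 < e ->
  exists2 p', fast p' & dn (pc (p' - p)) < e /\ univ_cond G c (pc p').
Proof.
move=> fp e0; rewrite /univ_cond /=.
case: (unpickle c : option (nat * nat * nat)) => [[[n k] n0]|]; last first.
  exists p => //; split; last by have [] := fast_inDnv fp.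
  by apply: le_lt_trans (dn_le_l1 _) _; rewrite subrr /l1 size_poly0 mul0r.
set t : R := k.+1%:R^-1; have t0 : 0 < t by rewrite invr_gt0.
have t1 : t <= 1 by rewrite invf_le1 ?ler1n.
have [B B1 hB] := continuous_on_bounded ET Ecl (@Gc n).
have B0 : 0 < B by apply: lt_le_trans B1.
have [c0 c00 hc0] := fast_lower fp.
have p0 z : E z -> p.[z] != 0.
  by move=> Ez; rewrite -cabs_gt0; apply: lt_le_trans c00 _; apply: hc0; rewrite ET.
pose P := l1 p + 1; have P1 : 1 <= P by rewrite lerDr.
have P0 : 0 < P by apply: lt_le_trans P1.
pose h z := (G n z * p.[z])^-1.
have gp0 z : E z -> G n z * p.[z] != 0 by move=> Ez; rewrite mulf_neq0 ?p0.
have ch : continuous_on E h.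
  by apply: continuous_onV => //; apply: continuous_onM => //; exact: continuous_on_horner.
(* These make each of the two errors [t / 8], apart from a multiple of the unknown [x] small enough
   to be absorbed. *)
pose eta1 := t / (8 * B ^+ 2 * P); pose eta2 := t / (8 * B).
have eta10 : 0 < eta1 by rewrite divr_gt0 // !mulr_gt0 // exprn_gt0.
have eta20 : 0 < eta2 by rewrite divr_gt0 // mulr_gt0.
have mb0 : 0 <= mulbound p by apply: sumr_ge0 => i _; rewrite mulr_ge0.
have eta0 : 0 < Num.min eta1 (e / (mulbound p + 1)).
  by rewrite lt_min eta10 divr_gt0 // ltr_wpDl.
have h0 z : E z -> h z != 0 by move=> Ez; rewrite invr_eq0 gp0.
have [v [fv v1 vh]] := zero_free_interpolation ET Ecl Ecap ch h0 eta0.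
have fpv : fast (p * v) by exact: fastM.
exists (p * v) => //; have [Dpv pv0] := fast_inDnv fpv; split; last split=> //; last split=> //.
  have -> : p * v - p = p * (v - 1) by rewrite mulrBr mulr1.
  rewrite -(eq_dn (pmul_pc _ _)); apply: le_lt_trans (dn_pmul _ (inD_pc _)).2 _.
  move: v1; rewrite lt_min => /andP[_]; rewrite ltr_pdivlMr ?ltr_wpDl //.
  apply: le_lt_trans; rewrite mulrC; apply: ler_wpM2l => //; by rewrite lerDl.
have [m nm hm] := fast_Qm n0 fpv eta20.
exists m, (t / 2); split=> //; first by rewrite ltr_pdivrMr // ltr_pMr // ltr1n.
move: hm; set Q := Qm _ _; clearbody Q => hm z Ez.
have z1 : cabs z <= 1 by rewrite ET.
have h1 := hm z z1; have h2 := vh z Ez; have gB := hB z Ez.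
have pP : cabs p.[z] <= P.
  by apply: le_trans (cabs_horner_le_l1 p z1) _; rewrite lerDl.
have {}h2 : cabs (v.[z] - h z) < eta1 by apply: lt_le_trans h2 _; rewrite ge_min lexx.
rewrite hornerM in h1.
set x := cabs (Q.[z] - G n z).
(* [h] is the inverse of [G n] times [p]. The second term contains [Q], itself bounded by [x + B],
   so the estimate for [x] is implicit. *)
have eq1 : Q.[z] - G n z = G n z * (Q.[z] * (p.[z] * v.[z]) - 1)
    - Q.[z] * (G n z * p.[z] * (v.[z] - h z)).
  by rewrite /h; field; rewrite p0 ?G0.
have Qx : cabs Q.[z] <= x + B.
  have := cabs_triB Q.[z] (G n z) 0; rewrite !subr0 -/x; lra.
have t2 : cabs (G n z * (Q.[z] * (p.[z] * v.[z]) - 1)) <= B * eta2.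
  by rewrite cabsM; apply: ler_pM => //; exact: ltW.
have t3 : cabs (Q.[z] * (G n z * p.[z] * (v.[z] - h z))) <= (x + B) * (B * P * eta1).
  rewrite !cabsM; apply: ler_pM => //; first by rewrite !mulr_ge0.
  by apply: ler_pM; rewrite ?mulr_ge0 // ?(ltW h2) //; apply: ler_pM.
have x3 : x <= B * eta2 + (x + B) * (B * P * eta1).
  by rewrite {1}/x eq1; apply: le_trans (cabsB _ _) _; exact: lerD.
have e1 : B * eta2 = t / 8 by rewrite /eta2; field; rewrite gt_eqF.
have e2 : (x + B) * (B * P * eta1) = x * (t / (8 * B)) + t / 8.
  by rewrite /eta1; field; rewrite !gt_eqF.
have e3 : t / (8 * B) <= 1 / 2.
  rewrite ler_pdivrMr ?mulr_gt0 //; lra.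
have e4 : x * (t / (8 * B)) <= x * (1 / 2) by apply: ler_wpM2l; first exact: cabs_ge0.
rewrite e1 e2 in x3; lra.
Qed.

End Universality.

(** * Nested balls around zero-free polynomials *)

Section NestedBalls.
Context {R : realType}.
Local Notation C := R[i].

(** Jumps below [d n / 4] with halving radii add up to at most [d n / 2]. The limit is taken
    coefficientwise and its norm estimated on partial sums: for finitely many coefficients, a late
    [p m] is within [d n / 4] of the limit because the radii tend to 0. *)
Lemma fast_chain_limit (p : nat -> {poly C}) (d : nat -> R) :
  (forall n, 0 < d n) -> (forall n, d n.+1 <= d n / 2) ->
  (forall n, d n.+1 <= n.+1%:R^-1) -> (forall n, dn (pc (p n.+1 - p n)) < d n / 4) ->
  exists f : nat -> C, forall n, inD (fun k => f k - pc (p n) k) /\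
    dn (fun k => f k - pc (p n) k) < d n.
Proof.
move=> d0 dhalf dsmall dp.
have close n j : dn (pc (p (n + j)%N - p n)) <= d n / 2.
  elim: j n => [|j IH] n.
    rewrite addn0 subrr; apply: le_trans (dn_le_l1 _) _.
    by rewrite /l1 size_poly0 mul0r divr_ge0 // ltW.
  have := IH n.+1; rewrite addSnnS => h1; have h2 := dp n; have h3 := dhalf n.
  have [_] := dnD (inD_pc (p (n + j.+1)%N - p n.+1)) (inD_pc (p n.+1 - p n)).
  rewrite (eq_dn (b := pc (p (n + j.+1)%N - p n))); first lra.
  by move=> k; rewrite /pc -coefD addrA subrK.
have closeC n m k : (n <= m)%N -> cabs ((p m)`_k - (p n)`_k) <= d n / 2.
  move=> nm; rewrite -coefB -(subnKC nm).
  exact: le_trans (cabs_le_dn k (inD_pc _)) (close n (m - n)%N).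
have lim k : exists L : C, forall n, cabs (L - (p n)`_k) <= d n.
  have [n|L hL] := @ulimC_exists _ (fun n => (p n)`_k) (d 0%N / 2 + cabs (p 0%N)`_k).
    have := closeC 0%N n k (leq0n n); have := cabs_triB (p n)`_k (p 0%N)`_k 0.
    rewrite !subr0; lra.
  exists L => n; have dn2 : 0 < d n / 2 by rewrite divr_gt0.
  have [m nm /= hm] := ultra_large n (hL _ dn2).
  have := cabs_triB L (p m)`_k (p n)`_k; have := closeC n m k nm.
  rewrite cabsBC in hm; lra.
have [f hf] := choice lim; exists f => n.
have n4 : 0 < d n / 4 by rewrite divr_gt0.
have n2 : 0 < d n / 2 by rewrite divr_gt0.
have [h1 h2] : inD (fun k => f k - pc (p n) k) /\
    dn (fun k => f k - pc (p n) k) <= d n / 4 + d n / 2.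
  apply: dn_le; first by rewrite addr_ge0 // ltW.
  move=> N.
  have N0 : 0 < d n / 4 / N.+1%:R by rewrite divr_gt0.
  have [m0 hm0] := inv_nat_small N0.
  pose m := maxn m0 n; have {}hm0 := hm0 m (leq_maxl _ _).
  have dm : d m.+1 <= d n / 4 / N.+1%:R by apply: le_trans (dsmall m) (ltW hm0).
  have nm : (n <= m.+1)%N by rewrite leqW // leq_maxr.
  have -> : (fun k => f k - pc (p n) k) =
     (fun k => (f k - (p m.+1)`_k) + pc (p m.+1 - p n) k).
    by apply/funext => k; rewrite /pc coefB addrA subrK.
  apply: dsumD_le => //; last first.
    apply: le_trans (dsum_le_dn N (inD_pc _)) _; rewrite ler_pXn2r ?nnegrE ?(ltW n2) //.
    by rewrite -(subnKC nm).
  apply: (@le_trans _ _ (\sum_(k < N) N.+1%:R * (d n / 4 / N.+1%:R) ^+ 2)).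
    apply: ler_sum => k _; apply: ler_pM => //.
    - by rewrite exprn_ge0.
    - by rewrite ler_nat ltnS ltnW.
    - rewrite ler_pXn2r ?nnegrE ?(ltW N0) //; exact: le_trans (hf k m.+1) dm.
  have sc (c : R) : \sum_(i < N) c = c * N%:R by rewrite sumr_const card_ord mulr_natr.
  rewrite sc -[leRHS]mulr1; set y := d n / 4.
  have -> : N.+1%:R * (y / N.+1%:R) ^+ 2 * N%:R = y ^+ 2 * (N%:R / N.+1%:R).
    have : N.+1%:R != 0 :> R by rewrite pnatr_eq0.
    by move: (N.+1%:R : R) => c c0; field.
  apply: ler_wpM2l; first exact: sqr_ge0.
  by rewrite ler_pdivrMr // mul1r ler_nat.
split=> //; apply: le_lt_trans h2 _; have := d0 n; lra.
Qed.

(* Since [|f - p n| <= d n / (1 - |z|)] in the disc while [|p n| >= n * d n],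
   the limit cannot vanish. *)
Lemma chain_limit_zero_free (p : nat -> {poly C}) (d : nat -> R) (f : nat -> C) :
  (forall n, 0 < d n) ->
  (forall n z, cabs z <= 1 -> d n.+1 * n.+1%:R <= cabs (p n.+1).[z]) ->
  (forall n, inD (fun k => f k - pc (p n) k) /\ dn (fun k => f k - pc (p n) k) < d n) ->
  zero_free f.
Proof.
move=> d0 low hf z z1 hz; have s0 : 0 < 1 - cabs z by rewrite subr_gt0.
have [n hn] : exists n : nat, 1 + (1 - cabs z)^-1 < n.+1%:R.
  by exists (Num.truncn (1 + (1 - cabs z)^-1)); exact: truncnS_gt.
have [h1 h2] := hf n.+1; have dn1 := d0 n.+1.
have [N hN] := hz _ dn1; pose m := maxn N (size (p n.+1)).
have {}hN := hN m (leq_maxl _ _); rewrite subr0 in hN.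
have hb k : cabs (f k - pc (p n.+1) k) <= d n.+1.
  exact: le_trans (cabs_le_dn k h1) (ltW h2).
have h3 := partial_sum_le m hb z1.
have e : \sum_(k < m) (f k - pc (p n.+1) k) * z ^+ k =
    \sum_(k < m) f k * z ^+ k - (p n.+1).[z].
  rewrite -(sum_pc z (leq_maxr N (size (p n.+1)))) -sumrB.
  by apply: eq_bigr => k _; rewrite mulrBl.
rewrite e in h3.
have h4 := low n z (ltW z1).
have h5 := cabs_triB (p n.+1).[z] (\sum_(k < m) f k * z ^+ k) 0.
rewrite !subr0 (cabsBC (p n.+1).[z]) in h5.
have : d n.+1 * (1 + (1 - cabs z)^-1) < d n.+1 * n.+1%:R by rewrite ltr_pM2l.
rewrite mulrDr mulr1; lra.
Qed.

Lemma fast_baire (W : nat -> set (nat -> C)) (a : nat -> C) (e : R) :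
  (forall n, open_in_Dnv (W n)) ->
  (forall n p e, fast p -> 0 < e ->
     exists2 p', fast p' & dn (pc (p' - p)) < e /\ W n (pc p')) ->
  inDnv a -> 0 < e -> exists f, (forall n, W n f) /\ ddist_lt a f e.
Proof.
move=> Wo Wd ha e0; have e2 : 0 < e / 2 by rewrite divr_gt0.
have [p0 fp0 ap0] := approx_fast ha e2.
pose good (x : {poly C} * R) := fast x.1 /\ 0 < x.2.
pose step (n : nat) (x y : {poly C} * R) := [/\ y.2 <= x.2 / 2, y.2 <= n.+1%:R^-1,
  dn (pc (y.1 - x.1)) < x.2 / 4,
  forall b, inDnv b -> inD (fun k => b k - pc y.1 k) ->
    dn (fun k => b k - pc y.1 k) < y.2 -> W n b &
  forall z, cabs z <= 1 -> y.2 * n.+1%:R <= cabs y.1.[z]].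
have hs (nx : nat * ({poly C} * R)) : exists y, good nx.2 -> good y /\ step nx.1 nx.2 y.
  case: nx => n [p d] /=; have [[fp d0]|ng] := pselect (good (p, d)); last by exists (p, d).
  have d4 : 0 < d / 4 by rewrite divr_gt0.
  have [p' fp' [pp' Wp']] := Wd n p _ fp d4.
  have [r r0 hr] := (Wo n).2 _ Wp'; have [c c0 hc] := fast_lower fp'.
  (* In this order: halving and [1 / (n + 1)] for convergence, [r] for staying in [W n], and
     [c / (n + 1)] to keep the polynomial large compared with the radius. *)
  pose y := Num.min (Num.min (d / 2) n.+1%:R^-1) (Num.min r (c / n.+1%:R)).
  have y0 : 0 < y by rewrite !lt_min invr_gt0 r0 !divr_gt0 //= ltr0n.
  exists (p', y) => _; split; first by split.
  have y1 : y <= d / 2 by rewrite !ge_min lexx.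
  have y2 : y <= n.+1%:R^-1 by rewrite !ge_min lexx orbT.
  have y3 : y <= r by rewrite !ge_min lexx !orbT.
  have y4 : y * n.+1%:R <= c by rewrite -ler_pdivlMr // !ge_min lexx !orbT.
  split=> //=; last by move=> z z1; apply: le_trans y4 _; exact: hc.
  move=> b hb Db db; apply: hr => //; apply/ddist_ltE => //; first exact: inDBC.
  by rewrite dnBC; exact: lt_le_trans db y3.
have {hs} [F hF] := choice hs.
pose x := fix x n := if n is n'.+1 then F (n', x n') else (p0, e / 2).
have gx n : good (x n) by elim: n => [|n IH] //; have [] := hF (n, x n) IH.
have sx n : step n (x n) (x n.+1) by have [] := hF (n, x n) (gx n).
have d0 n : 0 < (x n).2 by case: (gx n).
have [f hf] : exists f : nat -> C, forall n, inD (fun k => f k - pc (x n).1 k) /\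
    dn (fun k => f k - pc (x n).1 k) < (x n).2.
  by apply: (@fast_chain_limit (fun n => (x n).1) (fun n => (x n).2)) => // n;
    case: (sx n).
(* This comes before membership in the [W n], which contain a ball only relative to the nonvanishing
   functions. *)
have zf : zero_free f.
  apply: (@chain_limit_zero_free (fun n => (x n).1) (fun n => (x n).2)) => // n z z1.
  by case: (sx n) => _ _ _ _; exact.
have Df : inD f.
  have [h _] := dnD (hf 0%N).1 (inD_pc (x 0%N).1); apply: eq_inD h => k.
  by rewrite subrK.
exists f; split.
  move=> n; case: (sx n) => _ _ _ h _; have [h1 h2] := hf n.+1.
  by apply: h => //; split=> //; right.
have [h1 h2] := hf 0%N; rewrite /= in h1 h2.
have [h3 h4] := dn_triB (dnB ha.1 (inD_pc p0)).1 (inDBC h1).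
apply/ddist_ltE => //; rewrite (dnBC (pc p0)) in h4; lra.
Qed.

End NestedBalls.

Theorem theorem4p1 (R : realType) (E : set R[i])
  (HT : in_circle E) (Hclosed : closed_in_C E) (Hcap : log_capacity_zero E) :
  dense_in_Dnv (UE E) /\ Gdelta_in_Dnv (UE E).
Proof.
have [G [Gc G0 Gd]] := countable_dense_family HT Hclosed Hcap.
have Wo n : open_in_Dnv (univ_cond E G n) by exact: univ_cond_open.
have UEE := UE_univ_cond Gc Gd.
split; last by exists (univ_cond E G).
move=> a ha e e0.
have [f [hf af]] := fast_baire Wo (univ_cond_dense HT Hclosed Hcap Gc G0) ha e0.
by exists f; split=> //; apply/UEE.
Qed.
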